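(* Let $a>0$ be fixed, and let $X,X_1,X_2,\ldots$ be i.i.d. $d$-dimensional random vectors, with distribution absolutely continuous with respect to Lebesgue measure, such that $\mathbb{E}\|X\|^4<\infty$, $\mathbb{E}(X)=0$ and $\mathbb{E}(XX^\top)=\mathrm{I}_d$. Then, as $n\to\infty$, $$\sqrt n\left(\frac{U_{n,a}}{n}-\Gamma_a\right)\longrightarrow\mathrm{N}(0,\sigma_a^2)\quad\text{in distribution},$$ where $$\sigma_a^2=4\int_{\mathbb{R}^d}\int_{\mathbb{R}^d}K^*(s,t)\,z(s)z(t)\,w_a(s)w_a(t)\,\mathrm{d}s\,\mathrm{d}t .$$
   Context: $\|\cdot\|$ is the Euclidean norm, $\mathrm{I}_d$ the identity matrix of size $d$, $\Delta$ the Laplace operator, $\nabla f(t)$ the gradient (column vector) and $\mathrm{H}f(t)$ the Hessian matrix of $f$ at $t$, and $w_a(t)=\exp(-a\|t\|^2)$. $\mathrm{N}(0,0)$ is understood as the point mass at $0$. Test statistic. For $n\ge d+1$ put $\overline X_n=n^{-1}\sum_{j=1}^nX_j$, $S_n=n^{-1}\sum_{j=1}^n(X_j-\overline X_n)(X_j-\overline X_n)^\top$ (almost surely invertible), and $Y_{n,j}=S_n^{-1/2}(X_j-\overline X_n)$, where $S_n^{-1/2}$ is the unique symmetric positive definite square root of $S_n^{-1}$. Let $\psi_n(t)=n^{-1}\sum_{j=1}^n\exp(\mathrm{i}t^\top Y_{n,j})$ and $$U_{n,a}=n\int_{\mathbb{R}^d}\left|\Delta\psi_n(t)-\left(\|t\|^2-d\right)\psi_n(t)\right|^2w_a(t)\,\mathrm{d}t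 .$$ Limit quantities. For $t\in\mathbb{R}^d$ put $\psi^{\pm}(t)=\mathbb{E}[\cos(t^\top X)]\pm\mathbb{E}[\sin(t^\top X)]$, $z(t)=-\Delta\psi^+(t)+(\|t\|^2-d)\psi^+(t)$, and $\Gamma_a=\int_{\mathbb{R}^d}z^2(t)w_a(t)\,\mathrm{d}t$. With $\mathrm{CS}^+(\xi)=\cos(\xi)+\sin(\xi)$, define for $x,t\in\mathbb{R}^d$ $$\begin{aligned}h^*(x,t)={}&\big(\|x\|^2+\|t\|^2-d\big)\mathrm{CS}^+(t^\top x)+\left(\tfrac12\nabla\Delta\psi^+(t)^\top-\tfrac12(\|t\|^2-d)\nabla\psi^+(t)^\top\right)(xx^\top-\mathrm{I}_d)\,t\\&+2\nabla\psi^-(t)^\top x+\big(\Delta\psi^-(t)-(\|t\|^2-d)\psi^-(t)\big)\,t^\top x+x^\top\mathrm{H}\psi^+(t)\,x-(\|t\|^2-d)\psi^+(t),\end{aligned}$$ and $K^*(s,t)=\mathbb{E}\big[h^*(X,s)h^*(X,t)\big]$ for $s,t\in\mathbb{R}^d$. *)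

(* Defs.v *)
From HB Require Import structures.
From mathcomp Require Import all_boot all_order all_algebra.
From mathcomp Require Import all_classical all_reals all_analysis.
From mathcomp.real_closed Require Import complex.

Set Implicit Arguments.
Unset Strict Implicit.
Unset Printing Implicit Defensive.

Import Order.TTheory GRing.Theory Num.Theory.
Import numFieldNormedType.Exports.

Local Open Scope classical_set_scope.
Local Open Scope ring_scope.

(* Points of R^d are column vectors 'cV[R]_d. Matrices carry the product
   sigma-algebra, generated by the coordinates; over a realType it is the Borel
   sigma-algebra of the (sup-norm = Euclidean) topology of 'M[R]_(m, n). *)
Definition measure_mx_display : measure_display -> measure_display.
Proof. exact. Qed.

Section measurable_mx.
Context {R : realType} {m n : nat}.

Definition mx_cylinders : set (set 'M[R]_(m, n)) :=
  [set A | exists i j (B : set R),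
     measurable B /\ A = (fun M : 'M[R]_(m, n) => M i j) @^-1` B].

Let mx_set0 : <<s mx_cylinders >> set0.
Proof. exact: sigma_algebra0. Qed.

Let mx_setC A : <<s mx_cylinders >> A -> <<s mx_cylinders >> (~` A).
Proof. exact: sigma_algebraC. Qed.

Let mx_bigcup (F : (set 'M[R]_(m, n))^nat) :
  (forall i, <<s mx_cylinders >> (F i)) ->
  <<s mx_cylinders >> (\bigcup_i (F i)).
Proof. exact: sigma_algebra_bigcup. Qed.

HB.instance Definition _ := @isMeasurable.Build
  (measure_mx_display default_measure_display)
  'M[R]_(m, n) <<s mx_cylinders >> mx_set0 mx_setC mx_bigcup.

Lemma measurable_coord i j :
  measurable_fun [set: 'M[R]_(m, n)] (fun M : 'M[R]_(m, n) => M i j).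
Proof.
move=> _ B mB; rewrite setTI; apply: sub_sigma_algebra.
by exists i, j, B.
Qed.

Lemma measurable_fun_mx d (T : measurableType d) (f : T -> 'M[R]_(m, n)) :
  (forall i j, measurable_fun [set: T] (fun x => f x i j)) ->
  measurable_fun [set: T] f.
Proof.
move=> mf.
apply: (@measurability _ _ _ _ _ f mx_cylinders) => //.
move=> _ [_ [i [j [B [mB ->]]]] <-].
exact: mf.
Qed.

End measurable_mx.

(* Lebesgue measure on R^d, by R^(d+1) = R x R^d *)
Section lebesgue_step.
Context {R : realType} {d : nat}.
Variable mu : {sigma_finite_measure set 'cV[R]_d -> \bar R}.

Definition cv_cons (p : measurableTypeR R * 'cV[R]_d) : 'cV[R]_d.+1 :=
  col_mx (p.1)%:M p.2.

Definition cv_uncons (x : 'cV[R]_d.+1) : measurableTypeR R * 'cV[R]_d :=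
  (x ord0 ord0, dsubmx (x : 'cV[R]_(1 + d))).

Lemma cv_consK : cancel cv_cons cv_uncons.
Proof.
move=> [a x]; rewrite /cv_uncons /cv_cons /= col_mxKd; congr (_, _).
transitivity (col_mx (a%:M : 'M[R]_1) x (lshift d ord0) ord0).
  by congr (fun_of_matrix _ _ _); exact/val_inj.
by rewrite col_mxEu mxE eqxx.
Qed.

Lemma measurable_cv_cons : measurable_fun setT cv_cons.
Proof.
apply: measurable_fun_mx => i j; rewrite /cv_cons.
case: (@split_ordP 1 d i) => k ->.
  rewrite (_ : (fun _ => _) = fst) //.
  apply/funext => p; apply: etrans (col_mxEu (p.1)%:M p.2 k j) _.
  by rewrite mxE !ord1 eqxx.
rewrite (_ : (fun _ => _) = (fun x : 'cV[R]_d => x k j) \o snd).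
  by apply: measurableT_comp => //; exact: measurable_coord.
by apply/funext => p; exact: (col_mxEd (p.1)%:M p.2 k j).
Qed.

Lemma measurable_cv_uncons : measurable_fun setT cv_uncons.
Proof.
apply/measurable_fun_pairP; split; first exact: measurable_coord.
apply: measurable_fun_mx => i j /=.
rewrite (_ : (fun _ => _) = fun x : 'cV[R]_d.+1 => x (rshift 1 i) j).
  exact: measurable_coord.
by apply/funext => x; rewrite /= mxE.
Qed.

Definition lebesgue_cons : set 'cV[R]_d.+1 -> \bar R :=
  pushforward (@lebesgue_measure R \x mu)%E cv_cons.

Let pushforward_lebesgue : {measure set 'cV[R]_d.+1 -> \bar R} :=
  measure_function_pushforward__canonical__measure_function_Measure
    (@lebesgue_measure R \x mu)%E measurable_cv_cons.

Let lebesgue_cons0 : lebesgue_cons set0 = 0%E.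
Proof. exact: (measure0 pushforward_lebesgue). Qed.

Let lebesgue_cons_ge0 A : (0 <= lebesgue_cons A)%E.
Proof. exact: (measure_ge0 pushforward_lebesgue). Qed.

Let lebesgue_cons_sigma_additive : semi_sigma_additive lebesgue_cons.
Proof. exact: (@measure_semi_sigma_additive _ _ _ pushforward_lebesgue). Qed.

HB.instance Definition _ := isMeasure.Build _ _ _ lebesgue_cons
  lebesgue_cons0 lebesgue_cons_ge0 lebesgue_cons_sigma_additive.

Let lebesgue_cons_sigma_finite : sigma_finite setT lebesgue_cons.
Proof.
have /sigma_finiteP[F [FT ndF Foo]] := sigma_finiteT (@lebesgue_measure R).
have /sigma_finiteP[G [GT ndG Goo]] := sigma_finiteT mu.
exists (fun k => cv_uncons @^-1` (F k `*` G k)).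
  rewrite -preimage_bigcup -[LHS](preimage_setT cv_uncons); congr (_ @^-1` _).
  apply/esym/seteqP; split=> // -[x y] _.
  have : [set: measurableTypeR R] x by [].
  have : [set: 'cV[R]_d] y by [].
  rewrite FT GT => -[j _ Gjy] [i _ Fix]; exists (maxn i j) => //; split.
    by move: x Fix; exact/subsetPset/ndF/leq_maxl.
  by move: y Gjy; exact/subsetPset/ndG/leq_maxr.
move=> k; have [mFk Fkoo] := Foo k; have [mGk Gkoo] := Goo k; split.
  rewrite -[X in measurable X]setTI; apply: measurable_cv_uncons => //.
  exact: measurableX.
rewrite /lebesgue_cons /pushforward -comp_preimage.
rewrite (_ : cv_uncons \o cv_cons = id); last by apply/funext; exact: cv_consK.
by rewrite preimage_id product_measure1E// lte_mul_pinfty// ge0_fin_numE.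
Qed.

HB.instance Definition _ := Measure_isSigmaFinite.Build _ _ _
  lebesgue_cons lebesgue_cons_sigma_finite.

End lebesgue_step.

Fixpoint lebesgue_cV {R : realType} (d : nat) :
    {sigma_finite_measure set 'cV[R]_d -> \bar R} :=
  if d is d'.+1 then lebesgue_cons (lebesgue_cV d') else \d_(0 : 'cV[R]_0).

Definition dotv {R : realType} {d : nat} (x y : 'cV[R]_d) : R :=
  (x^T *m y) ord0 ord0.

(* the norm `|x| of 'cV[R]_d is the sup norm *)
Definition enorm {R : realType} {d : nat} (x : 'cV[R]_d) : R :=
  Num.sqrt (dotv x x).

Section differential_operators.
Context {R : realType} {d : nat}.
Implicit Types (f : 'cV[R]_d -> R) (t : 'cV[R]_d).

Definition pderiv (i : 'I_d) f t : R :=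
  'D_(delta_mx i ord0) (f : 'cV[R]_d -> R^o) t.

Definition grad f t : 'cV[R]_d := \col_i pderiv i f t.

Definition hessian f t : 'M[R]_d := \matrix_(i, j) pderiv i (pderiv j f) t.

Definition laplacian f t : R := \sum_(i < d) pderiv i (pderiv i f) t.

Definition claplacian (f : 'cV[R]_d -> R[i]) t : R[i] :=
  Complex (laplacian (fun u => complex.Re (f u)) t)
          (laplacian (fun u => complex.Im (f u)) t).

End differential_operators.

Definition expi {R : realType} (y : R) : R[i] := Complex (cos y) (sin y).

Definition weight {R : realType} {d : nat} (a : R) (t : 'cV[R]_d) : R :=
  expR (- a * enorm t ^+ 2).

Section test_statistic.
Context {R : realType} {d : nat}.
Variables (n : nat) (x : nat -> 'cV[R]_d).

Definition sample_mean : 'cV[R]_d := n%:R^-1 *: \sum_(1 <= j < n.+1) x j.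

Definition sample_cov : 'M[R]_d :=
  n%:R^-1 *: \sum_(1 <= j < n.+1)
    ((x j - sample_mean) *m (x j - sample_mean)^T).

Definition sympd (B : 'M[R]_d) : Prop :=
  B^T = B /\ forall v : 'cV[R]_d, v != 0 -> 0 < dotv v (B *m v).

(* A^(-1/2); the default value 0 is taken only when A is not symmetric positive
   definite (in particular when A is singular, where [invmx A = A]). *)
Definition invsqrtmx (A : 'M[R]_d) : 'M[R]_d :=
  xget 0 [set B | sympd B /\ B *m B = invmx A].

Definition scaled_residual (j : nat) : 'cV[R]_d :=
  invsqrtmx sample_cov *m (x j - sample_mean).

Definition ecf (t : 'cV[R]_d) : R[i] :=
  n%:R^-1 * \sum_(1 <= j < n.+1) expi (dotv t (scaled_residual j)).

Definition test_stat (a : R) : R :=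
  n%:R * \int[lebesgue_cV d]_t
    (Normc.normc (claplacian ecf t
            - real_complex R (enorm t ^+ 2 - d%:R) * ecf t) ^+ 2
     * weight a t).

End test_statistic.

Section probability_notions.
Context {R : realType} {dT : measure_display} {T : measurableType dT}.
Variable P : probability T R.

(* Expectations of real- and matrix-valued functions; meaningful for integrable
   ones only. *)
Definition expect (Y : T -> R) : R := fine 'E_P[Y].

Definition mx_expect m n (Y : T -> 'M[R]_(m, n)) : 'M[R]_(m, n) :=
  \matrix_(i, j) expect (fun w => Y w i j).

Definition mutually_independent dE (E : measurableType dE)
    (X : nat -> {RV P >-> E}) : Prop :=
  forall (s : seq nat) (A : nat -> set E), uniq s ->
    (forall k, measurable (A k)) ->
    P (\bigcap_(k in [set` s]) X k @^-1` A k)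
    = (\prod_(k <- s) P (X k @^-1` A k))%E.

Definition identically_distributed dE (E : measurableType dE)
    (X : nat -> {RV P >-> E}) : Prop :=
  forall k (A : set E), measurable A ->
    distribution P (X k) A = distribution P (X 0%N) A.

Definition iid dE (E : measurableType dE) (X : nat -> {RV P >-> E}) : Prop :=
  mutually_independent X /\ identically_distributed X.

Definition cvg_in_distribution (Z : nat -> T -> R)
    (mu : probability (measurableTypeR R) R) : Prop :=
  (\forall n \near \oo, measurable_fun [set: T] (Z n)) /\
  forall f : R -> R, continuous f -> (exists M : R, forall y, `|f y| <= M) ->
    \int[P]_w f (Z n w) @[n --> \oo] --> \int[mu]_y f y.

End probability_notions.

(* N(0, v); [normal_prob 0 0] is not the point mass at 0. *)
Definition normal_law {R : realType} (v : R) :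
    probability (measurableTypeR R) R :=
  if v == 0 then (\d_(0 : measurableTypeR R) : probability _ R)
  else (normal_prob 0 (Num.sqrt v) : probability _ R).

Section limit_quantities.
Context {R : realType} {d : nat} {dT : measure_display}.
Context {T : measurableType dT}.
Variables (P : probability T R) (X : T -> 'cV[R]_d) (a : R).
Implicit Types (s t x : 'cV[R]_d).

Definition psi_plus t : R :=
  expect P (fun w => cos (dotv t (X w)))
  + expect P (fun w => sin (dotv t (X w))).

Definition psi_minus t : R :=
  expect P (fun w => cos (dotv t (X w)))
  - expect P (fun w => sin (dotv t (X w))).

Definition zfun t : R :=
  - laplacian psi_plus t + (enorm t ^+ 2 - d%:R) * psi_plus t.

Definition Gamma_lim : R :=
  \int[lebesgue_cV d]_t (zfun t ^+ 2 * weight a t).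

Definition CSplus (y : R) : R := cos y + sin y.

Definition hstar x t : R :=
  (enorm x ^+ 2 + enorm t ^+ 2 - d%:R) * CSplus (dotv t x)
  + ((2^-1 *: (grad (laplacian psi_plus) t)^T
      - (2^-1 * (enorm t ^+ 2 - d%:R)) *: (grad psi_plus t)^T)
     *m (x *m x^T - 1%:M) *m t) ord0 ord0
  + 2 * dotv (grad psi_minus t) x
  + (laplacian psi_minus t - (enorm t ^+ 2 - d%:R) * psi_minus t) * dotv t x
  + dotv x (hessian psi_plus t *m x)
  - (enorm t ^+ 2 - d%:R) * psi_plus t.

Definition Kstar s t : R := expect P (fun w => hstar (X w) s * hstar (X w) t).

Definition sigma2 : R :=
  4 * \int[lebesgue_cV d]_s (\int[lebesgue_cV d]_t
    (Kstar s t * zfun s * zfun t * weight a s * weight a t)).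

End limit_quantities.

(* Main.v *)
Require Import Defs.
From HB Require Import structures.
From mathcomp Require Import all_boot all_order all_algebra.
From mathcomp Require Import all_classical all_reals all_analysis.
From mathcomp.real_closed Require Import complex.
From mathcomp Require Import measurable_realfun ring lra.

Set Implicit Arguments.
Unset Strict Implicit.
Unset Printing Implicit Defensive.

Import Order.TTheory GRing.Theory Num.Theory.
Import numFieldNormedType.Exports.

Local Open Scope classical_set_scope.
Local Open Scope ring_scope.

(* Let g(x, t) = (|x|^2 + |t|^2 - d) CS^+(t.x), so that z(t) = E g(X, t), and let
   Z_n(t) be the average of g(Y_{n,j}, t). Expanding |.|^2 into real and imaginary
   parts, whose product is odd in t, gives U_n / n = int Z_n^2 w, hence
     U_n / n - Gamma = int (Z_n - z)^2 w + 2 (average of gamma(Y_{n,j}) - E gamma(X)),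
   where gamma(x) = int g(x, t) z(t) w(t) dt. Since Z_n - z is of order n^(-1/2), the
   first term is negligible. As S_n^(-1/2) = I - (S_n - I) / 2 + O(|S_n - I|^2), a
   first-order expansion of gamma at X_j turns the second one into twice the average
   of eta(X_j) up to o_P(n^(-1/2)), with eta(x) = int h*(x, t) z(t) w(t) dt.
   The central limit theorem for the i.i.d. variables 2 eta(X_j) is obtained by
   Lindeberg's replacement method: smooth test functions, Gaussian convolutions in
   place of independent Gaussian variables, and approximation of Lipschitz test
   functions by smooth ones. *)

(** * Integrable real functions *)

(** The residuals depend on the whole sample, so averages over them are not sums of independent
    variables. The expansion is therefore deterministic: as soon as [sample_dev], the distance of
    the sample covariance from the identity plus the norm of the sample mean, is at most 1/2, every
    error is bounded by an explicit expression in it, and probability enters only afterwards. The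
    coefficients of the first-order terms are sample averages, such as that of
    [dgamma i x * x k ord0]; replacing them by their means leaves an i.i.d. sum, and the corrections
    in h* are built from these means. Only fourth moments are available: with [growth x] equal to 1
    + |x|^2, gamma and its derivatives are O(growth), and the Taylor remainder at a residual is
    O(sample_dev^2 growth^2), which is just integrable. The averages to be replaced have a first
    moment only, hence a law of large numbers by truncation. In t all bounds are polynomial, and the
    Gaussian weight integrates every power. A singular covariance gives the inverse square root its
    default value 0, which has to be followed through the measurability of the statistic. *)

Section real_integral.
Context d (T : measurableType d) (R : realType).
Variable mu : {measure set T -> \bar R}.
Implicit Types f g : T -> R.

Definition intg f := mu.-integrable setT (EFin \o f).

Lemma intg_measurable f : intg f -> measurable_fun setT f.
Proof. by move=> /integrableP[/measurable_EFinP]. Qed.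

Lemma intg_dom f g : measurable_fun setT f -> intg g ->
  (forall x, `|f x| <= g x) -> intg f.
Proof.
move=> mf ig fg; apply: le_integrable ig => //; first exact/measurable_EFinP.
by move=> x _ /=; rewrite lee_fin (le_trans (fg x))// ler_norm.
Qed.

Lemma eq_intg f g : f =1 g -> intg f -> intg g.
Proof. by move=> /funext ->. Qed.

Lemma intgD f g : intg f -> intg g -> intg (fun x => f x + g x).
Proof. by move=> hf hg; apply: eq_integrable (integrableD _ hf hg). Qed.

Lemma intgZ c f : intg f -> intg (fun x => c * f x).
Proof. by move=> hf; apply: eq_integrable (integrableZl _ c hf). Qed.

Lemma intgN f : intg f -> intg (fun x => - f x).
Proof. by move=> hf; apply: eq_intg (intgZ (-1) hf) => x; rewrite mulN1r. Qed.

Lemma intgB f g : intg f -> intg g -> intg (fun x => f x - g x).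
Proof. by move=> hf hg; apply: (intgD hf (intgN hg)). Qed.

Lemma intg0 : intg (fun=> 0).
Proof. exact: integrable0. Qed.

Lemma intg_sum (I : Type) (s : seq I) (F : I -> T -> R) :
  (forall i, intg (F i)) -> intg (fun x => \sum_(i <- s) F i x).
Proof.
move=> hF; elim: s => [|i s ih].
  by apply: eq_intg intg0 => x; rewrite big_nil.
by apply: eq_intg (intgD (hF i) ih) => x; rewrite big_cons.
Qed.

Lemma intg_norm f : intg f -> intg (fun x => `|f x|).
Proof. exact: integrable_norm. Qed.

Lemma RintD f g : intg f -> intg g ->
  \int[mu]_x (f x + g x) = \int[mu]_x f x + \int[mu]_x g x.
Proof. exact: RintegralD. Qed.

Lemma RintB f g : intg f -> intg g ->
  \int[mu]_x (f x - g x) = \int[mu]_x f x - \int[mu]_x g x.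
Proof. exact: RintegralB. Qed.

Lemma RintZ c f : intg f -> \int[mu]_x (c * f x) = c * \int[mu]_x f x.
Proof. exact: RintegralZl. Qed.

Lemma Rint0 : \int[mu]_x (0 : R) = 0.
Proof. by rewrite /Rintegral integral0. Qed.

Lemma Rint_sum (I : Type) (s : seq I) (F : I -> T -> R) :
  (forall i, intg (F i)) ->
  \int[mu]_x (\sum_(i <- s) F i x) = \sum_(i <- s) \int[mu]_x F i x.
Proof.
move=> hF; elim: s => [|i s ih].
  by under eq_Rintegral do rewrite big_nil; rewrite big_nil Rint0.
under eq_Rintegral do rewrite big_cons.
by rewrite big_cons RintD ?ih//; exact: intg_sum.
Qed.

Lemma Rint_le f g : intg f -> intg g -> (forall x, f x <= g x) ->
  \int[mu]_x f x <= \int[mu]_x g x.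
Proof. by move=> hf hg fg; apply: le_Rintegral. Qed.

Lemma Rint_ge0 f : (forall x, 0 <= f x) -> 0 <= \int[mu]_x f x.
Proof. by move=> f0; apply: Rintegral_ge0. Qed.

Lemma Rint_norm_le f g : intg f -> intg g -> (forall x, `|f x| <= g x) ->
  `|\int[mu]_x f x| <= \int[mu]_x g x.
Proof.
move=> hf hg fg; apply: (le_trans (le_normr_Rintegral _ _)) => //.
by apply: Rint_le => //; exact: intg_norm.
Qed.

Lemma eq_Rint f g : f =1 g -> \int[mu]_x f x = \int[mu]_x g x.
Proof. by move=> fg; apply: eq_Rintegral => x _. Qed.

Lemma RintE f : intg f -> (\int[mu]_x (f x)%:E = (\int[mu]_x f x)%:E)%E.
Proof. by move=> hf; rewrite /Rintegral fineK//; exact: integrable_fin_num. Qed.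

Lemma intg_ge0 f : measurable_fun setT f -> (forall x, 0 <= f x) ->
  (\int[mu]_x (f x)%:E < +oo)%E -> intg f.
Proof.
move=> mf f0 hf; apply/integrableP; split; first exact/measurable_EFinP.
by rewrite (eq_integral (fun x => (f x)%:E))// => x _; rewrite /= ger0_norm.
Qed.

End real_integral.

Section finite_integral.
Context d (T : measurableType d) (R : realType).
Variable P : probability T R.

Lemma intg_cst (c : R) : intg P (fun=> c).
Proof. exact: finite_measure_integrable_cst. Qed.

Lemma Rint_cst (c : R) : \int[P]_x c = c.
Proof.
transitivity (c * fine (P setT)); first exact: Rintegral_cst.
by rewrite probability_setT mulr1.
Qed.

Lemma intg_bounded (f : T -> R) (M : R) : measurable_fun setT f ->
  (forall x, `|f x| <= M) -> intg P f.
Proof. by move=> mf fM; apply: intg_dom (intg_cst M) _. Qed.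

(** Markov's inequality, from [e * \1_A <= f] on the set [A] where [f] is at least [e]. The
    exceptional set is exhibited because the stochastic orders below are phrased with such sets. *)
Lemma markov_set (f : T -> R) (e : R) : 0 < e -> intg P f ->
  (forall x, 0 <= f x) ->
  exists A, [/\ measurable A, (P A <= (e^-1 * \int[P]_x f x)%:E)%E &
    forall x, ~ A x -> f x < e].
Proof.
move=> e0 hf f0; pose A := [set x | e <= f x].
have mf := intg_measurable hf.
have mA : measurable A.
  rewrite /A -[X in measurable X]setTI.
  have -> : [set x | e <= f x] = f @^-1` `[e, +oo[%classic.
    by apply/seteqP; split=> x /=; rewrite in_itv/= andbT.
  exact: mf.
exists A; split => //; last first.
  by move=> x /negP; rewrite /A /= -ltNge.
have iA : intg P (fun x => e * \1_A x).
  by apply: intgZ; exact: integrable_indic.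
have h : \int[P]_x (e * \1_A x) <= \int[P]_x f x.
  apply: Rint_le => // x; rewrite indicE; have [|] := boolP (x \in A).
    by rewrite inE /A /= mulr1.
  by rewrite mulr0.
rewrite EFinM lee_pdivlMl//.
move: h; rewrite RintZ; last exact: integrable_indic.
rewrite -lee_fin EFinM; congr (_ <= _)%E; congr (_ * _)%E.
rewrite -RintE; last exact: integrable_indic.
by rewrite integral_indic// setIT.
Qed.

End finite_integral.

(** * Fubini's theorem for kernels dominated by a product *)

Section dominated_fubini.
Context d1 d2 (T1 : measurableType d1) (T2 : measurableType d2) (R : realType).
Variables (m1 : {sigma_finite_measure set T1 -> \bar R}).
Variables (m2 : {sigma_finite_measure set T2 -> \bar R}).
Variables (k : T1 * T2 -> R) (u : T1 -> R) (v : T2 -> R).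
Hypothesis mk : measurable_fun setT k.
Hypothesis kuv : forall x y, `|k (x, y)| <= u x * v y.
Hypothesis iu : intg m1 u.
Hypothesis iv : intg m2 v.

Lemma dom_intg2 x : intg m2 (fun y => k (x, y)).
Proof.
apply: intg_dom (intgZ (u x) iv) _ => //.
exact: (measurableT_comp mk (measurable_pair1 x)).
Qed.

Lemma dom_intg1 y : intg m1 (fun x => k (x, y)).
Proof.
apply: intg_dom (intgZ (v y) iu) _ => [|x].
  exact: (measurableT_comp mk (measurable_pair2 y)).
by rewrite mulrC.
Qed.

Let mk' : measurable_fun setT (EFin \o k).
Proof. exact/measurable_EFinP. Qed.

(** By Tonelli, since the iterated integral of [|k|] is at most that of [|u|] times that of
    [|v|]. *)
Lemma dom_intg12 : (m1 \x m2)%E.-integrable setT (EFin \o k).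
Proof.
apply/integrable12ltyP => //=.
apply: (@le_lt_trans _ _ (\int[m1]_x (`|u x| * \int[m2]_y `|v y|)%:E)%E).
  apply: ge0_le_integral => //=.
  - by move=> x _; apply: integral_ge0.
  - apply: (measurable_fun_fubini_tonelli_F (fun z => `|k z|%:E)) => //=.
    by apply/measurable_EFinP; exact: measurableT_comp.
  - apply/measurable_EFinP; apply: measurable_funM => //.
    by apply: measurableT_comp => //; exact: intg_measurable iu.
  - move=> x _; rewrite -RintZ; last exact: intg_norm.
    rewrite -RintE; last by apply: intgZ; exact: intg_norm.
    apply: ge0_le_integral => //=.
    + apply/measurable_EFinP; apply: measurableT_comp => //.
      exact: intg_measurable (dom_intg2 x).
    + apply/measurable_EFinP; apply: measurable_funM => //.
      by apply: measurableT_comp => //; exact: intg_measurable iv.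
    + move=> y _; rewrite lee_fin (le_trans (kuv x y))//.
      by rewrite -normrM ler_norm.
rewrite (_ : (fun x => _) = EFin \o (fun x => (\int[m2]_y `|v y|) * `|u x|)).
  by rewrite RintE ?ltry//; apply: intgZ; exact: intg_norm.
by apply/funext => x; rewrite /= mulrC.
Qed.

Lemma dom_intgF : intg m1 (fun x => \int[m2]_y k (x, y)).
Proof.
have := integrable_fubini_F dom_intg12; apply: eq_integrable => // x _ /=.
by rewrite /fubini_F -RintE//; exact: dom_intg2.
Qed.

Lemma dom_intgG : intg m2 (fun y => \int[m1]_x k (x, y)).
Proof.
have : m2.-integrable setT (fubini_G m1 (EFin \o k)).
  apply/integrableP; split; first exact: measurable_fubini_G dom_intg12.
  apply: le_lt_trans ((integrable21ltyP _ _ mk').1 dom_intg12).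
  apply: ge0_le_integral => //=.
  - by apply: measurableT_comp => //; exact: measurable_fubini_G dom_intg12.

  - apply: (measurable_fun_fubini_tonelli_G (fun z => `|k z|%:E)) => //=.
    by apply/measurable_EFinP; exact: measurableT_comp.
  - move=> y _; apply: le_abse_integral => //.
    by apply/measurable_EFinP; exact: intg_measurable (dom_intg1 y).
apply: eq_integrable => // y _ /=.
by rewrite /fubini_G -RintE//; exact: dom_intg1.
Qed.

Lemma dom_fubini :
  \int[m1]_x \int[m2]_y k (x, y) = \int[m2]_y \int[m1]_x k (x, y).
Proof.
apply: EFin_inj; rewrite -RintE; last exact: dom_intgF.
rewrite -RintE; last exact: dom_intgG.
transitivity (\int[m1]_x \int[m2]_y (k (x, y))%:E)%E.
  by apply: eq_integral => x _; rewrite RintE//; exact: dom_intg2.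
rewrite (Fubini dom_intg12).
by apply: eq_integral => y _; rewrite -RintE//; exact: dom_intg1.
Qed.

End dominated_fubini.

(** * Taylor bounds *)

Section calculus.
Context (R : realType).
Implicit Types (f df : R -> R) (u v x y a M : R).

(** The mean value inequality on either side of [a]. The derivative is bounded only at points no
    farther from [a] than [x], so that a bound on one derivative can be fed into the next; the
    Taylor estimates below arise in this way. *)
Lemma mvt_bound f df a x M : (forall y, is_derive y 1 f (df y)) ->
  (forall y, `|y - a| <= `|x - a| -> `|df y| <= M) ->
  `|f x - f a| <= M * `|x - a|.
Proof.
move=> dF dfM; have cf y : {for y, continuous f}.
  apply/differentiable_continuous/derivable1_diffP.
  exact: (@ex_derive _ _ _ _ _ _ _ (dF y)).
have [ax|xa] := leP a x.
  have [c] := MVT_segment ax (fun y _ => dF y) (continuous_subspaceT cf).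
  rewrite in_itv/= => /andP[ac cx] ->; rewrite normrM ler_wpM2r//.
  by apply: dfM; rewrite !ger0_norm ?subr_ge0// lerD2r.
have [c] := MVT_segment (ltW xa) (fun y _ => dF y) (continuous_subspaceT cf).
rewrite in_itv/= => /andP[xc ca].
rewrite distrC => ->; rewrite [X in _ <= _ * X]distrC normrM ler_wpM2r//.
apply: dfM; rewrite distrC [leRHS]distrC.
by rewrite !ger0_norm ?subr_ge0// ?(ltW xa)// lerB.
Qed.

Lemma cos_le1 x : `|cos x| <= 1 :> R.
Proof. by rewrite ler_norml cos_geN1 cos_le1. Qed.

Lemma sin_le1 x : `|sin x| <= 1 :> R.
Proof. by rewrite ler_norml sin_geN1 sin_le1. Qed.

Lemma cos_lip u v : `|cos (u + v) - cos u| <= `|v| :> R.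
Proof.
have := @mvt_bound (@cos R) (fun y => - sin y) u (u + v) 1.
rewrite mul1r [u + v - u]addrAC subrr add0r; apply => // y _.
by rewrite normrN sin_le1.
Qed.

Lemma sin_lip u v : `|sin (u + v) - sin u| <= `|v| :> R.
Proof.
have := @mvt_bound (@sin R) (fun y => cos y) u (u + v) 1.
rewrite mul1r [u + v - u]addrAC subrr add0r; apply => // y _.
exact: cos_le1.
Qed.

(** The remainder [f] has derivative [sin u - sin y], at most [|v|] by the Lipschitz bound. This
    gives the constant 1 instead of 1/2. *)
Lemma cos_taylor u v : `|cos (u + v) - cos u + sin u * v| <= v ^+ 2 :> R.
Proof.
pose f y := cos y + sin u * (y - u).
have dF y : is_derive y 1 f (- sin y + sin u).
  by apply: is_derive_eq; rewrite subr0 /GRing.scale/= mulr1.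
have := @mvt_bound f (fun y => - sin y + sin u) u (u + v) `|v| dF.
rewrite [u + v - u]addrAC subrr add0r /f subrr mulr0 addr0.
rewrite [u + v - u]addrAC subrr add0r => h.
rewrite addrAC -[leRHS]ger0_norm ?sqr_ge0// expr2 normrM; apply: h => y yv.
have := sin_lip u (y - u); rewrite subrKC => h.
by rewrite addrC distrC (le_trans h).
Qed.

Lemma sin_taylor u v : `|sin (u + v) - sin u - cos u * v| <= v ^+ 2 :> R.
Proof.
pose f y := sin y - cos u * (y - u).
have dF y : is_derive y 1 f (cos y - cos u).
  by apply: is_derive_eq; rewrite subr0 /GRing.scale/= mulr1.
have := @mvt_bound f (fun y => cos y - cos u) u (u + v) `|v| dF.
rewrite [u + v - u]addrAC subrr add0r /f subrr mulr0 subr0.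
rewrite [u + v - u]addrAC subrr add0r => h.
rewrite addrAC -[leRHS]ger0_norm ?sqr_ge0// expr2 normrM; apply: h => y yv.
by have := cos_lip u (y - u); rewrite subrKC => /le_trans; apply.
Qed.

(** Three mean value inequalities: [f1], [f2], [f3] are the remainders of order 1, 2, 3, each the
    derivative of the next. Every step costs one factor [|y|], without the factorial. *)
Lemma expR_taylor x :
  `|expR x - (1 + x + x ^+ 2 / 2)| <= `|x| ^+ 3 * expR `|x| :> R.
Proof.
pose f1 y : R := expR y - 1.
pose f2 y : R := expR y - (1 + y).
pose f3 y : R := expR y - (1 + y + y ^+ 2 / 2).
have d1 y : is_derive y 1 f1 (expR y) by apply: is_derive_eq; rewrite subr0.
have d2 y : is_derive y 1 f2 (f1 y).
  by apply: is_derive_eq; rewrite add0r.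
have d3 y : is_derive y 1 f3 (f2 y).
  by apply: is_derive_eq; rewrite /f2 /GRing.scale/=; lra.
have le1 y : `|f1 y| <= `|y| * expR `|y|.
  have := @mvt_bound f1 expR 0 y (expR `|y|) d1.
  rewrite subr0 {2}/f1 expR0 subrr subr0 mulrC; apply => z.
  rewrite subr0 => zy; rewrite ger0_norm ?expR_ge0// ler_expR.
  exact: le_trans (ler_norm _) zy.
have le2 y : `|f2 y| <= `|y| ^+ 2 * expR `|y|.
  have := @mvt_bound f2 f1 0 y (`|y| * expR `|y|) d2.
  rewrite subr0 {2}/f2 expR0 addr0 subrr subr0 mulrAC -expr2; apply => z.
  rewrite subr0 => zy; apply: (le_trans (le1 _)).
  by rewrite ler_pM ?expR_ge0// ler_expR.
have := @mvt_bound f3 f2 0 x (`|x| ^+ 2 * expR `|x|) d3.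
rewrite subr0 {2}/f3 expR0 expr0n/= mul0r !addr0 subrr subr0.
rewrite (mulrAC (`|x| ^+ 2)) -exprSr; apply => z; rewrite subr0 => zx.
apply: (le_trans (le2 _)); rewrite ler_pM ?expR_ge0 ?ler_expR//.
by rewrite lerXn2r ?nnegrE.
Qed.

Lemma expR_ge_pow3 x : `|x| ^+ 3 <= 6 * expR `|x| :> R.
Proof.
have := expR_ge1Dxn 2 (normr_ge0 x).
by rewrite (_ : 3`!%:R = 6)//; lra.
Qed.

Lemma expR_ge_pow4 x : x ^+ 4 <= 24 * expR `|x| :> R.
Proof.
have := expR_ge1Dxn 3 (normr_ge0 x).
have -> : x ^+ 4 = `|x| ^+ 4 by rewrite -normrX ger0_norm// exprn_even_ge0.
by rewrite (_ : 4`!%:R = 24)//; lra.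
Qed.

Lemma expR_norm_le x : expR `|x| <= expR x + expR (- x) :> R.
Proof.
by case: (leP 0 x) => [/ger0_norm|/ltr0_norm] ->; rewrite ?lerDl ?lerDr expR_ge0.
Qed.

End calculus.

(** * Moments of the normal distribution *)

Section normal_integrals.
Context (R : realType).
Implicit Types (m s x y t : R) (f : R -> R).
Local Notation lam := (@lebesgue_measure R).
Local Notation N m s := (normal_prob m s : probability (measurableTypeR R) R).

(** The Radon-Nikodym derivative of the normal law agrees almost everywhere with [normal_pdf], both
    having the same integral over every measurable set. *)
Lemma ge0_integral_normal m s (f : R -> \bar R) : measurable_fun setT f ->
  (forall x, (0 <= f x)%E) ->
  (\int[N m s]_x f x = \int[lam]_x (f x * (normal_pdf m s x)%:E))%E.
Proof.
move=> mf f0; have dom := normal_prob_dominates m s.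
rewrite -(Radon_Nikodym_SigmaFinite.change_of_variables dom)//.
apply: ae_eq_integral => //.
- apply: emeasurable_funM => //; apply: (measurable_int lam).
  exact: Radon_Nikodym_SigmaFinite.f_integrable.
- apply: emeasurable_funM => //; apply/measurableT_comp => //.
  exact: measurable_normal_pdf.
- apply: ae_eqe_mul2l; apply: integral_ae_eq => //.
  + exact: Radon_Nikodym_SigmaFinite.f_integrable.
  + by apply/measurableT_comp => //; exact: measurable_normal_pdf.
  + by move=> E _ mE; rewrite -Radon_Nikodym_SigmaFinite.f_integral.
Qed.

Lemma intg_normal m s f : measurable_fun setT f ->
  intg lam (fun x => f x * normal_pdf m s x) -> intg (N m s) f.
Proof.
move=> mf /integrableP[_ h]; apply/integrableP; split; first exact/measurable_EFinP.
rewrite ge0_integral_normal//.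
  apply: le_lt_trans h; rewrite le_eqVlt; apply/orP; left; apply/eqP.
  apply: eq_integral => x _ /=.
  by rewrite normrM (ger0_norm (normal_pdf_ge0 _ _ _)).
by apply/measurable_EFinP; exact: measurableT_comp.
Qed.

(** Reduction to nonnegative functions: as the density is nonnegative, the positive and negative
    parts of the product are those of [f] times the density. *)
Lemma Rint_normal m s f : intg (N m s) f ->
  intg lam (fun x => f x * normal_pdf m s x) /\
  \int[N m s]_x f x = \int[lam]_x (f x * normal_pdf m s x).
Proof.
move=> hf; have /integrableP[/measurable_EFinP mf hoo] := hf.
have mp := measurable_normal_pdf m s.
have ifp : intg lam (fun x => f x * normal_pdf m s x).
  apply/integrableP; split.
    by apply/measurable_EFinP; exact: measurable_funM.
  move: hoo; rewrite ge0_integral_normal//; last first.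
    by apply/measurable_EFinP; exact: measurableT_comp.
  apply: le_lt_trans; rewrite le_eqVlt; apply/orP; left; apply/eqP.
  apply: eq_integral => x _ /=.
  by rewrite normrM (ger0_norm (normal_pdf_ge0 _ _ _)).
split=> //; apply: EFin_inj; rewrite -!RintE//.
rewrite [LHS]integralE [RHS]integralE; congr (_ - _)%E.
  rewrite ge0_integral_normal//; last exact/measurable_funepos/measurable_EFinP.
  apply: eq_integral => x _ /=.
  rewrite !funeposE/= -!EFin_max -EFinM.
  by rewrite maxr_pMl ?normal_pdf_ge0// mul0r.
rewrite ge0_integral_normal//; last exact/measurable_funeneg/measurable_EFinP.
apply: eq_integral => x _ /=.
rewrite !funenegE/= -!EFin_max -EFinM.
by rewrite maxr_pMl ?normal_pdf_ge0// mul0r mulNr.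
Qed.

(** Completing the square: [expR (t * x)] times the density of N(0, s^2) is
    [expR (t ^+ 2 * s ^+ 2 / 2)] times the density of N(t s^2, s^2). *)
Lemma normal_mgf s t : s != 0 ->
  intg (N 0 s) (fun x => expR (t * x)) /\
  \int[N 0 s]_x expR (t * x) = expR (t ^+ 2 * s ^+ 2 / 2).
Proof.
move=> s0.
have E x : expR (t * x) * normal_pdf 0 s x =
    expR (t ^+ 2 * s ^+ 2 / 2) * normal_pdf (t * s ^+ 2) s x.
  rewrite !normal_pdfE// !(mulrCA _ (normal_peak s)); congr (_ * _).
  rewrite /normal_fun -!expRD; congr expR.
  by rewrite -(mulr_natr (s ^+ 2) 2); field; rewrite s0.
have ip : intg lam (fun x => expR (t * x) * normal_pdf 0 s x).
  under eq_fun do rewrite E.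
  by apply: intgZ; exact: integrable_normal_pdf.
have ie : intg (N 0 s) (fun x => expR (t * x)).
  by apply: intg_normal => //; apply: measurableT_comp.
split=> //; rewrite (Rint_normal ie).2.
under eq_Rintegral do rewrite E.
rewrite RintZ; last exact: integrable_normal_pdf.
by rewrite /Rintegral integral_normal_pdf mulr1.
Qed.

Lemma normal_intg_expnorm s t : s != 0 ->
  intg (N 0 s) (fun x => expR `|t * x|).
Proof.
move=> s0; apply: intg_dom (intgD (normal_mgf t s0).1 (normal_mgf (- t) s0).1) _.
  by do 2 apply: measurableT_comp => //.
by move=> x; rewrite ger0_norm ?expR_ge0// mulNr expR_norm_le.
Qed.

Lemma normal_intg_pow4 s : s != 0 -> intg (N 0 s) (fun x => x ^+ 4).
Proof.
move=> s0; apply: intg_dom (intgZ 24 (normal_intg_expnorm 1 s0)) _.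
  by apply: measurable_funX.
by move=> x; rewrite mul1r ger0_norm ?expR_ge_pow4// exprn_even_ge0.
Qed.

Lemma normal_intg_pow2 s : s != 0 -> intg (N 0 s) (fun x => x ^+ 2).
Proof.
move=> s0; apply: intg_dom (intgD (intg_cst _ 1) (normal_intg_pow4 s0)) _.
  by apply: measurable_funX.
move=> x; rewrite ger0_norm ?sqr_ge0//.
rewrite (_ : x ^+ 4 = x ^+ 2 ^+ 2) -?exprM//.
by have := sqr_ge0 (x ^+ 2 - 1); have := sqr_ge0 (x ^+ 2); nra.
Qed.

Lemma normal_intg_id s : s != 0 -> intg (N 0 s) (fun x => x).
Proof.
move=> s0; apply: intg_dom (intgD (intg_cst _ 1) (normal_intg_pow2 s0)) _ => //.
by move=> x; rewrite ler_norml; apply/andP; split; nra.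
Qed.

(** With y = x / s, y^4 is at most 24 (exp y + exp(-y)), and each exponential has mean exp(1/2). The
    exact constant is 3; only the order s^4 matters later. *)
Lemma normal_pow4_bound s : s != 0 ->
  \int[N 0 s]_x (x ^+ 4) <= 48 * expR (2^-1) * s ^+ 4.
Proof.
move=> s0; have k := normal_intg_expnorm s^-1 s0.
apply: (@le_trans _ _ (\int[N 0 s]_x (24 * s ^+ 4 *
   (expR (s^-1 * x) + expR (- s^-1 * x))))).
  apply: Rint_le; first exact: normal_intg_pow4.
    by apply: intgZ; apply: intgD; exact: (normal_mgf _ s0).1.
  move=> x; have := expR_ge_pow4 (s^-1 * x).
  rewrite exprMn exprVn ler_pdivrMl ?exprn_even_gt0//= => /le_trans; apply.
  rewrite mulrCA mulrA ler_wpM2l//.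
    by rewrite mulr_ge0// exprn_even_ge0.
  by rewrite mulNr expR_norm_le.
rewrite RintZ; last by apply: intgD; exact: (normal_mgf _ s0).1.
rewrite RintD; [|exact: (normal_mgf _ s0).1..].
rewrite !(normal_mgf _ s0).2 sqrrN exprVn mulVf ?sqrf_eq0// mul1r.
by lra.
Qed.

(** Both sides of E exp(t x) = exp(t^2 s^2 / 2) are expanded to second order in t; the two quadratic
    polynomials then differ by O(|t|^3), from which mean and variance are read off. *)
Lemma normal_moment_expansion s : s != 0 -> exists K, forall t, `|t| <= 1 ->
  `|t * - (\int[N 0 s]_x x) +
    t ^+ 2 * (s ^+ 2 - \int[N 0 s]_x (x ^+ 2)) / 2| <= K * `|t| ^+ 3.
Proof.
move=> s0; set m := \int[N 0 s]_x x; set v := \int[N 0 s]_x (x ^+ 2).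
(* [K1] bounds the Taylor remainder of [expR (t * x)]: |x|^3 is at most 6 exp|x|, and the remainder
   brings a second factor exp|x| because |t| is at most 1. [K2] does the same for exp(t^2 s^2 / 2)
   and includes its second-order term, already O(t^4). *)
pose K1 := \int[N 0 s]_x (6 * expR `|2 * x|).
pose K2 := `|s ^+ 2 / 2| ^+ 3 * expR (s ^+ 2 / 2) + (s ^+ 2 / 2) ^+ 2 / 2.
exists (K1 + K2) => t t1.
have iid := normal_intg_id s0; have i2 := normal_intg_pow2 s0.
have [ie eE] := normal_mgf t s0.
have i3 : intg (N 0 s) (fun x => 1 + t * x + t ^+ 2 / 2 * x ^+ 2).
  by do ![apply: intgD|apply: intgZ|apply: intg_cst].
have A : `|expR (t ^+ 2 * s ^+ 2 / 2) - (1 + t * m + t ^+ 2 / 2 * v)| <=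
    K1 * `|t| ^+ 3.
  have -> : expR (t ^+ 2 * s ^+ 2 / 2) - (1 + t * m + t ^+ 2 / 2 * v) =
    \int[N 0 s]_x (expR (t * x) - (1 + t * x + t ^+ 2 / 2 * x ^+ 2)).
    rewrite RintB// eE; congr (_ - _).
    rewrite RintD//; [|by do ![apply: intgD|apply: intgZ|apply: intg_cst]..].
    rewrite RintD ?Rint_cst ?RintZ//; first exact: intg_cst.
    exact: intgZ.
  have i4 := normal_intg_expnorm 2 s0.
  rewrite (mulrC K1) /K1 -RintZ; last exact: intgZ.
  apply: Rint_norm_le; [exact: intgB|by do 2 apply: intgZ|move=> x].
  have := expR_taylor (t * x); rewrite exprMn (mulrAC (t ^+ 2)) => /le_trans.
  apply; rewrite !normrM exprMn -mulrA ler_wpM2l ?exprn_ge0//.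
  have le1 : expR (`|t| * `|x|) <= expR `|x|.
    by rewrite ler_expR ler_piMl.
  apply: le_trans (ler_wpM2l _ le1) _; first by rewrite exprn_ge0.
  apply: le_trans (ler_wpM2r (expR_ge0 _) (expR_ge_pow3 x)) _.
  have -> : `|2| = 2 :> R by rewrite ger0_norm.
  by rewrite -mulrA -expRD (mulr_natl _ 2) mulr2n.
have t31 : `|t| ^+ 4 <= `|t| ^+ 3.
  by rewrite exprSr ler_piMr// exprn_ge0.
have t63 : `|t| ^+ 6 <= `|t| ^+ 3.
  by rewrite (exprD _ 3 3) ler_piMr ?exprn_ile1 ?exprn_ge0.
have B : `|expR (t ^+ 2 * s ^+ 2 / 2) - (1 + t ^+ 2 * s ^+ 2 / 2)| <=
    K2 * `|t| ^+ 3.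
  set w := s ^+ 2 / 2; have w0 : 0 <= w by rewrite divr_ge0 ?sqr_ge0.
  rewrite -mulrA -/w; have := expR_taylor (t ^+ 2 * w).
  have tw0 : 0 <= t ^+ 2 * w by rewrite mulr_ge0 ?sqr_ge0.
  rewrite (ger0_norm tw0) => C.
  have t2 : t ^+ 2 = `|t| ^+ 2 by rewrite real_normK ?num_real.
  have C2 : (t ^+ 2 * w) ^+ 3 * expR (t ^+ 2 * w) <=
      `|t| ^+ 3 * (w ^+ 3 * expR w).
    rewrite exprMn -mulrA; apply: ler_pM.
    - by rewrite exprn_ge0 ?sqr_ge0.
    - by rewrite mulr_ge0 ?exprn_ge0 ?expR_ge0.
    - by rewrite t2 -exprM.
    - rewrite ler_wpM2l ?exprn_ge0// ler_expR ler_piMl// t2.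
      by rewrite exprn_ile1.
  have C3 : (t ^+ 2 * w) ^+ 2 / 2 <= `|t| ^+ 3 * (w ^+ 2 / 2).
    by rewrite exprMn -mulrA ler_wpM2r ?divr_ge0 ?sqr_ge0// t2 -exprM.
  have C0 : 0 <= (t ^+ 2 * w) ^+ 2 / 2 by rewrite divr_ge0 ?sqr_ge0.
  rewrite /K2 -/w (ger0_norm w0).
  move: C; rewrite !ler_norml => /andP[C4 C5]; apply/andP; split; lra.
move: A B; rewrite !ler_norml => /andP[A1 A2] /andP[B1 B2].
by apply/andP; split; lra.
Qed.

(* Letting t tend to 0 along both signs separates the two coefficients. *)
Lemma cubic_small (a b K : R) :
  (forall t, `|t| <= 1 -> `|t * a + t ^+ 2 * b| <= K * `|t| ^+ 3) ->
  a = 0 /\ b = 0.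
Proof.
move=> h; have K0 : 0 <= K.
  by have := h 1; rewrite normr1 !expr1n mulr1 => /(_ (lexx _)); apply: le_trans.
have h1 t : 0 < t -> t <= 1 -> `|a| <= K * t /\ `|b| <= K * t.
  move=> t0 t1; have tN : `|t| = t by exact: gtr0_norm.
  have := h t; have := h (- t); rewrite normrN tN sqrrN => /(_ t1) + /(_ t1).
  have t20 : 0 < t ^+ 2 by rewrite exprn_gt0.
  rewrite !ler_norml !exprS expr0 mulr1 => /andP[p1 p2] /andP[p3 p4].
  have q1 : t * a <= K * (t * (t * t)) by lra.
  have q2 : - (t * a) <= K * (t * (t * t)) by lra.
  have q3 : t * t * b <= K * (t * (t * t)) by lra.
  have q4 : - (t * t * b) <= K * (t * (t * t)) by lra.
  have q5 : K * (t * (t * t)) <= t * (K * t).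
    rewrite [leLHS](_ : _ = t * (K * t) * t); last by ring.
    by rewrite ler_piMr// !mulr_ge0// ltW.
  split; apply/andP; split.
  - by rewrite -(ler_pM2l t0); lra.
  - by rewrite -(ler_pM2l t0); lra.
  - by rewrite -(ler_pM2l t20) expr2; lra.
  - by rewrite -(ler_pM2l t20) expr2; lra.
have small (c : R) : (forall t, 0 < t -> t <= 1 -> `|c| <= K * t) -> c = 0.
  move=> hc; apply/eqP; rewrite -normr_eq0; apply/negPn/negP => c0.
  have {c0}c0 : 0 < `|c| by rewrite lt_neqAle eq_sym c0/=.
  pose t := Num.min 1 (`|c| / (2 * (K + 1))).
  have t0 : 0 < t by rewrite /t lt_min ltr01/= divr_gt0//; lra.
  have := hc t t0; rewrite /t ge_min lexx => /(_ isT).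
  have : K * t <= K * (`|c| / (2 * (K + 1))).
    by rewrite ler_wpM2l// /t ge_min lexx orbT.
  have : K * (`|c| / (2 * (K + 1))) < `|c|.
    rewrite mulrA ltr_pdivrMr; last by lra.
    by nra.
  by rewrite /t; lra.
by split; apply: small => t t0 t1; have [] := h1 t t0 t1.
Qed.

Lemma normal_mean s : s != 0 -> \int[N 0 s]_x x = 0.
Proof.
move=> s0; have [K hK] := normal_moment_expansion s0.
have [] := @cubic_small (- \int[N 0 s]_x x)
  ((s ^+ 2 - \int[N 0 s]_x (x ^+ 2)) / 2) K.
  by move=> t /hK; rewrite -mulrA.
by move/eqP; rewrite oppr_eq0 => /eqP.
Qed.

Lemma normal_var s : s != 0 -> \int[N 0 s]_x (x ^+ 2) = s ^+ 2.
Proof.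
move=> s0; have [K hK] := normal_moment_expansion s0.
have [|_] := @cubic_small (- \int[N 0 s]_x x)
  ((s ^+ 2 - \int[N 0 s]_x (x ^+ 2)) / 2) K.
  by move=> t /hK; rewrite -mulrA.
by move=> h; lra.
Qed.

End normal_integrals.

(** * Convolution with a normal density *)

Section fubini_swap.
Context d1 d2 (T1 : measurableType d1) (T2 : measurableType d2) (R : realType).
Variables (m1 : {sigma_finite_measure set T1 -> \bar R}).
Variables (m2 : {sigma_finite_measure set T2 -> \bar R}).

(** Here only the inner integral of [|k|] is dominated, not [k] itself by a product. This suits
    convolution kernels, whose mass in [y] is bounded uniformly in [x]. *)
Lemma fubini_swap (k : T1 * T2 -> R) (U : T1 -> R) : measurable_fun setT k ->
  (forall x, intg m2 (fun y => k (x, y))) ->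
  (forall y, intg m1 (fun x => k (x, y))) ->
  intg m1 U -> (forall x, \int[m2]_y `|k (x, y)| <= U x) ->
  \int[m1]_x \int[m2]_y k (x, y) = \int[m2]_y \int[m1]_x k (x, y).
Proof.
move=> mk i2 i1 iU kU.
have mk' : measurable_fun setT (EFin \o k) by exact/measurable_EFinP.
have i12 : (m1 \x m2)%E.-integrable setT (EFin \o k).
  apply/integrable12ltyP => //=.
  apply: (@le_lt_trans _ _ (\int[m1]_x (U x)%:E)%E); last first.
    by rewrite RintE// ltry.
  apply: ge0_le_integral => //=.
  - by move=> x _; apply: integral_ge0.
  - apply: (measurable_fun_fubini_tonelli_F (fun z => `|k z|%:E)) => //=.
    by apply/measurable_EFinP; exact: measurableT_comp.
  - by apply/measurable_EFinP; exact: intg_measurable iU.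
  - by move=> x _; rewrite RintE ?lee_fin//; exact: intg_norm.
apply: EFin_inj.
transitivity (\int[m1]_x \int[m2]_y (k (x, y))%:E)%E.
  rewrite -RintE; first by apply: eq_integral => x _; rewrite RintE.
  have := integrable_fubini_F i12; apply: eq_integrable => // x _ /=.
  by rewrite /fubini_F -RintE.
rewrite (Fubini i12) -RintE; first by apply: eq_integral => y _; rewrite -RintE.
have : m2.-integrable setT (fubini_G m1 (EFin \o k)).
  apply/integrableP; split; first exact: measurable_fubini_G i12.
  apply: le_lt_trans ((integrable21ltyP _ _ mk').1 i12).
  apply: ge0_le_integral => //=.
  - by apply: measurableT_comp => //; exact: measurable_fubini_G i12.
  - apply: (measurable_fun_fubini_tonelli_G (fun z => `|k z|%:E)) => //=.
    by apply/measurable_EFinP; exact: measurableT_comp.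
  - move=> y _; apply: le_abse_integral => //.
    by apply/measurable_EFinP; exact: intg_measurable (i1 y).
by apply: eq_integrable => // y _ /=; rewrite /fubini_G -RintE.
Qed.

Lemma measurable_Rint2 (k : T1 * T2 -> R) : measurable_fun setT k ->
  (forall z, 0 <= k z) -> measurable_fun setT (fun x => \int[m2]_y k (x, y)).
Proof.
move=> mk k0; apply: measurableT_comp => //.
apply: (measurable_fun_fubini_tonelli_F (fun z => (k z)%:E)) => //.
exact/measurable_EFinP.
Qed.

End fubini_swap.

(** * Translation invariance of Lebesgue measure *)

Section lebesgue_shift.
Context (R : realType).
Local Notation lam := (@lebesgue_measure R).

(** Lebesgue measure is determined by its values on half-open intervals, and translations preserve
    their lengths. *)
Lemma lebesgue_measure_shift (c : R) (A : set R) : measurable A ->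
  pushforward lam ((fun x => x + c) : measurableTypeR R -> measurableTypeR R) A
  = lam A.
Proof.
move=> mA; apply/esym/lebesgue_measure_unique => //=.
  exact: measurable_funD.
move=> mc _ [[a b]] _ <-; rewrite /pushforward.
have -> : (fun x : R => x + c) @^-1` `]a, b] = `](a - c), (b - c)]%classic.
  by apply/seteqP; split => x /=; rewrite !in_itv/= ltrBlDr lerBrDr.
rewrite !lebesgue_measure_itv/= !lte_fin ltrD2r.
by case: ifP => // _; rewrite -!EFinD; congr (_%:E); lra.
Qed.

(** The image of Lebesgue measure under [phi] is Lebesgue measure again, so the integral of [g] is
    that of [g \o phi], which is [f]. *)
Lemma Rint_shift (c : R) (f : R -> R) : intg lam f ->
  intg lam (fun x => f (x + c)) /\
  \int[lam]_x f (x + c) = \int[lam]_x f x.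
Proof.
move=> hf; pose g x := f (x + c).
pose phi := (fun x => x - c) : measurableTypeR R -> measurableTypeR R.
have mphi : measurable_fun setT phi by exact: measurable_funB.
have gphi : EFin \o g \o phi = EFin \o f.
  by apply/funext => x; rewrite /= /g /phi subrK.
have mg : measurable_fun setT g.
  apply: measurableT_comp; first exact: intg_measurable hf.
  exact: measurable_funD.
have mEg : measurable_fun setT (EFin \o g) by exact/measurable_EFinP.
have E h : (\int[pushforward lam phi]_x h x = \int[lam]_x h x)%E.
  by apply: eq_measure_integral => // A mA _; exact: lebesgue_measure_shift.
have ig : lam.-integrable setT (EFin \o g).
  apply/integrableP; split => //; rewrite -E.
  rewrite (ge0_integral_pushforward mphi lam measurableT)//; last first.
    exact: measurableT_comp.
  rewrite preimage_setT; have /integrableP[_] := hf.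
  by congr (_ < _)%E; apply: eq_integral => x _; rewrite /= /g /phi subrK.
split=> //; apply: EFin_inj; rewrite -!RintE// -E.
rewrite (integral_pushforward mphi mEg) ?preimage_setT//=.
  by apply: eq_integral => x _; rewrite /= /g /phi subrK.
by rewrite [X in integrable _ _ X]gphi.
Qed.

End lebesgue_shift.

(** * The Gaussian semigroup *)

Section gaussian_convolution.
Context (R : realType).
Implicit Types (s t x y : R) (f : R -> R).
Local Notation lam := (@lebesgue_measure R).
Local Notation N m s := (normal_prob m s : probability (measurableTypeR R) R).

(** The mean of [f (x + s * Z)] for a standard normal Z. The case [s = 0] is separate because
    [normal_prob 0 0] is not the point mass at 0. *)
Definition gconv s f x := if s == 0 then f x else \int[N 0 s]_y f (x + y).

Lemma measurable_shift f x : measurable_fun setT f ->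
  measurable_fun setT (fun y => f (x + y)).
Proof. by move=> mf; apply: measurableT_comp => //; exact: measurable_funD. Qed.

Lemma intg_shift_bounded s f M x : measurable_fun setT f ->
  (forall y, `|f y| <= M) -> intg (N 0 s) (fun y => f (x + y)).
Proof. by move=> mf fM; apply: (@intg_bounded _ _ _ (N 0 s) _ M (measurable_shift x mf)). Qed.

Lemma gconv_bounded s f M x : measurable_fun setT f ->
  (forall y, `|f y| <= M) -> `|gconv s f x| <= M.
Proof.
move=> mf fM; rewrite /gconv; case: ifP => // _.
rewrite -[leRHS](Rint_cst (N 0 s)); apply: Rint_norm_le => //.
  exact: intg_shift_bounded.
exact: intg_cst.
Qed.

Lemma measurable_gconv s f M : measurable_fun setT f ->
  (forall y, `|f y| <= M) -> measurable_fun setT (gconv s f).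
Proof.
move=> mf fM; rewrite /gconv; have [//|_] := eqVneq s 0.
(* Adding [M] makes the integrand nonnegative, as Tonelli's measurability statement requires. *)
have -> : (fun x => \int[N 0 s]_y f (x + y)) =
    (fun x => \int[N 0 s]_y (f (x + y) + M) - M).
  apply/funext => x; rewrite RintD ?Rint_cst ?addrK//.
    exact: intg_shift_bounded fM.
  exact: intg_cst.
apply: measurable_funB => //.
apply: (@measurable_Rint2 _ _ (measurableTypeR R) (measurableTypeR R) R (N 0 s)
  (fun z => f (z.1 + z.2) + M)).
  apply: measurable_funD => //; apply: measurableT_comp => //.
  exact: measurable_funD.
by move=> z; have := fM (z.1 + z.2); rewrite ler_norml => /andP[]; lra.
Qed.

(** For independent Y and Z with standard deviations s and t, the joint density of Y and U = Y + Z
    factors into the density of U and the conditional density of Y given U, with mean s^2 U / (s^2 +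
    t^2). The proof completes the square in y. *)
Lemma normal_pdf_conv s t u y : s != 0 -> t != 0 ->
  normal_pdf 0 t (u - y) * normal_pdf 0 s y =
  normal_pdf 0 (Num.sqrt (s ^+ 2 + t ^+ 2)) u *
  normal_pdf (s ^+ 2 / (s ^+ 2 + t ^+ 2) * u)
    (s * t / Num.sqrt (s ^+ 2 + t ^+ 2)) y.
Proof.
move=> s0 t0; set c := Num.sqrt _.
have c2 : c ^+ 2 = s ^+ 2 + t ^+ 2 by rewrite sqr_sqrtr// addr_ge0 ?sqr_ge0.
have st0 : 0 < s ^+ 2 + t ^+ 2 by rewrite addr_gt0// exprn_even_gt0.
have c0 : c != 0 by rewrite gt_eqF// sqrtr_gt0.
have stc0 : s * t / c != 0 by rewrite !mulf_neq0// invr_eq0.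
rewrite !normal_pdfE// mulrACA [RHS]mulrACA; congr (_ * _).
  have pe r : r != 0 -> normal_peak r = (`|r| * Num.sqrt (pi *+ 2))^-1.
    move=> r0; rewrite /normal_peak -mulrnAr sqrtrM ?sqr_ge0//.
    by rewrite sqrtr_sqr.
  rewrite !pe// -!invfM; congr (_^-1); rewrite !normrM normfV.
  by field; rewrite normr_eq0.
rewrite /normal_fun -!expRD; congr expR.
rewrite -(mulr_natr (t ^+ 2) 2) -(mulr_natr (s ^+ 2) 2).
rewrite -(mulr_natr (c ^+ 2) 2) -(mulr_natr ((s * t / c) ^+ 2) 2).
rewrite -c2; have -> : (s * t / c) ^+ 2 = s ^+ 2 * t ^+ 2 / c ^+ 2.
  by rewrite exprMn exprVn exprMn.
have -> : t ^+ 2 = c ^+ 2 - s ^+ 2 by rewrite c2 addrAC subrr add0r.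
have ts : c ^+ 2 - s ^+ 2 != 0.
  by rewrite c2 addrAC subrr add0r sqrf_eq0.
move: (c ^+ 2) ts (expf_neq0 2 c0) => C ts C0.
by field; rewrite C0 ts s0.
Qed.

(** Variances of independent normal variables add up. After the substitution u = y + z the integrals
    are exchanged, and the conditional density of [normal_pdf_conv] integrates to 1 over y. *)
Lemma gconvD s t f M x : measurable_fun setT f -> (forall y, `|f y| <= M) ->
  0 <= s -> 0 <= t ->
  gconv s (gconv t f) x = gconv (Num.sqrt (s ^+ 2 + t ^+ 2)) f x.
Proof.
move=> mf fM sp tp; have [->|s0] := eqVneq s 0.
  by rewrite {1}/gconv eqxx expr0n/= add0r sqrtr_sqr ger0_norm.
have [->|t0] := eqVneq t 0.
  rewrite expr0n/= addr0 sqrtr_sqr ger0_norm// /gconv (negbTE s0).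
  by rewrite eqxx.
set c := Num.sqrt _.
have st0 : 0 < s ^+ 2 + t ^+ 2 by rewrite addr_gt0// exprn_even_gt0.
have c0 : c != 0 by rewrite gt_eqF// sqrtr_gt0.
rewrite /gconv (negbTE s0) (negbTE t0) (negbTE c0).
pose k (z : measurableTypeR R * measurableTypeR R) :=
  f (x + z.2) * normal_pdf 0 t (z.2 - z.1).
have mfs := measurable_shift x mf.
have mk : measurable_fun setT k.
  apply: measurable_funM; first exact: (measurableT_comp mfs measurable_snd).
  apply: (measurableT_comp (measurable_normal_pdf 0 t)).
  exact: measurable_funB.
have shiftE y : intg lam (fun u => k (y, u)) /\
    \int[N 0 t]_z f (x + y + z) = \int[lam]_u k (y, u).
  have [h1 h2] := Rint_normal (intg_shift_bounded t (x + y) mf fM).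
  have [] := Rint_shift (- y) h1; rewrite h2.
  have e : (fun u => f (x + y + (u - y)) * normal_pdf 0 t (u - y)) =
     (fun u => k (y, u)).
    by apply/funext => u; rewrite /k /=; congr (f _ * _); lra.
  by rewrite e => h3 h4; split=> //; rewrite h4.
have pdfsh y : intg lam (fun u => normal_pdf 0 t (u - y)) /\
    \int[lam]_u normal_pdf 0 t (u - y) = 1.
  have [h1 h2] := Rint_shift (- y) (integrable_normal_pdf 0 t).
  by split => //; rewrite h2 /Rintegral integral_normal_pdf.
transitivity (\int[N 0 s]_y \int[lam]_u k (y, u)).
  by apply: eq_Rint => y; rewrite (shiftE y).2.
have iM : intg (N 0 s) (fun=> M) by exact: intg_cst.
have k1 u : intg (N 0 s) (fun y => k (y, u)).
  apply: (@intg_bounded _ _ _ (N 0 s) _ (M * normal_peak t)).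
    exact: (measurableT_comp mk (measurable_pair2 u)).
  move=> y; rewrite normrM ler_pM//.
  by rewrite (ger0_norm (normal_pdf_ge0 _ _ _)) normal_pdf_ub.
rewrite (fubini_swap (m1 := N 0 s) mk (fun y => (shiftE y).1) k1 iM).
  rewrite (Rint_normal (intg_shift_bounded c x mf fM)).2.
  apply: eq_Rint => u.
  rewrite (Rint_normal (k1 u)).2 /k/=.
  under eq_Rintegral do rewrite -mulrA normal_pdf_conv// mulrA.
  rewrite RintZ; last exact: integrable_normal_pdf.
  by rewrite /Rintegral integral_normal_pdf mulr1.
move=> y; rewrite -[leRHS]mulr1 -(pdfsh y).2 -RintZ; last exact: (pdfsh y).1.
apply: Rint_le; [exact: intg_norm (shiftE y).1|exact: intgZ (pdfsh y).1|].
move=> u; rewrite normrM (ger0_norm (normal_pdf_ge0 _ _ _)).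
by rewrite ler_wpM2r ?normal_pdf_ge0.
Qed.

End gaussian_convolution.

(** * Independence *)

Section transfer.
Context dT (T : measurableType dT) (R : realType) (P : probability T R).
Context dE (E : measurableType dE).

Definition mkRV (f : T -> E) (mf : measurable_fun setT f) : {RV P >-> E} :=
  HB.pack f (isMeasurableFun.Build _ _ _ _ f mf).

Lemma intg_distr (Y : {RV P >-> E}) (f : E -> R) : measurable_fun setT f ->
  intg P (fun w => f (Y w)) <-> intg (distribution P Y) f.
Proof.
move=> mf; have mEf : measurable_fun setT (EFin \o f) by exact/measurable_EFinP.
have mfY : measurable_fun setT (fun w => f (Y w)) by exact: measurableT_comp.
have E0 : (\int[distribution P Y]_y `|(f y)%:E| = \int[P]_w `|(f (Y w))%:E|)%E.
  by rewrite ge0_integral_distribution//; exact: measurableT_comp.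
split=> /integrableP[_ h]; apply/integrableP; split.
- exact/measurable_EFinP.
- by rewrite E0.
- exact/measurable_EFinP.
- by rewrite -E0.
Qed.

Lemma Rint_distr (Y : {RV P >-> E}) (f : E -> R) : measurable_fun setT f ->
  intg P (fun w => f (Y w)) ->
  \int[distribution P Y]_y f y = \int[P]_w f (Y w).
Proof.
move=> mf hf; rewrite /Rintegral integral_distribution//.
exact/measurable_EFinP.
Qed.

End transfer.

Section indep_pair.
Context dT (T : measurableType dT) (R : realType) (P : probability T R).
Context d1 (E1 : measurableType d1) d2 (E2 : measurableType d2).
Variables (Y1 : {RV P >-> E1}) (Y2 : {RV P >-> E2}).

Definition indep_pair := forall A B, measurable A -> measurable B ->
  P (Y1 @^-1` A `&` Y2 @^-1` B) = (P (Y1 @^-1` A) * P (Y2 @^-1` B))%E.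

(** Independence makes the law of the pair agree with the product of the two laws on rectangles,
    hence everywhere; dominated Fubini then applies. The inner variable [v] is a second copy of the
    sample point. *)
Lemma indep_fubini (k : E1 * E2 -> R) (U : E1 -> R) (V : E2 -> R) :
  indep_pair -> measurable_fun setT k ->
  measurable_fun setT U -> measurable_fun setT V ->
  (forall x y, `|k (x, y)| <= U x * V y) ->
  intg P (fun w => U (Y1 w)) -> intg P (fun w => V (Y2 w)) ->
  intg P (fun w => k (Y1 w, Y2 w)) /\
  \int[P]_w k (Y1 w, Y2 w) = \int[P]_w \int[P]_v k (Y1 w, Y2 v).
Proof.
move=> ind mk mU mV kUV iU iV.
pose mu1 := distribution P Y1; pose mu2 := distribution P Y2.
have jU : intg mu1 U by apply/intg_distr.
have jV : intg mu2 V by apply/intg_distr.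
have mYY : measurable_fun setT (fun w => (Y1 w, Y2 w)).
  exact/measurable_fun_pairP.
pose YY : {RV P >-> (E1 * E2)%type} := mkRV P mYY.
have muE A : measurable A -> (mu1 \x mu2)%E A = distribution P YY A.
  by apply: product_measure_unique => C D mC mD; exact: ind.
have mEk : measurable_fun setT (EFin \o k) by exact/measurable_EFinP.
have int_eq (h : E1 * E2 -> \bar R) :
    (\int[(mu1 \x mu2)%E]_z h z = \int[distribution P YY]_z h z)%E.
  by apply: eq_measure_integral => A mA _; exact: muE.
have i12 := dom_intg12 mk kUV jU jV.
have ik : intg P (fun w => k (Y1 w, Y2 w)).
  apply/(intg_distr YY mk)/integrableP; split => //.
  by rewrite -int_eq; have /integrableP[_] := i12.
split=> //; rewrite -(Rint_distr (Y := YY) mk ik).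
transitivity (\int[mu1]_x \int[mu2]_y k (x, y)).
  apply: EFin_inj; rewrite -RintE; last exact/(intg_distr YY mk).
  rewrite -int_eq -(integral12_prod_meas1 i12) -RintE; last exact: dom_intgF jV.
  apply: eq_integral => x _; rewrite /fubini_F -RintE//.
  exact: dom_intg2 jV _.
have mk2 x : measurable_fun setT (fun y => k (x, y)).
  exact: (measurableT_comp mk (measurable_pair1 x)).
have mF : measurable_fun setT (fun x => \int[mu2]_y k (x, y)).
  by apply: intg_measurable; exact: dom_intgF mk kUV jU jV.
rewrite Rint_distr//; last first.
  by apply: (intg_distr Y1 mF).2; exact: dom_intgF mk kUV jU jV.
apply: eq_Rint => w; rewrite Rint_distr//.
by apply: (intg_distr Y2 (mk2 _)).2; exact: dom_intg2 mk kUV jV _.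
Qed.

End indep_pair.

(** * Equality of laws, and independence of the next term from the past *)

Section iid_sample.
Context dT (T : measurableType dT) (R : realType) (P : probability T R).
Context dE (E : measurableType dE) (X : nat -> {RV P >-> E}).
Hypothesis X_iid : iid X.

Lemma iid_intg (f : E -> R) j : measurable_fun setT f ->
  intg P (fun w => f (X 0%N w)) -> intg P (fun w => f (X j w)).
Proof.
move=> mf /(intg_distr _ mf) /integrableP[mEf h].
apply/intg_distr => //; apply/integrableP; split => //.
move: h; congr (_ < _)%E; apply: eq_measure_integral => A mA _.
by apply/esym; exact: X_iid.2.
Qed.

Lemma iid_Rint (f : E -> R) j : measurable_fun setT f ->
  intg P (fun w => f (X 0%N w)) ->
  \int[P]_w f (X j w) = \int[P]_w f (X 0%N w).
Proof.
move=> mf hf; rewrite -!Rint_distr//; last exact: iid_intg.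
by congr fine; apply: eq_measure_integral => A mA _; exact: X_iid.2.
Qed.

Lemma iid_pair i j : i != j -> indep_pair (X i) (X j).
Proof.
move=> ij A B mA mB.
have /= := X_iid.1 [:: i; j] (fun k => if k == i then A else B).
rewrite inE ij !big_cons big_nil eqxx eq_sym (negbTE ij) mule1.
have -> : \bigcap_(k in [set` [:: i; j]]) X k @^-1` (if k == i then A else B) =
    X i @^-1` A `&` X j @^-1` B.
  apply/seteqP; split => [w h|w [h1 h2] k /=].
    split; first by have := h i; rewrite eqxx; apply; rewrite /= inE eqxx.
    by have := h j; rewrite eq_sym (negbTE ij); apply; rewrite /= !inE eqxx orbT.
  by rewrite !inE => /orP[/eqP ->|/eqP ->]; rewrite ?eqxx// eq_sym (negbTE ij).
by apply=> // k; case: ifP.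
Qed.

(* The past is generated by the pi-system of finite-dimensional rectangles,
   hence Dynkin's theorem. *)
Lemma past_indep dF (F : measurableType dF) (u : E -> R) (v : E -> F) n
  (mu : measurable_fun setT u) (mv : measurable_fun setT v)
  (mS : measurable_fun setT (fun w => \sum_(1 <= j < n.+1) u (X j w)))
  (mv' : measurable_fun setT (fun w => v (X n.+1 w))) :
  indep_pair (mkRV P mS) (mkRV P mv').
Proof.
move=> A B mA mB; set C := mkRV P mv' @^-1` B.
have mC : measurable C by rewrite -[C]setTI; exact: (measurable_funPT (mkRV P mv')).
pose rect (D : nat -> set E) : set T :=
  \bigcap_(k in [set` iota 1 n]) X k @^-1` D k.
pose G : set (set T) := [set Z | exists2 D, (forall k, measurable (D k)) & Z = rect D].
have mrect D : (forall k, measurable (D k)) -> measurable (rect D).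
  move=> mD; apply: fin_bigcap_measurable => // k _.
  by rewrite -[X in measurable X]setTI; exact: measurable_funPT.
have rectP D : (forall k, measurable (D k)) ->
    P (rect D `&` C) = (P (rect D) * P C)%E.
  (* [rect D] constrains the indices 1 to [n] only, so the slot [n.+1] is free to carry the
     condition on the next term. *)
  move=> mD; pose D' k := if k == n.+1 then v @^-1` B else D k.
  have mD' k : measurable (D' k).
    rewrite /D'; case: ifP => // _; rewrite -[X in measurable X]setTI; exact: mv.
  have nin k : k \in iota 1 n -> (k == n.+1) = false.
    by rewrite mem_iota add1n => /andP[_ kn]; rewrite ltn_eqF.
  have DD' : rect D = rect D'.
    by apply: eq_bigcapr => k /= kn; rewrite /D' nin.
  have := X_iid.1 (n.+1 :: iota 1 n) D'.
  rewrite cons_uniq iota_uniq andbT big_cons.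
  have -> : \bigcap_(k in [set` n.+1 :: iota 1 n]) X k @^-1` D' k = rect D `&` C.
    rewrite DD'; apply/seteqP; split => [w h|w [h1 h2] k /=].
      split; first by move=> k kn; apply: h; rewrite /= inE kn orbT.
      by have := h n.+1; rewrite /D' eqxx; apply; rewrite /= inE eqxx.
    rewrite inE => /orP[/eqP ->|kn]; last exact: h1.
    by rewrite /D' eqxx.
  move=> -> //; last by rewrite mem_iota add1n ltnn andbF.
  rewrite -(X_iid.1 (iota 1 n) D' (iota_uniq _ _) mD') -/(rect D') -DD' muleC.
  by rewrite {1}/D' eqxx.
pose H : set (set T) := [set Z | measurable Z /\ P (Z `&` C) = (P Z * P C)%E].
have GH : <<s G >> `<=` H.
  apply: (@lambda_system_subset _ _ _ setT H).
  - move=> _ _ [D1 mD1 ->] [D2 mD2 ->].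
    exists (fun k => D1 k `&` D2 k); first by move=> k; exact: measurableI.
    apply/seteqP; split => [w [h1 h2] k kn|w h]; first by split; [exact: h1|exact: h2].
    by split => k kn; have [] := h k kn.
  - split => //.
    + by split; rewrite ?setTI ?probability_setT ?mul1e.
    + move=> Z1 Z2 Z21 [m1 p1] [m2 p2]; split; first exact: measurableD.
      have fin Z : measurable Z -> (P Z < +oo)%E.
        by move=> mZ; rewrite -ge0_fin_numE// fin_num_measure.
      have mI1 := measurableI _ _ m1 mC.
      have -> : (Z1 `\` Z2) `&` C = (Z1 `&` C) `\` Z2 by rewrite setIDAC setIDA.
      rewrite !measureD ?fin//.
      have -> : Z1 `&` C `&` Z2 = Z2 `&` C.
        by rewrite setIAC (setIidr Z21).
      transitivity (P Z1 * P C - P Z2 * P C)%E; first by congr (_ - _)%E.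
      rewrite (setIidr Z21) muleBl ?fin_num_measure//.
      by apply: fin_num_adde_defl; rewrite fin_numN fin_num_measure.
    + move=> F0 ndF0 F0H; have mF0 i : measurable (F0 i) by have [] := F0H i.
      split; first exact: bigcup_measurable.
      have c1 : P (F0 i) @[i --> \oo] --> P (\bigcup_i F0 i).
        by apply: nondecreasing_cvg_mu => //; exact: bigcup_measurable.
      have c2 : P (F0 i `&` C) @[i --> \oo] --> P ((\bigcup_i F0 i) `&` C).
        rewrite setI_bigcupl; apply: nondecreasing_cvg_mu => //.
        * by move=> i; exact: measurableI.
        * by apply: bigcup_measurable => i _; exact: measurableI.
        * move=> i j ij; apply/subsetPset; apply: setSI.
          by apply/subsetPset; exact: ndF0.
      have c3 : P (F0 i `&` C) @[i --> \oo] --> (P (\bigcup_i F0 i) * P C)%E.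
        under eq_fun do rewrite (F0H _).2.
        by apply: cvgeZr => //; rewrite fin_num_measure.
      exact: cvg_unique c2 c3.
  - by move=> Z [D mD ->]; split; [exact: mrect|exact: rectP].
  - by [].
(* It remains to see that the sum is measurable for the sigma-algebra generated by the rectangles;
   each summand is, its preimages being rectangles constrained at a single index. *)
suff : <<s G >> (mkRV P mS @^-1` A) by move=> /GH[].
have mXG k : (1 <= k < n.+1)%N ->
    measurable_fun [set: g_sigma_algebraType G] (fun w => u (X k w)).
  move=> /andP[k1 kn] _ D mD; rewrite setTI; apply: sub_sigma_algebra.
  exists (fun l => if l == k then u @^-1` D else setT).
    by move=> l; case: ifP => // _; rewrite -[X in measurable X]setTI; exact: mu.
  apply/seteqP; split => [w h l /= ln|w h].
    by case: ifP => // /eqP ->.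
  have := h k; rewrite /= eqxx; apply.
  by rewrite mem_iota k1 add1n.
have mSG m : (m <= n)%N -> measurable_fun [set: g_sigma_algebraType G]
    (fun w => \sum_(1 <= j < m.+1) u (X j w)).
  elim: m => [_|m ih mn].
    by under eq_fun do rewrite big_geq//; exact: measurable_cst.
  under eq_fun do rewrite big_nat_recr//=.
  by apply: measurable_funD; [exact: ih (ltnW mn)|exact: mXG].
by have := mSG n (leqnn n) measurableT A mA; rewrite setTI.
Qed.

End iid_sample.

(** * Smooth approximation *)

Section smoothing.
Context (R : realType).
Implicit Types (f g : R -> R) (x y M L h : R).
Local Notation lam := (@lebesgue_measure R).

(** Second-order Taylor bounds are recorded in place of derivatives: they are what the replacement
    step consumes, and they pass to Gaussian convolutions by integration, without differentiating
    under the integral. The quadratic and the cubic bound together give Lindeberg's minimum of y^2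
    and |y|^3. *)
Record smooth2 M g g1 g2 : Prop := Smooth2 {
  smooth2_m0 : measurable_fun setT g;
  smooth2_m1 : measurable_fun setT g1;
  smooth2_m2 : measurable_fun setT g2;
  smooth2_b0 : forall x, `|g x| <= M;
  smooth2_b1 : forall x, `|g1 x| <= M;
  smooth2_b2 : forall x, `|g2 x| <= M;
  smooth2_t2 : forall x y,
    `|g (x + y) - g x - g1 x * y - g2 x * (y ^+ 2 / 2)| <= M * y ^+ 2;
  smooth2_t3 : forall x y,
    `|g (x + y) - g x - g1 x * y - g2 x * (y ^+ 2 / 2)| <= M * `|y| ^+ 3 }.

(** Two mean value inequalities, for [r1] and then for [r0]. The oscillation [b] of the second
    derivative is left open: a constant yields the quadratic bound of [smooth2], a multiple of [|y|]
    the cubic one. *)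
Lemma taylor2_bound (g g1 g2 : R -> R) (b : R -> R) x y :
  (forall x, is_derive x 1 g (g1 x)) -> (forall x, is_derive x 1 g1 (g2 x)) ->
  (forall u, `|u| <= `|y| -> `|g2 (x + u) - g2 x| <= b y) ->
  `|g (x + y) - g x - g1 x * y - g2 x * (y ^+ 2 / 2)| <= b y * y ^+ 2.
Proof.
move=> d1 d2 h2.
pose r1 u : R := g1 u - g2 x * (u - x).
pose r0 u : R := g u - g1 x * (u - x) - g2 x * ((u - x) ^+ 2 / 2).
have D1 (u : R) : is_derive u 1 r1 (g2 u - g2 x).
  by apply: is_derive_eq; rewrite subr0 /GRing.scale/= mulr1.
have D0 (u : R) : is_derive u 1 r0 (r1 u - g1 x).
  by apply: is_derive_eq; rewrite /r1 /GRing.scale/=; lra.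
have e1 u : `|u - x| <= `|y| -> `|r1 u - g1 x| <= b y * `|y|.
  move=> uy; have := @mvt_bound R r1 (fun v => g2 v - g2 x) x u (b y) D1.
  rewrite {2}/r1 subrr mulr0 subr0 => H.
  apply: le_trans (H _) _ => [v vu|].
    by have := h2 (v - x); rewrite subrKC; apply; exact: le_trans uy.
  have b0 : 0 <= b y by apply: le_trans (h2 0 _) => //; rewrite normr0.
  by rewrite ler_wpM2l.
have := @mvt_bound R r0 (fun v => r1 v - g1 x) x (x + y) (b y * `|y|) D0.
rewrite /r0 subrr expr0n/= mul0r !mulr0 !subr0 (addrC x) addrK => H.
have -> : g (y + x) - g x - g1 x * y - g2 x * (y ^+ 2 / 2) =
  g (y + x) - g1 x * y - g2 x * (y ^+ 2 / 2) - g x by lra.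
apply: le_trans (H e1) _.
by rewrite -mulrA -expr2 real_normK ?num_real.
Qed.

Lemma is_derive_continuous f df : (forall x, is_derive x 1 f (df x)) ->
  continuous f.
Proof.
move=> dF x; apply/differentiable_continuous/derivable1_diffP.
exact: (@ex_derive _ _ _ _ _ _ _ (dF x)).
Qed.

Lemma continuous_measurable f : continuous f -> measurable_fun setT f.
Proof. exact: continuous_measurable_fun. Qed.

(** Vanishing on the negative half-line makes the integral from minus infinity converge, so that the
    fundamental theorem of calculus applies to it. *)
Lemma antiderivative_pos f : continuous f -> (forall x, x <= 0 -> f x = 0) ->
  exists F, forall x, is_derive x 1 F (f x).
Proof.
move=> cf f0; pose F x := \int[lam]_(t in [set` `]-oo, x]]) f t.
exists F => x; have x1 : x < x + 1 by rewrite ltrDl.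
have mf : measurable_fun setT f := continuous_measurable cf.
have intf (u : R) : 0 < u -> lam.-integrable [set` `]-oo, u]] (EFin \o f).
  move=> u0; have i0 : lam.-integrable `[0, u] (EFin \o f).
    apply: continuous_compact_integrable; first exact: segment_compact.
    by apply: continuous_subspaceT.
  have i2 : lam.-integrable [set` `]-oo, u]] ((EFin \o f) \_ `[0, u]).
    apply: (integrableS measurableT) => //.
    exact/(integrable_mkcond _ _).1.
  apply: eq_integrable i2 => // y; rewrite inE/= in_itv/= => yu.
  rewrite patchE; case: ifPn => //; rewrite notin_setE/= in_itv/= yu andbT.
  by move/negP; rewrite -ltNge => /ltW /f0 ->.
have ix : lam.-integrable [set` `]-oo, (Num.max x 0 + 1)]] (EFin \o f).
  by apply: intf; rewrite ltr_wpDl// le_max lexx orbT.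
have xm : x < Num.max x 0 + 1 by rewrite ltr_pwDr// le_max lexx.
have [dF DF] := continuous_FTC1 xm ix (ltNyr x) (cf x).
by apply: DeriveDef => //; rewrite -derive1E.
Qed.

(** With the ramp [p] rising from 0 to 1 on [0, 1], [f] splits into [f * p], zero on the left, and
    [f * (1 - p)], zero to the right of 1; the reflection of the latter at 1/2 falls under the
    previous case. *)
Lemma antiderivative f : continuous f ->
  exists F, forall x, is_derive x 1 F (f x).
Proof.
move=> cf; pose p x : R := Num.min 1 (Num.max 0 x).
have cp : continuous p.
  by move=> x; apply: continuous_min; [exact: cvg_cst|
    apply: continuous_max; [exact: cvg_cst|exact: cvg_id]].
have p0 x : x <= 0 -> p x = 0.
  by move=> x0; rewrite /p (max_idPl x0) (min_idPr ler01).
have p1 x : 1 <= x -> p x = 1.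
  by move=> x0; rewrite /p (max_idPr (le_trans ler01 x0)) (min_idPl x0).
have [||F1 d1] := @antiderivative_pos (fun x => f x * p x).
- by move=> x; apply: cvgM; [exact: cf|exact: cp].
- by move=> x /p0 ->; rewrite mulr0.
have [||F2 d2] := @antiderivative_pos (fun x => f (1 - x) * (1 - p (1 - x))).
- have c1 (k : R -> R) : continuous k -> continuous (fun x => k (1 - x)).
    move=> ck x; apply: (@continuous_comp _ _ _ (fun x : R => 1 - x) k); last exact: ck.
    by apply: cvgB; [exact: cvg_cst|exact: cvg_id].
  move=> x; apply: cvgM; first exact: c1.
  by apply: cvgB; [exact: cvg_cst|exact: (c1 p)].
- by move=> x x0; rewrite p1 ?subrr ?mulr0//; lra.
exists (fun x => F1 x - F2 (1 - x)) => x.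
have d2' : is_derive x 1 (fun x => F2 (1 - x)) (- (f x * (1 - p x))).
  have e : f x * (1 - p x) = f (1 - (1 - x)) * (1 - p (1 - (1 - x))).
    by rewrite subKr.
  have dl : is_derive x 1 (fun x : R => 1 - x) (-1).
    by apply: is_derive_eq; lra.
  have := @is_derive1_comp _ F2 (fun x : R => 1 - x) x _ _ (d2 (1 - x)) dl.
  by rewrite subKr mulrN1.
have := is_deriveB (d1 x) d2'.
by rewrite (_ : f x * p x - - (f x * (1 - p x)) = f x)//; lra.
Qed.

Lemma is_derive_shift f df c x : is_derive (x + c) 1 f (df (x + c)) ->
  is_derive x 1 (fun u => f (u + c)) (df (x + c)).
Proof.
move=> d1; have dl : is_derive x 1 (fun x : R => x + c) 1.
  by apply: is_derive_eq; lra.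
have := @is_derive1_comp _ f (fun x : R => x + c) x _ _ d1 dl.
by rewrite mulr1.
Qed.

(* The test function is replaced by its double moving average. *)
Lemma smooth_approx f M L h : 0 < h -> (forall x, `|f x| <= M) ->
  (forall x y, `|f x - f y| <= L * `|x - y|) -> continuous f ->
  exists C g g1 g2, smooth2 C g g1 g2 /\ forall x, `|g x - f x| <= 2 * L * h.
Proof.
move=> h0 fM fL cf.
have [F dF] := antiderivative cf.
have [G dG] := antiderivative (is_derive_continuous dF).
have M0 : 0 <= M := le_trans (normr_ge0 _) (fM 0).
have L0 : 0 <= L.
  by have := fL 1 0; rewrite subr0 normr1 mulr1; apply: le_trans.
(* The second difference of the second antiderivative [G], divided by h^2, is the average of f(x + p
   + q) over p and q in [0, h]. Its derivatives are the same operator applied to [F] and to [f]. *)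
pose dd (k : R -> R) x := (k (x + (h + h)) - 2 * k (x + h) + k x) / h ^+ 2.
have ddd k dk : (forall x, is_derive x 1 k (dk x)) ->
    forall x, is_derive x 1 (dd k) (dd dk x).
  move=> dk0 x.
  have a1 := is_derive_shift (dk0 (x + (h + h))).
  have a2 := is_derive_shift (dk0 (x + h)).
  by apply: is_derive_eq; rewrite /dd /GRing.scale/=; lra.
have dg := ddd _ _ dG; have dg1 := ddd _ _ dF.
have h20 : 0 < h ^+ 2 by rewrite exprn_gt0.
have g2b x : `|dd f x| <= 4 * M / h ^+ 2.
  rewrite /dd normrM normfV (gtr0_norm h20) ler_wpM2r ?invr_ge0 ?(ltW h20)//.
  have := fM (x + (h + h)); have := fM (x + h); have := fM x.
  rewrite !ler_norml => /andP[? ?] /andP[? ?] /andP[? ?].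
  by apply/andP; split; lra.
have g2l x u : `|dd f (x + u) - dd f x| <= 4 * L / h ^+ 2 * `|u|.
  have -> : dd f (x + u) - dd f x =
    ((f (x + u + (h + h)) - f (x + (h + h))) -
      2 * (f (x + u + h) - f (x + h)) + (f (x + u) - f x)) / h ^+ 2.
    by rewrite /dd; lra.
  rewrite normrM normfV (gtr0_norm h20) mulrAC ler_wpM2r ?invr_ge0 ?(ltW h20)//.
  have := fL (x + u + (h + h)) (x + (h + h)).
  have := fL (x + u + h) (x + h); have := fL (x + u) x.
  have -> : x + u - x = u by lra.
  have -> : x + u + h - (x + h) = u by lra.
  have -> : x + u + (h + h) - (x + (h + h)) = u by lra.
  rewrite !ler_norml => /andP[? ?] /andP[? ?] /andP[? ?].
  by apply/andP; split; lra.
have Fq u : `|F (u + h) - F u| <= M * h.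
  have := @mvt_bound R F f u (u + h) M dF (fun y _ => fM y).
  by rewrite (_ : u + h - u = h) ?(gtr0_norm h0)//; lra.
have g1b x : `|dd F x| <= 2 * M / h.
  rewrite /dd normrM normfV (gtr0_norm h20) ler_pdivrMr// expr2 mulrA divfK ?gt_eqF//.
  have := Fq x; have := Fq (x + h); rewrite -addrA.
  rewrite !ler_norml => /andP[? ?] /andP[? ?].
  by apply/andP; split; lra.
(* On [x, x + 2h] the function [f] stays within [2 * L * h] of [f x]. Mean value inequalities for
   [q] and [Q] carry this to the first difference of [F] and the second difference of [G]. *)
have gf x : `|dd G x - f x| <= 2 * L * h.
  pose Q u := G (u + h) - G u - f x * h * (u - x).
  have dQ (u : R) : is_derive u 1 Q (F (u + h) - F u - f x * h).
    have a1 := is_derive_shift (dG (u + h)).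
    by apply: is_derive_eq; rewrite /GRing.scale/=; lra.
  have := mvt_bound (a := x) (x := x + h) (M := 2 * L * h * h) dQ.
  have -> : Q (x + h) - Q x = (dd G x - f x) * h ^+ 2.
    rewrite /Q /dd mulrBl divfK ?gt_eqF// -(addrA x h h).
    by ring.
  rewrite normrM (gtr0_norm h20) => H.
  rewrite -(ler_pM2r h20) (_ : 2 * L * h * h ^+ 2 = 2 * L * h * h * `|x + h - x|).
    apply: H => u ux.
    pose q v := F v - f x * v.
    have dq (v : R) : is_derive v 1 q (f v - f x).
      by apply: is_derive_eq; rewrite /GRing.scale/=; lra.
    have := mvt_bound (a := u) (x := u + h) (M := 2 * L * h) dq.
    have -> : q (u + h) - q u = F (u + h) - F u - f x * h by rewrite /q; lra.
    have -> : u + h - u = h by lra.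
    rewrite (gtr0_norm h0); apply => v vu; apply: le_trans (fL _ _) _.
    rewrite (mulrC 2) -mulrA ler_wpM2l// mulr_natl mulr2n.
    have -> : v - x = (v - u) + (u - x) by lra.
    apply: le_trans (ler_normD _ _) _; apply: lerD => //.
    by move: ux; rewrite [x + h - x]addrAC subrr add0r (gtr0_norm h0).
  by rewrite [x + h - x]addrAC subrr add0r (gtr0_norm h0) expr2 mulrA.
pose C := (M + 2 * L * h) + 2 * M / h + 8 * M / h ^+ 2 + 4 * L / h ^+ 2.
have [c1 c2 c3 c4] : [/\ 0 <= 2 * L * h, 0 <= 2 * M / h, 0 <= 8 * M / h ^+ 2 &
    0 <= 4 * L / h ^+ 2].
  by split; rewrite ?mulr_ge0 ?invr_ge0 ?(ltW h0) ?(ltW h20).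
exists C, (dd G), (dd F), (dd f); split => //.
have tb (b : R -> R) x y := @taylor2_bound _ _ _ b x y dg dg1.
split.
- exact: continuous_measurable (is_derive_continuous dg).
- exact: continuous_measurable (is_derive_continuous dg1).
- have mf : measurable_fun setT f by exact: continuous_measurable.
  have ms c : measurable_fun setT (fun x => f (x + c)).
    by apply: measurableT_comp => //; exact: measurable_funD.
  apply: measurable_funM => //; apply: measurable_funD => //.
  by apply: measurable_funB => //; exact: measurable_funM.
- move=> x; have := gf x; have := fM x; rewrite /C !ler_norml.
  by move=> /andP[? ?] /andP[? ?]; apply/andP; split; lra.
- by move=> x; apply: le_trans (g1b x) _; rewrite /C; lra.
- by move=> x; apply: le_trans (g2b x) _; rewrite /C; lra.
- move=> x y; apply: le_trans (tb (fun=> 8 * M / h ^+ 2) x y _) _.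
    move=> u _; have := g2b (x + u); have := g2b x; rewrite !ler_norml.
    by move=> /andP[? ?] /andP[? ?]; apply/andP; split; lra.
  by rewrite ler_wpM2r ?sqr_ge0// /C; lra.
- move=> x y; apply: le_trans (tb (fun y => 4 * L / h ^+ 2 * `|y|) x y _) _.
    by move=> u uy; apply: le_trans (g2l x u) _; rewrite ler_wpM2l.
  have -> : y ^+ 2 = `|y| ^+ 2 by rewrite real_normK ?num_real.
  by rewrite -mulrA -exprS ler_wpM2r ?exprn_ge0// /C; lra.
Qed.

End smoothing.

(** * Lindeberg's central limit theorem *)

Lemma dct_real d (T : measurableType d) (R : realType)
    (mu : {measure set T -> \bar R}) (f_ : nat -> T -> R) (f g : T -> R) :
  (forall n, measurable_fun setT (f_ n)) -> measurable_fun setT f ->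
  (forall x, f_ n x @[n --> \oo] --> f x) -> intg mu g ->
  (forall n x, `|f_ n x| <= g x) ->
  (\int[mu]_x f_ n x) @[n --> \oo] --> \int[mu]_x f x.
Proof.
move=> mf_ mf ff ig fg.
have [||||i0 _ h] := @dominated_convergence _ _ _ mu setT measurableT
  (fun n => EFin \o f_ n) (EFin \o f) (EFin \o g) _ _ _ ig _.
- by move=> n; exact/measurable_EFinP.
- exact/measurable_EFinP.
- by apply: aeW => x _; apply/cvg_EFin; [near=> n|exact: ff].
- by apply: aeW => x n _; rewrite /= lee_fin.
apply: fine_cvg; have -> : (\int[mu]_x f x)%:E = (\int[mu]_x (f x)%:E)%E.
  by rewrite RintE.
exact: h.
Unshelve. all: by end_near. Qed.

Section lindeberg_step.
Context (R : realType).
Local Notation N m s := (normal_prob m s : probability (measurableTypeR R) R).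

(** The Taylor expansion is integrated: the linear term vanishes with the mean, and the quadratic
    one sees [Y] only through its variance. Two variables with equal variance are thus
    interchangeable up to the right-hand side. *)
Lemma smooth2_step d (T : measurableType d) (Q : probability T R) (Y : T -> R)
    M (f f1 f2 : R -> R) v x :
  smooth2 M f f1 f2 -> intg Q Y -> intg Q (fun w => Y w ^+ 2) ->
  \int[Q]_w Y w = 0 -> \int[Q]_w (Y w ^+ 2) = v ->
  `|\int[Q]_w f (x + Y w) - f x - f2 x * (v / 2)| <=
    M * \int[Q]_w Num.min (Y w ^+ 2) (`|Y w| ^+ 3).
Proof.
move=> [m0 m1 m2 b0 b1 b2 t2 t3] iY iY2 EY EY2.
have mY := intg_measurable iY.
have ifY : intg Q (fun w => f (x + Y w)).
  apply: (@intg_bounded _ _ _ Q _ M) => //.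
  by apply: measurableT_comp => //; exact: measurable_funD.
have imin : intg Q (fun w => Num.min (Y w ^+ 2) (`|Y w| ^+ 3)).
  apply: intg_dom iY2 _ => [|w].
    apply: measurable_minr; apply: measurable_funX => //.
    exact: measurableT_comp.
  by rewrite ger0_norm ?ge_min ?lexx// le_min sqr_ge0 exprn_ge0.
have i1 : intg Q (fun w => f1 x * Y w) by exact: intgZ.
have i2 : intg Q (fun w => f2 x * (Y w ^+ 2 / 2)).
  apply: intgZ; apply: eq_intg (intgZ 2^-1 iY2) => w; exact: mulrC.
have -> : \int[Q]_w f (x + Y w) - f x - f2 x * (v / 2) =
    \int[Q]_w (f (x + Y w) - f x - f1 x * Y w - f2 x * (Y w ^+ 2 / 2)).
  have ic : intg Q (fun w => f (x + Y w) - f x) by apply: intgB => //; exact: intg_cst.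
  rewrite RintB//; last exact: intgB.
  rewrite RintB// RintB//; last exact: intg_cst.
  rewrite Rint_cst RintZ// EY mulr0 subr0; congr (_ - _).
  under eq_Rintegral do rewrite mulrA mulrAC.
  by rewrite RintZ// EY2 mulrAC mulrA.
rewrite -RintZ//; apply: Rint_norm_le.
- by apply: intgB => //; apply: intgB => //; apply: intgB => //; exact: intg_cst.
- exact: intgZ.
- move=> w; have M0 : 0 <= M := le_trans (normr_ge0 _) (b0 0).
  by rewrite minr_pMr// le_min t2 t3.
Qed.

(** The bounds at [x + u] are integrated over [u]; the constant [M] survives because the normal law
    has mass 1. This uniformity in [s] is what allows the replacement to be iterated. *)
Lemma gconv_smooth2 s M (f f1 f2 : R -> R) : smooth2 M f f1 f2 ->
  smooth2 M (gconv s f) (gconv s f1) (gconv s f2).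
Proof.
move=> [m0 m1 m2 b0 b1 b2 t2 t3]; split; try exact: measurable_gconv;
  try (by move=> x; exact: gconv_bounded).
all: move=> x y; rewrite /gconv; have [//|s0] := eqVneq s 0.
all: have i (k : R -> R) z : measurable_fun setT k -> (forall y, `|k y| <= M) ->
  intg (N 0 s) (fun u => k (z + u)) by move=> mk bk; exact: intg_shift_bounded bk.
all: have -> : \int[N 0 s]_u f (x + y + u) - \int[N 0 s]_u f (x + u) -
    (\int[N 0 s]_u f1 (x + u)) * y - (\int[N 0 s]_u f2 (x + u)) * (y ^+ 2 / 2) =
  \int[N 0 s]_u (f (x + u + y) - f (x + u) - y * f1 (x + u) -
     (y ^+ 2 / 2) * f2 (x + u)).
1,3: have -> : (fun u : measurableTypeR R => f (x + u + y) - f (x + u) - y * f1 (x + u) -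
     (y ^+ 2 / 2) * f2 (x + u)) = (fun u => f (x + y + u) - f (x + u) - y * f1 (x + u) -
     (y ^+ 2 / 2) * f2 (x + u)) by apply/funext => u; rewrite (addrAC x).
1,2: rewrite RintB ?RintB ?RintZ ?(mulrC y) ?(mulrC (y ^+ 2 / 2))//; 
  do ?[apply: intgB|apply: intgZ|exact: i].
all: rewrite -[leRHS](Rint_cst (N 0 s)); apply: Rint_norm_le.
2,5: exact: intg_cst.
1,3: apply: intgB; [apply: intgB; [apply: intgB|]|]; do ?[apply: intgZ]; try exact: i.
1,2: under eq_fun do rewrite (addrAC x); exact: i.
all: by move=> u; rewrite (mulrC y) (mulrC (y ^+ 2 / 2)).
Qed.

(** A bound for the third absolute moment of a standard normal variable: |y|^3 is at most (s/2) y^2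
    + y^4 / (2s), by expanding the square |y|^2 (|y| - s)^2, and the two moments are s^2 and at most
    48 exp(1/2) s^4. *)
Definition gauss_third : R := (1 + 48 * expR 2^-1) / 2.

Lemma gconv_step s M (f f1 f2 : R -> R) x : 0 <= s -> smooth2 M f f1 f2 ->
  `|gconv s f x - f x - f2 x * (s ^+ 2 / 2)| <= M * (gauss_third * s ^+ 3).
Proof.
move=> sp sf; have M0 : 0 <= M := le_trans (normr_ge0 _) (smooth2_b0 sf 0).
rewrite /gconv; have [->|s0] := eqVneq s 0.
  by rewrite expr0n/= mul0r mulr0 subr0 subrr normr0 expr0n/= mulr0 mulr0.
apply: le_trans (smooth2_step x sf (normal_intg_id s0) (normal_intg_pow2 s0)
  (normal_mean s0) (normal_var s0)) _.
have i4 := normal_intg_pow4 s0; have i2 := normal_intg_pow2 s0.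
rewrite ler_wpM2l//.
have ib : intg (N 0 s) (fun y => s / 2 * y ^+ 2 + (2 * s)^-1 * y ^+ 4).
  by apply: intgD; exact: intgZ.
apply: (@le_trans _ _ (\int[N 0 s]_y (s / 2 * y ^+ 2 + (2 * s)^-1 * y ^+ 4))).
  have bnd (y : R) : Num.min (y ^+ 2) (`|y| ^+ 3) <= s / 2 * y ^+ 2 + (2 * s)^-1 * y ^+ 4.
    rewrite ge_min; apply/orP; right.
    have -> : y ^+ 2 = `|y| ^+ 2 by rewrite real_normK ?num_real.
    have -> : y ^+ 4 = `|y| ^+ 4 by rewrite -normrX ger0_norm// exprn_even_ge0.
    have : 0 <= (2 * s)^-1 * (`|y| ^+ 2 * (`|y| - s) ^+ 2).
      by apply: mulr_ge0; [rewrite invr_ge0 mulr_ge0|rewrite mulr_ge0 ?sqr_ge0].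
    have -> : (2 * s)^-1 * (`|y| ^+ 2 * (`|y| - s) ^+ 2) =
      s / 2 * `|y| ^+ 2 + (2 * s)^-1 * `|y| ^+ 4 - `|y| ^+ 3 by field.
    by rewrite subr_ge0.
  apply: Rint_le => //; apply: intg_dom ib _ => [|y].
    by apply: measurable_minr; apply: measurable_funX.
  by rewrite ger0_norm// le_min sqr_ge0 exprn_ge0.
rewrite RintD; [|exact: intgZ..].
rewrite !RintZ// normal_var//.
apply: (@le_trans _ _ (s / 2 * s ^+ 2 + (2 * s)^-1 * (48 * expR (2^-1) * s ^+ 4))).
  rewrite lerD2l ler_wpM2l ?normal_pow4_bound//.
  by rewrite invr_ge0 mulr_ge0.
rewrite le_eqVlt; apply/orP; left; apply/eqP; rewrite /gauss_third; field.
exact: s0.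
Qed.

End lindeberg_step.

(** * The central limit theorem for smooth test functions *)

Section clt.
Context dT (T : measurableType dT) (R : realType) (P : probability T R).
Context dE (E : measurableType dE) (X : nat -> {RV P >-> E}).
Hypothesis X_iid : iid X.
Variable u : E -> R.
Hypothesis mu : measurable_fun setT u.
Hypothesis iu2 : intg P (fun w => u (X 0%N w) ^+ 2).
Hypothesis Eu : \int[P]_w u (X 0%N w) = 0.

Let sigma := Num.sqrt (\int[P]_w (u (X 0%N w) ^+ 2)).
Let S n w := \sum_(1 <= j < n.+1) u (X j w).

Let muX j : measurable_fun setT (fun w => u (X j w)).
Proof. exact: measurableT_comp. Qed.

Let mS n : measurable_fun setT (S n).
Proof.
rewrite /S; elim: n => [|n ih].
  by under eq_fun do rewrite big_geq//; exact: measurable_cst.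
under eq_fun do rewrite big_nat_recr//=.
exact: measurable_funD.
Qed.

Let iu : intg P (fun w => u (X 0%N w)).
Proof.
apply: intg_dom (intgD (intg_cst P 1) iu2) _ => // w.
by rewrite ler_norml; apply/andP; split; nra.
Qed.

(* Lindeberg's replacement of one summand. *)
Let swap M f f1 f2 (c : R) k : 0 <= c -> smooth2 M f f1 f2 ->
  `|\int[P]_w f (c * S k.+1 w) - \int[P]_w gconv (sigma * c) f (c * S k w)| <=
  M * (\int[P]_w Num.min ((c * u (X 0%N w)) ^+ 2) (`|c * u (X 0%N w)| ^+ 3) +
       gauss_third R * (sigma * c) ^+ 3).
Proof.
move=> c0 sf; have [m0 _ _ b0 _ _ _ _] := sf.
have mk : measurable_fun setT (fun z : R * R => f (c * z.1 + z.2)).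
  apply: measurableT_comp => //; apply: measurable_funD => //.
  exact: measurable_funM.
have mcu : measurable_fun setT (fun x => c * u x) by exact: measurable_funM.
have mcuX : measurable_fun setT (fun w => c * u (X k.+1 w)) by exact: measurable_funM.
have ind := past_indep X_iid mu mcu (mS k) mcuX.
have kM (x y : R) : `|f (c * (x, y).1 + (x, y).2)| <= M * 1 by rewrite mulr1.
have [_ fub] := @indep_fubini _ _ _ P _ _ _ _ _ _ (fun z : R * R => f (c * z.1 + z.2))
   (fun=> M) (fun=> 1) ind mk (@measurable_cst _ _ _ _ _ M)
   (@measurable_cst _ _ _ _ _ (1 : R)) kM
   (intg_cst P M) (intg_cst P 1).
(* Independence of term [k.+1] from the past makes this an iterated integral, in which the inner
   variable may be taken to be [X 0]. *)
have -> : \int[P]_w f (c * S k.+1 w) =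
    \int[P]_w \int[P]_v f (c * S k w + c * u (X 0%N v)).
  transitivity (\int[P]_w f (c * S k w + c * u (X k.+1 w))).
    by apply: eq_Rint => w; rewrite /S big_nat_recr//= mulrDr.
  rewrite [LHS]fub; apply: eq_Rint => w /=.
  have mfc : measurable_fun setT (fun x => f (c * S k w + c * u x)).
    apply: measurableT_comp => //; exact: measurable_funD.
  apply: (iid_Rint X_iid _ mfc); apply: (@intg_bounded _ _ _ P _ M) => //.
  exact: (measurableT_comp mfc).
set v := c ^+ 2 * \int[P]_w (u (X 0%N w) ^+ 2).
have v_sc : v = (sigma * c) ^+ 2.
  by rewrite exprMn /sigma sqr_sqrtr ?Rint_ge0 1?mulrC// => w; exact: sqr_ge0.
have icu : intg P (fun w => c * u (X 0%N w)) by exact: intgZ.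
have icu2 : intg P (fun w => (c * u (X 0%N w)) ^+ 2).
  by apply: eq_intg (intgZ (c ^+ 2) iu2) => w; rewrite exprMn.
have Ecu : \int[P]_w (c * u (X 0%N w)) = 0 by rewrite RintZ// Eu mulr0.
have Ecu2 : \int[P]_w ((c * u (X 0%N w)) ^+ 2) = v.
  by rewrite /v -RintZ//; apply: eq_Rint => w; rewrite exprMn.
have mg : measurable_fun setT (gconv (sigma * c) f) by exact: measurable_gconv b0.
have mcS : measurable_fun setT (fun w => c * S k w) by exact: measurable_funM.
have ig : intg P (fun w => gconv (sigma * c) f (c * S k w)).
  apply: (@intg_bounded _ _ _ P _ M); first exact: measurableT_comp.
  by move=> w; exact: gconv_bounded.
have mcX : measurable_fun setT (fun w => c * u (X 0%N w)) by exact: measurable_funM.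
have mfx (x : R) : measurable_fun setT (fun w => f (x + c * u (X 0%N w))).
  by apply: (measurableT_comp m0); exact: measurable_funD.
have mF : measurable_fun setT (fun x : R => \int[P]_v f (x + c * u (X 0%N v))).
  have -> : (fun x : R => \int[P]_v f (x + c * u (X 0%N v))) =
      (fun x => \int[P]_v (f (x + c * u (X 0%N v)) + M) - M).
    apply/funext => x; rewrite RintD ?Rint_cst ?addrK//.
      exact: (@intg_bounded _ _ _ P _ M).
    exact: intg_cst.
  apply: measurable_funB => //.
  apply: (@measurable_Rint2 _ _ (measurableTypeR R) T R P (fun z : measurableTypeR R * T => f (z.1 + c * u (X 0%N z.2)) + M)).
    apply: measurable_funD => //; apply: measurableT_comp => //.
    apply: measurable_funD => //; apply: measurable_funM => //.
    exact: (measurableT_comp (muX 0)).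
  by move=> z; have := b0 (z.1 + c * u (X 0%N z.2)); rewrite ler_norml => /andP[]; lra.
have iF : intg P (fun w => \int[P]_v f (c * S k w + c * u (X 0%N v))).
  apply: (@intg_bounded _ _ _ P _ M); first exact: (measurableT_comp mF).
  move=> w; rewrite -[leRHS](Rint_cst P); apply: Rint_norm_le => //.
    exact: (@intg_bounded _ _ _ P _ M).
  exact: intg_cst.
rewrite -RintB// -[leRHS](Rint_cst P); apply: Rint_norm_le.
- exact: intgB.
- exact: intg_cst.
- move=> w; have sc0 : 0 <= sigma * c by rewrite mulr_ge0 ?sqrtr_ge0.
  (* Both expansions at [c * S k w] contain the same value and the same second-order term, which
     cancel. *)
  have A := smooth2_step (c * S k w) sf icu icu2 Ecu Ecu2.
  have B := gconv_step (c * S k w) sc0 sf.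
  move: A B; rewrite -v_sc mulrDr !ler_norml => /andP[? ?] /andP[? ?].
  by apply/andP; split; lra.
Qed.

(** The last [k] summands are replaced one at a time. By the semigroup property the accumulated
    Gaussian has variance k (sigma c)^2, and each swap is applied to an already convolved function,
    whose constant is still [M]. *)
Let telescope M f f1 f2 (c : R) n k : 0 <= c -> smooth2 M f f1 f2 -> (k <= n)%N ->
  `|\int[P]_w f (c * S n w) -
    \int[P]_w gconv (sigma * c * Num.sqrt k%:R) f (c * S (n - k) w)| <=
  k%:R * (M *
  (\int[P]_w Num.min ((c * u (X 0%N w)) ^+ 2) (`|c * u (X 0%N w)| ^+ 3) +
       gauss_third R * (sigma * c) ^+ 3)).
Proof.
move=> c0 sf; have s0 : 0 <= sigma by exact: sqrtr_ge0.
have sc0 : 0 <= sigma * c by rewrite mulr_ge0.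
elim: k => [_|k ih kn].
  by rewrite subn0 sqrtr0 mulr0 /gconv eqxx subrr normr0 mul0r.
set b := M * _ in ih *; set t := sigma * c * Num.sqrt k%:R in ih *.
set t' := sigma * c * Num.sqrt k.+1%:R.
have tS : Num.sqrt ((sigma * c) ^+ 2 + t ^+ 2) = t'.
  have -> : (sigma * c) ^+ 2 + t ^+ 2 = (sigma * c) ^+ 2 * k.+1%:R.
    by rewrite /t [(sigma * c * _) ^+ 2]exprMn sqr_sqrtr// -natr1; ring.
  by rewrite sqrtrM ?sqr_ge0// sqrtr_sqr ger0_norm.
have t0 : 0 <= t by rewrite mulr_ge0 ?sqrtr_ge0.
have p2 := swap (n - k.+1) c0 (gconv_smooth2 t sf).
clearbody t t'; have p1 := ih (ltnW kn).
have e : \int[P]_w gconv (sigma * c) (gconv t f) (c * S (n - k.+1) w) =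
    \int[P]_w gconv t' f (c * S (n - k.+1) w).
  apply: eq_Rint => w.
  by rewrite (gconvD _ (smooth2_m0 sf) (smooth2_b0 sf)) ?tS.
have p3 : `|\int[P]_w gconv t f (c * S (n - k) w) -
    \int[P]_w gconv t' f (c * S (n - k.+1) w)| <= b.
  have tr (p q r b' : R) : `|p - q| <= b' -> q = r -> `|p - r| <= b' by move=> + <-.
  by rewrite -(subnSK kn); exact: tr p2 e.
rewrite -natr1 mulrDl mul1r.
exact: le_trans (ler_distD _ _ _) (lerD p1 p3).
Qed.

(** All [n] summands are replaced, with c = n^(-1/2). Since n c^2 = 1, the total error is the mean
    of min(u^2, c |u|^3) plus a multiple of c; the former tends to 0 by dominated convergence under
    u^2. *)
Lemma clt_smooth M f f1 f2 : smooth2 M f f1 f2 ->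
  (\int[P]_w f ((Num.sqrt n%:R)^-1 * S n w)) @[n --> \oo] --> gconv sigma f 0.
Proof.
move=> sf; pose c n : R := (Num.sqrt n%:R)^-1.
have c_ge0 n : 0 <= c n by rewrite invr_ge0 sqrtr_ge0.
have c2 n : (0 < n)%N -> c n ^+ 2 = n%:R^-1.
  by move=> n0; rewrite exprVn sqr_sqrtr.
pose a n := \int[P]_w Num.min ((c n * u (X 0%N w)) ^+ 2) (`|c n * u (X 0%N w)| ^+ 3) +
       gauss_third R * (sigma * c n) ^+ 3.
have bound n : (0 < n)%N -> `|\int[P]_w f (c n * S n w) - gconv sigma f 0| <= M * (n%:R * a n).
  move=> n0; have := telescope (c_ge0 n) sf (leqnn n); rewrite subnn -/(a n).
  have -> : sigma * c n * Num.sqrt n%:R = sigma.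
    by rewrite -mulrA mulVf ?mulr1// gt_eqF// sqrtr_gt0 ltr0n.
  rewrite mulrCA; under [X in _ - X]eq_Rintegral do rewrite /S big_geq// mulr0.
  by rewrite Rint_cst.
have c0 : c n @[n --> \oo] --> (0 : R).
  apply/cvgrPdist_le => e e0; near=> n.
  rewrite sub0r normrN ger0_norm// /c.
  have n0 : (0 < n)%N by near: n; exact: nbhs_infty_gt.
  rewrite invf_ple ?posrE ?sqrtr_gt0 ?ltr0n//.
  rewrite -(ger0_norm (ltW (_ : 0 < e^-1))) ?invr_gt0// -sqrtr_sqr ler_wsqrtr//.
  by near: n; exact: nbhs_infty_ger.
have na n : (0 < n)%N -> n%:R * a n =
    \int[P]_w Num.min (u (X 0%N w) ^+ 2) (c n * `|u (X 0%N w)| ^+ 3) +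
    gauss_third R * sigma ^+ 3 * c n.
  move=> n0; have nc2 : n%:R * c n ^+ 2 = 1.
    by rewrite c2// mulfV// pnatr_eq0 -lt0n.
  rewrite /a mulrDr; congr (_ + _).
    rewrite -RintZ; last first.
      have i2 : intg P (fun w => (c n * u (X 0%N w)) ^+ 2).
        by apply: eq_intg (intgZ (c n ^+ 2) iu2) => w; rewrite exprMn.
      apply: intg_dom i2 _ => [|w].
        apply: measurable_minr; apply: measurable_funX => //; last first.
          by apply: measurableT_comp => //; exact: measurable_funM.
        exact: measurable_funM.
      by rewrite ger0_norm ?ge_min ?lexx// le_min sqr_ge0 exprn_ge0.
    apply: eq_Rint => w; rewrite minr_pMr// normrM (ger0_norm (c_ge0 n)) !exprMn.
    move: (c n) nc2 (u (X 0%N w)) => y ny v; rewrite mulrA ny mul1r; congr Num.min.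
    rewrite (_ : n%:R * _ = n%:R * y ^+ 2 * (y * `|v| ^+ 3)).
      by rewrite ny mul1r.
    by ring.
  rewrite exprMn; move: (c n) nc2 => y ny.
  rewrite (_ : n%:R * _ = n%:R * y ^+ 2 * (gauss_third R * sigma ^+ 3 * y)).
    by rewrite ny mul1r.
  by ring.
have lim0 : (n%:R * a n) @[n --> \oo] --> (0 : R).
  suff : (\int[P]_w Num.min (u (X 0%N w) ^+ 2) (c n * `|u (X 0%N w)| ^+ 3) +
    gauss_third R * sigma ^+ 3 * c n) @[n --> \oo] --> (0 + 0 : R).
    rewrite addr0; apply: cvg_trans.
    by apply: near_eq_cvg; near=> n; rewrite na//; near: n; exact: nbhs_infty_gt.
  apply: cvgD; last first.
    by rewrite -(mulr0 (gauss_third R * sigma ^+ 3)); apply: cvgMr.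
  rewrite -(Rint0 P); apply: (dct_real _ _ _ iu2) => //.
  - move=> n; apply: measurable_minr; first exact: measurable_funX.
    by apply: measurable_funM => //; apply: measurable_funX; exact: measurableT_comp.
  - move=> w; apply: (@squeeze_cvgr _ _ _ _ (fun=> 0) (fun n => c n * `|u (X 0%N w)| ^+ 3)).
    + near=> n; rewrite le_min sqr_ge0/= mulr_ge0 ?exprn_ge0//=.
      by rewrite ge_min lexx orbT.
    + exact: cvg_cst.
    + by rewrite -(mul0r (`|u (X 0%N w)| ^+ 3)); apply: cvgMl.
  - move=> n w; rewrite ger0_norm ?ge_min ?lexx//.
    by rewrite le_min sqr_ge0 mulr_ge0 ?exprn_ge0.
apply/cvgrPdist_le => e e0.
have {}lim0 : (M * (n%:R * a n)) @[n --> \oo] --> (0 : R).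
  by rewrite -(mulr0 M); apply: cvgMr.
have small : \forall n \near \oo, M * (n%:R * a n) <= e by exact: cvgr_le lim0 _ e0.
near=> n; rewrite distrC; apply: (le_trans (bound n _)).
  by near: n; exact: nbhs_infty_gt.
by near: n; exact: small.
Unshelve. all: by end_near. Qed.

End clt.

(** * Stochastic orders and convergence in distribution *)

Section stochastic_orders.
Context dT (T : measurableType dT) (R : realType) (P : probability T R).
Implicit Types (Q : nat -> T -> R) (K e : R).

(* Exceptional sets are used instead of events [|Q n| > e], so that no
   measurability of [Q] is needed. *)
Definition often (A : nat -> T -> Prop) := forall e, 0 < e ->
  \forall n \near \oo, exists N, [/\ measurable N, (P N <= e%:E)%E &
    forall w, ~ N w -> A n w].

Definition oP Q := forall e, 0 < e -> often (fun n w => `|Q n w| <= e).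

Definition OP Q := forall e, 0 < e -> exists K, \forall n \near \oo,
  exists N, [/\ measurable N, (P N <= e%:E)%E & forall w, ~ N w -> `|Q n w| <= K].

Lemma setU_small (N1 N2 : set T) e : measurable N1 -> measurable N2 ->
  (P N1 <= (e / 2)%:E)%E -> (P N2 <= (e / 2)%:E)%E ->
  measurable (N1 `|` N2) /\ (P (N1 `|` N2) <= e%:E)%E.
Proof.
move=> m1 m2 p1 p2; split; first exact: measurableU.
by rewrite (le_trans (measureU2 _ m1 m2))// [e]splitr EFinD leeD.
Qed.

Lemma often_always (A : nat -> T -> Prop) :
  (\forall n \near \oo, forall w, A n w) -> often A.
Proof.
move=> h e e0; apply: filterS h => n h; exists set0; split => //.
by rewrite measure0 lee_fin ltW.
Qed.

Lemma often_and (A B : nat -> T -> Prop) : often A -> often B ->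
  often (fun n w => A n w /\ B n w).
Proof.
move=> hA hB e e0; have e20 : 0 < e / 2 by rewrite divr_gt0.
have := hA _ e20; have := hB _ e20; apply: filter_app2; near=> n.
move=> [N1 [m1 p1 h1]] [N2 [m2 p2 h2]]; exists (N1 `|` N2).
have [? ?] := setU_small m1 m2 p1 p2; split => // w /not_orP[n1 n2].
by split; [exact: h2|exact: h1].
Unshelve. all: by end_near. Qed.

Lemma often_impl (A B : nat -> T -> Prop) :
  (\forall n \near \oo, forall w, A n w -> B n w) -> often A -> often B.
Proof.
move=> h hA e e0; have := hA _ e0; move: h; apply: filter_app2; near=> n.
by move=> h [N [mN pN hN]]; exists N; split => // w /hN /h.
Unshelve. all: by end_near. Qed.

Lemma oP_le Q Q' : often (fun n w => `|Q n w| <= Q' n w) -> oP Q' -> oP Q.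
Proof.
move=> h hQ e e0; apply: often_impl (often_and h (hQ _ e0)).
near=> n; move=> w [h1 h2]; apply: le_trans h1 _; exact: le_trans (ler_norm _) h2.
Unshelve. all: by end_near. Qed.

Lemma oP_near Q Q' : (\forall n \near \oo, forall w, Q n w = Q' n w) ->
  oP Q -> oP Q'.
Proof.
by move=> h hQ e e0; apply: often_impl (hQ _ e0); apply: filterS h => n h w; rewrite h.
Qed.

Lemma OP_near Q Q' : (\forall n \near \oo, forall w, Q n w = Q' n w) ->
  OP Q -> OP Q'.
Proof.
move=> h hQ e e0; have [K hK] := hQ _ e0; exists K; move: h hK.
apply: filter_app2; near=> n => h [N [mN pN hN]].
by exists N; split => // w /hN; rewrite h.
Unshelve. all: by end_near. Qed.

Lemma OP_le Q Q' : often (fun n w => `|Q n w| <= Q' n w) -> OP Q' -> OP Q.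
Proof.
move=> h hQ e e0; have e20 : 0 < e / 2 by rewrite divr_gt0.
have [K hK] := hQ _ e20; exists K; have := h _ e20; move: hK.
apply: filter_app2; near=> n => -[N1 [m1 p1 h1]] [N2 [m2 p2 h2]].
exists (N1 `|` N2); have [? ?] := setU_small m1 m2 p1 p2; split => //.
move=> w /not_orP[n1 n2]; apply: le_trans (h2 _ n2) _.
exact: le_trans (ler_norm _) (h1 _ n1).
Unshelve. all: by end_near. Qed.

Lemma eq_oP Q Q' : (forall n w, Q n w = Q' n w) -> oP Q -> oP Q'.
Proof. by move=> h; apply: oP_near; near=> n. Unshelve. all: by end_near. Qed.

Lemma eq_OP Q Q' : (forall n w, Q n w = Q' n w) -> OP Q -> OP Q'.
Proof. by move=> h; apply: OP_near; near=> n. Unshelve. all: by end_near. Qed.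

Lemma oP_OP Q : oP Q -> OP Q.
Proof. by move=> h e e0; exists 1; exact: h. Qed.

Lemma oPD Q Q' : oP Q -> oP Q' -> oP (fun n w => Q n w + Q' n w).
Proof.
move=> h h' e e0; have e20 : 0 < e / 2 by rewrite divr_gt0.
apply: often_impl (often_and (h _ e20) (h' _ e20)); near=> n => w [h1 h2].
by rewrite (le_trans (ler_normD _ _))// [e]splitr lerD.
Unshelve. all: by end_near. Qed.

Lemma OPD Q Q' : OP Q -> OP Q' -> OP (fun n w => Q n w + Q' n w).
Proof.
move=> h h' e e0; have e20 : 0 < e / 2 by rewrite divr_gt0.
have [K hK] := h _ e20; have [K' hK'] := h' _ e20; exists (K + K').
move: hK hK'; apply: filter_app2; near=> n => -[N1 [m1 p1 h1]] [N2 [m2 p2 h2]].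
exists (N1 `|` N2); have [? ?] := setU_small m1 m2 p1 p2; split => //.
move=> w /not_orP[n1 n2].
by rewrite (le_trans (ler_normD _ _))// lerD; [|exact: h1|exact: h2].
Unshelve. all: by end_near. Qed.

Lemma OPM Q Q' : OP Q -> OP Q' -> OP (fun n w => Q n w * Q' n w).
Proof.
move=> h h' e e0; have e20 : 0 < e / 2 by rewrite divr_gt0.
have [K hK] := h _ e20; have [K' hK'] := h' _ e20; exists (K * K').
move: hK hK'; apply: filter_app2; near=> n => -[N1 [m1 p1 h1]] [N2 [m2 p2 h2]].
exists (N1 `|` N2); have [? ?] := setU_small m1 m2 p1 p2; split => //.
move=> w /not_orP[n1 n2].
by rewrite normrM ler_pM; [|exact: normr_ge0|exact: normr_ge0|exact: h1|exact: h2].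
Unshelve. all: by end_near. Qed.

Lemma oPMO Q Q' : oP Q -> OP Q' -> oP (fun n w => Q n w * Q' n w).
Proof.
move=> h h' e e0 r r0; have r20 : 0 < r / 2 by rewrite divr_gt0.
have [K hK] := h' _ r20.
have eK : 0 < e / (`|K| + 1) by rewrite divr_gt0// ltr_wpDl.
have := h _ eK _ r20; move: hK.
apply: filter_app2; near=> n => -[N1 [m1 p1 h1]] [N2 [m2 p2 h2]].
exists (N1 `|` N2); have [? ?] := setU_small m1 m2 p1 p2; split => //.
move=> w /not_orP[n1 n2]; rewrite normrM.
apply: (@le_trans _ _ (e / (`|K| + 1) * (`|K| + 1))).
  rewrite ler_pM//; first exact: h2.
  by rewrite (le_trans (h1 _ n1))// (le_trans (ler_norm _))// lerDl.
by rewrite divfK// gt_eqF// ltr_wpDl.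
Unshelve. all: by end_near. Qed.

Lemma OP_cst (c : R) : OP (fun _ _ => c).
Proof.
by move=> e e0; exists `|c|; near=> n; exists set0; split => //;
  rewrite measure0 lee_fin ltW.
Unshelve. all: by end_near. Qed.

Lemma oPZ (c : R) Q : oP Q -> oP (fun n w => c * Q n w).
Proof.
move=> h; apply: (eq_oP _ (oPMO h (OP_cst c))) => n w; exact: mulrC.
Qed.

Lemma oP0 : oP (fun _ _ => 0).
Proof.
by move=> e e0; apply: often_always; near=> n => w; rewrite normr0 ltW.
Unshelve. all: by end_near. Qed.

Lemma oP_sum (I : Type) (s : seq I) (Q : I -> nat -> T -> R) :
  (forall i, oP (Q i)) -> oP (fun n w => \sum_(i <- s) Q i n w).
Proof.
move=> h; elim: s => [|i s ih].
  by apply: (eq_oP _ oP0) => n w; rewrite big_nil.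
by apply: (eq_oP _ (oPD (h i) ih)) => n w; rewrite big_cons.
Qed.

Lemma OP_sum (I : Type) (s : seq I) (Q : I -> nat -> T -> R) :
  (forall i, OP (Q i)) -> OP (fun n w => \sum_(i <- s) Q i n w).
Proof.
move=> h; elim: s => [|i s ih].
  by apply: (eq_OP _ (OP_cst 0)) => n w; rewrite big_nil.
by apply: (eq_OP _ (OPD (h i) ih)) => n w; rewrite big_cons.
Qed.

Lemma oP_cvg0 (c : nat -> R) : c n @[n --> \oo] --> (0 : R) -> oP (fun n _ => c n).
Proof.
move=> c0 e e0; apply: often_always.
have : \forall n \near \oo, `|0 - c n| <= e.
  by move/cvgrPdist_le : c0; exact.
by apply: filterS => n h w; rewrite -normrN -[- _]add0r.
Qed.

Lemma OP_mean Q K : (\forall n \near \oo, intg P (fun w => `|Q n w|)) ->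
  (\forall n \near \oo, \int[P]_w `|Q n w| <= K) -> OP Q.
Proof.
(* Markov's inequality at this threshold leaves probability at most [e]; the added 1 keeps the
   threshold positive. *)
move=> iQ QK e e0; exists ((`|K| + 1) / e); near=> n.
have r0 : 0 < (`|K| + 1) / e by rewrite divr_gt0// ltr_wpDl.
have iQn : intg P (fun w => `|Q n w|) by near: n.
have [N [mN pN hN]] := markov_set r0 iQn (fun w => normr_ge0 _).
exists N; split => //; last by move=> w /hN /ltW.
apply: (le_trans pN); rewrite lee_fin ler_pdivrMl// divfK ?gt_eqF//.
apply: (@le_trans _ _ K); first by near: n.
by rewrite (le_trans (ler_norm _))// lerDl.
Unshelve. all: by end_near. Qed.

Lemma oP_mean Q (c : nat -> R) :
  (\forall n \near \oo, intg P (fun w => `|Q n w|)) ->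
  (\forall n \near \oo, \int[P]_w `|Q n w| <= c n) ->
  c n @[n --> \oo] --> (0 : R) -> oP Q.
Proof.
move=> iQ Qc c0 e e0 r r0; near=> n.
have iQn : intg P (fun w => `|Q n w|) by near: n.
have [N [mN pN hN]] := markov_set e0 iQn (fun w => normr_ge0 _).
exists N; split => //; last by move=> w /hN /ltW.
apply: (le_trans pN); rewrite lee_fin ler_pdivrMl//.
apply: (@le_trans _ _ (c n)); first by near: n.
near: n; apply: cvgr_le c0 _ _; exact: mulr_gt0.
Unshelve. all: by end_near. Qed.

Lemma cvg_invsqrt : (Num.sqrt n%:R)^-1 @[n --> \oo] --> (0 : R).
Proof.
apply/cvgrPdist_le => e e0; near=> n.
have n0 : (0 < n)%N by near: n; exact: nbhs_infty_gt.
rewrite sub0r normrN ger0_norm ?invr_ge0 ?sqrtr_ge0//.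
rewrite invf_ple ?posrE ?sqrtr_gt0 ?ltr0n//.
rewrite -(ger0_norm (ltW (_ : 0 < e^-1))) ?invr_gt0// -sqrtr_sqr ler_wsqrtr//.
by near: n; exact: nbhs_infty_ger.
Unshelve. all: by end_near. Qed.

(** A product of two O_P(n^(-1/2)) terms is O_P(1/n), so one factor root n still leaves n^(-1/2).
    Second-order terms are discarded in this way. *)
Lemma oP_sqrtM Q Q' : OP (fun n w => Num.sqrt n%:R * Q n w) ->
  OP (fun n w => Num.sqrt n%:R * Q' n w) ->
  oP (fun n w => Num.sqrt n%:R * (Q n w * Q' n w)).
Proof.
move=> h h'; have := oPMO (oP_cvg0 cvg_invsqrt) (OPM h h').
apply: oP_near; near=> n => w.
have : Num.sqrt n%:R != 0 :> R.
  by rewrite gt_eqF// sqrtr_gt0 ltr0n; near: n; exact: nbhs_infty_gt.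
by move: (Num.sqrt _) => s s0; field.
Unshelve. all: by end_near. Qed.

Lemma oP_invsqrt Q : OP Q -> oP (fun n w => (Num.sqrt n%:R)^-1 * Q n w).
Proof. exact: oPMO (oP_cvg0 cvg_invsqrt). Qed.

End stochastic_orders.

(** * Slutsky's lemma and the reduction to Lipschitz test functions *)

Section convergence_in_law.
Context dT (T : measurableType dT) (R : realType) (P : probability T R).
Implicit Types (f : R -> R) (Z L : nat -> T -> R).

Definition lipschitz_bounded (M K : R) f :=
  (forall x, `|f x| <= M) /\ (forall x y, `|f x - f y| <= K * `|x - y|).

Lemma lipschitz_continuous (M K : R) f : 0 <= K -> lipschitz_bounded M K f -> continuous f.
Proof.
move=> K0 [_ fK] x; apply/cvgrPdist_le => e e0.
have d0 : 0 < e / (K + 1) by rewrite divr_gt0// ltr_wpDl.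
near=> y; apply: le_trans (fK _ _) _.
apply: (@le_trans _ _ ((K + 1) * (e / (K + 1)))); last first.
  by rewrite mulrC divfK// gt_eqF// ltr_wpDl.
by apply: ler_pM => //; rewrite lerDl.
Unshelve. all: by end_near. Qed.

Lemma lipschitz_ge0 (M K : R) f : lipschitz_bounded M K f -> 0 <= K.
Proof. by move=> [_ h]; have := h 1 0; rewrite subr0 normr1 mulr1; apply: le_trans. Qed.

(** On the exceptional set the integrands differ by at most [2 * M], off it by the Lipschitz bound.
    A third of [e] each goes to these two errors and to the convergence of the means along [L]; the
    [+ 1] in the denominators only avoids division by 0. *)
Lemma slutsky_lipschitz Z L (M K : R) f (l : R) :
  (\forall n \near \oo, measurable_fun setT (Z n)) ->
  (forall n, measurable_fun setT (L n)) ->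
  oP P (fun n w => Z n w - L n w) -> lipschitz_bounded M K f ->
  (\int[P]_w f (L n w)) @[n --> \oo] --> l ->
  (\int[P]_w f (Z n w)) @[n --> \oo] --> l.
Proof.
move=> mZ mL ZL fMK fL; have K0 := lipschitz_ge0 fMK.
have mf : measurable_fun setT f by exact: continuous_measurable (lipschitz_continuous K0 fMK).
have [fM fK] := fMK; have M0 : 0 <= M := le_trans (normr_ge0 _) (fM 0).
apply/cvgrPdist_le => e e0.
have e30 : 0 < e / 3 by rewrite divr_gt0.
have eK0 : 0 < e / 3 / (K + 1) by rewrite divr_gt0// ltr_wpDl.
have eM0 : 0 < e / 3 / (2 * M + 1).
  by rewrite divr_gt0// ltr_wpDl// mulr_ge0.
have small := ZL _ eK0 _ eM0.
near=> n; have mZn : measurable_fun setT (Z n) by near: n.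
have [N [mN pN hN]] : exists N, [/\ measurable N, (P N <= (e / 3 / (2 * M + 1))%:E)%E &
    forall w, ~ N w -> `|Z n w - L n w| <= e / 3 / (K + 1)] by near: n.
have iZ : intg P (fun w => f (Z n w)).
  by apply: (@intg_bounded _ _ _ P _ M) => //; exact: measurableT_comp.
have iL : intg P (fun w => f (L n w)).
  by apply: (@intg_bounded _ _ _ P _ M) => //; exact: measurableT_comp.
have iN : intg P (\1_N : T -> R) by exact: integrable_indic.
have d1 : `|\int[P]_w f (L n w) - \int[P]_w f (Z n w)| <= e / 3 + e / 3.
  rewrite -RintB//.
  apply: (@le_trans _ _ (\int[P]_w (e / 3 + 2 * M * \1_N w))).
    apply: Rint_norm_le; first exact: intgB.
      by apply: intgD; [exact: intg_cst|exact: intgZ].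
    move=> w; rewrite indicE; have [wN|wN] := boolP (w \in N).
      rewrite mulr1; have := fM (L n w); have := fM (Z n w).
      by rewrite !ler_norml => /andP[? ?] /andP[? ?]; apply/andP; split; lra.
    rewrite mulr0 addr0; have {}wN : ~ N w by move=> /mem_set; apply/negP.
    rewrite distrC; apply: le_trans (fK _ _) _.
    apply: (@le_trans _ _ ((K + 1) * (e / 3 / (K + 1)))); last first.
      by rewrite mulrC divfK// gt_eqF// ltr_wpDl.
    by apply: ler_pM => //; [rewrite lerDl|exact: hN].
  rewrite RintD; [|exact: intg_cst|exact: intgZ].
  rewrite Rint_cst RintZ// lerD2l.
  have : \int[P]_w \1_N w <= e / 3 / (2 * M + 1).
    by rewrite -lee_fin -RintE// integral_indic// setIT.
  move=> h; apply: (@le_trans _ _ (2 * M * (e / 3 / (2 * M + 1)))).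
    by rewrite ler_wpM2l// mulr_ge0.
  rewrite mulrA ler_pdivrMr; last by rewrite ltr_wpDl// mulr_ge0.
  by rewrite mulrC ler_wpM2l ?(ltW e30)// lerDl.
have d2 : `|l - \int[P]_w f (L n w)| <= e / 3 by near: n; move/cvgrPdist_le : fL; exact.
by apply: le_trans (ler_distD _ _ _) (le_trans (lerD d2 d1) _); lra.
Unshelve. all: by end_near. Qed.

(** The Pasch-Hausdorff envelope, the largest [k]-Lipschitz minorant of a bounded [f]. *)
Definition infconv f (k : R) (x : R) : R := inf [set f y + k * `|x - y| | y in setT].

Lemma infconv_has_inf f (M k x : R) : 0 <= k -> (forall x, `|f x| <= M) ->
  has_inf [set f y + k * `|x - y| | y in setT].
Proof.
move=> k0 fM; split; first by exists (f 0 + k * `|x - 0|); exists 0.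
exists (- M) => _ [y _ <-]; have := fM y; rewrite ler_norml => /andP[h _].
by rewrite (le_trans h)// lerDl mulr_ge0.
Qed.

Lemma infconv_le f (M k x y : R) : 0 <= k -> (forall x, `|f x| <= M) ->
  infconv f k x <= f y + k * `|x - y|.
Proof.
by move=> k0 fM; apply: ge_inf; [exact: (infconv_has_inf x k0 fM).2|exists y].
Qed.

Lemma infconv_ge f (k x c : R) : (forall y, c <= f y + k * `|x - y|) ->
  c <= infconv f k x.
Proof.
move=> h; apply: lb_le_inf; first by exists (f 0 + k * `|x - 0|); exists 0.
by move=> _ [y _ <-].
Qed.

Lemma infconv_lipschitz f (M k : R) : 0 <= k -> (forall x, `|f x| <= M) ->
  lipschitz_bounded M k (infconv f k).
Proof.
move=> k0 fM; split=> [x|x y].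
  rewrite ler_norml; apply/andP; split.
    apply: infconv_ge => y; have := fM y; rewrite ler_norml => /andP[h _].
    by rewrite (le_trans h)// lerDl mulr_ge0.
  apply: le_trans (infconv_le x x k0 fM) _.
  by rewrite subrr normr0 mulr0 addr0 (le_trans (ler_norm _)).
have half a b : infconv f k a - k * `|a - b| <= infconv f k b.
  apply: infconv_ge => z; rewrite lerBlDr.
  apply: le_trans (infconv_le a z k0 fM) _.
  by rewrite -addrA lerD2l -mulrDr ler_wpM2l// [leRHS]addrC ler_distD.
have := half x y; have := half y x; rewrite (distrC y x) ler_norml => h1 h2.
by apply/andP; split; lra.
Qed.

(** Once [k * d] reaches [2 * M], points at distance at least [d] from [x] no longer lower the
    infimum; at closer points continuity controls [f]. *)
Lemma infconv_cvg f (M x : R) : continuous f -> (forall x, `|f x| <= M) ->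
  infconv f k%:R x @[k --> \oo] --> f x.
Proof.
move=> cf fM; apply/cvgrPdist_le => e e0.
have /cvgrPdist_le/(_ _ e0) /nbhs_ballP [d /= d0 hd] := cf x.
near=> k; have k0 : 0 <= k%:R :> R by [].
have le1 := infconv_le x x k0 fM; rewrite subrr normr0 mulr0 addr0 in le1.
rewrite ger0_norm ?subr_ge0// lerBlDr -lerBlDl; apply: infconv_ge => y.
have [xy|xy] := ltP `|x - y| d.
  have := hd y xy; rewrite ler_norml => /andP[_ h].
  by rewrite lerBlDl; have := mulr_ge0 k0 (normr_ge0 (x - y)); lra.
have kd : 2 * M / d <= k%:R by near: k; exact: nbhs_infty_ger.
have : 2 * M <= k%:R * `|x - y|.
  by rewrite ler_pdivrMr// in kd; rewrite (le_trans kd)// ler_wpM2l.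
have := fM y; have := fM x; rewrite !ler_norml => /andP[? ?] /andP[? ?]; lra.
Unshelve. all: by end_near. Qed.

(** Lipschitz envelopes from below give a lower bound for the limit inferior of the means of a
    bounded continuous function; applied to [f] and to [- f] this is convergence. *)
Lemma lipschitz_test Z (mu : probability (measurableTypeR R) R) :
  (\forall n \near \oo, measurable_fun setT (Z n)) ->
  (forall (M K : R) f, lipschitz_bounded M K f ->
    (\int[P]_w f (Z n w)) @[n --> \oo] --> \int[mu]_y f y) ->
  cvg_in_distribution P Z mu.
Proof.
move=> mZ hZ; split => // f cf [M fM].
have mf := continuous_measurable cf.
have iZ n : measurable_fun setT (Z n) -> intg P (fun w => f (Z n w)).
  by move=> mZn; apply: (@intg_bounded _ _ _ P _ M) => //; exact: measurableT_comp.
have lower (g : R -> R) (e : R) : continuous g -> (forall y, `|g y| <= M) -> 0 < e ->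
    \forall n \near \oo, \int[mu]_y g y - e <= \int[P]_w g (Z n w).
  move=> cg gM e0; have e20 : 0 < e / 2 by rewrite divr_gt0.
  have L (k : nat) := infconv_lipschitz (ler0n R k) gM.
  have mL k : measurable_fun setT (infconv g k%:R).
    exact: continuous_measurable (lipschitz_continuous (ler0n R k) (L k)).
  have lim : (\int[mu]_y infconv g k%:R y) @[k --> \oo] --> \int[mu]_y g y.
    apply: (dct_real (g := fun=> M)) => //.
    - exact: continuous_measurable.
    - by move=> x; exact: infconv_cvg gM.
    - exact: intg_cst.
    - by move=> n x; exact: (L n).1.
  have [k hk] : exists k, \int[mu]_y g y - e / 2 <= \int[mu]_y infconv g k%:R y.
    have /cvgrPdist_le/(_ _ e20) [k _ hk] := lim; exists k.
    by have := hk k (leqnn k); rewrite /= ler_norml => /andP[_]; lra.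
  have /cvgrPdist_le/(_ _ e20) := hZ _ _ _ (L k).
  move: mZ; apply: filter_app2; near=> n => mZn hn.
  have le2 : \int[P]_w infconv g k%:R (Z n w) <= \int[P]_w g (Z n w).
    apply: Rint_le.
    - apply: (@intg_bounded _ _ _ P _ M) => [|w]; last exact: (L k).1.
      exact: measurableT_comp.
    - apply: (@intg_bounded _ _ _ P _ M) => //.
      by apply: measurableT_comp => //; exact: continuous_measurable.
    - move=> w; apply: le_trans (infconv_le _ (Z n w) (ler0n R k) gM) _.
      by rewrite subrr normr0 mulr0 addr0.
  by apply: le_trans le2; move: hn; rewrite ler_norml => /andP[_]; lra.
apply/cvgrPdist_le => e e0.
have cNf : continuous (fun y => - f y) by move=> x; apply: cvgN; exact: cf.
have NfM y : `|- f y| <= M by rewrite normrN.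
have := lower _ _ cNf NfM e0; have := lower _ _ cf fM e0; move: mZ.
apply: filter_app3; near=> n => mZn.
have iN (mu' : probability (measurableTypeR R) R) : intg mu' f.
  exact: (@intg_bounded _ _ _ mu' _ M).
under [X in _ -> _ <= X -> _]eq_Rintegral do rewrite -mulN1r.
rewrite RintZ ?iZ//.
under [X in _ -> X - _ <= _ -> _]eq_Rintegral do rewrite -mulN1r.
rewrite RintZ ?iN// => h1 h2.
by rewrite ler_norml; apply/andP; split; lra.
Unshelve. all: by end_near. Qed.

Lemma Rint_normal_law (v : R) f (M : R) : 0 <= v -> measurable_fun setT f ->
  (forall x, `|f x| <= M) ->
  \int[normal_law v]_y f y = gconv (Num.sqrt v) f 0.
Proof.
move=> v0 mf fM; rewrite /normal_law /gconv sqrtr_eq0.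
have [->|vn0] := eqVneq v 0.
  rewrite lexx; rewrite /Rintegral integral_dirac//=.
    by rewrite indicE in_setT mul1r.
  exact/measurable_EFinP.
rewrite le_eqVlt (negbTE vn0) ltNge v0/=.
by apply: eq_Rint => y; rewrite add0r.
Qed.

(** Slutsky's lemma passes to the normalised sum. A uniform smooth approximation of the Lipschitz
    test function moves the mean at stage [n] and the Gaussian limit by at most [e / 3] each. *)
Lemma cvg_in_law_clt dE (E : measurableType dE) (X : nat -> {RV P >-> E})
    (u : E -> R) (Z : nat -> T -> R) :
  iid X -> measurable_fun setT u ->
  intg P (fun w => u (X 0%N w) ^+ 2) -> \int[P]_w u (X 0%N w) = 0 ->
  (\forall n \near \oo, measurable_fun setT (Z n)) ->
  oP P (fun n w => Z n w - (Num.sqrt n%:R)^-1 * \sum_(1 <= j < n.+1) u (X j w)) ->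
  cvg_in_distribution P Z (normal_law (\int[P]_w (u (X 0%N w) ^+ 2))).
Proof.
move=> X_iid mu iu2 Eu mZ ZL; apply: lipschitz_test => // M K f fMK.
have K0 := lipschitz_ge0 fMK; have cf := lipschitz_continuous K0 fMK.
have mf := continuous_measurable cf; have [fM fK] := fMK.
set v := \int[P]_w (u (X 0%N w) ^+ 2).
have v0 : 0 <= v by apply: Rint_ge0 => w; exact: sqr_ge0.
rewrite (Rint_normal_law v0 mf fM).
pose L n w := (Num.sqrt n%:R)^-1 * \sum_(1 <= j < n.+1) u (X j w).
have mL n : measurable_fun setT (L n).
  apply: measurable_funM => //; elim: n => [|n ih].
    by under eq_fun do rewrite big_geq//; exact: measurable_cst.
  under eq_fun do rewrite big_nat_recr//=.
  apply: measurable_funD => //; exact: measurableT_comp.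
apply: (slutsky_lipschitz mZ mL ZL fMK).
apply/cvgrPdist_le => e e0.
(* The smoothing width, chosen so that the approximation error [2 * K * h] is at most [e / 3]. *)
have h0 : 0 < e / 3 / (2 * K + 1) by rewrite !divr_gt0// ltr_wpDl// mulr_ge0.
have [C [g [g1 [g2 [sg gf]]]]] := smooth_approx h0 fM fK cf.
have e30 : 0 < e / 3 by rewrite divr_gt0.
have gf3 x : `|g x - f x| <= e / 3.
  apply: le_trans (gf x) _; rewrite mulrA ler_pdivrMr; last by rewrite ltr_wpDl// mulr_ge0.
  by rewrite mulrC ler_wpM2l ?(ltW e30)// lerDl.
have := clt_smooth X_iid mu iu2 Eu sg => /cvgrPdist_le/(_ _ e30).
apply: filterS => n hn.
have iL (k : R -> R) (B : R) : measurable_fun setT k -> (forall x, `|k x| <= B) ->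
    intg P (fun w => k (L n w)).
  by move=> mk kB; apply: (@intg_bounded _ _ _ P _ B) => //; exact: measurableT_comp.
have d1 : `|\int[P]_w g (L n w) - \int[P]_w f (L n w)| <= e / 3.
  rewrite -RintB; [|exact: iL (smooth2_m0 sg) (smooth2_b0 sg)|exact: iL fM].
  rewrite -[leRHS](Rint_cst P); apply: Rint_norm_le => //.
    by apply: intgB; [exact: iL (smooth2_m0 sg) (smooth2_b0 sg)|exact: iL fM].
  exact: intg_cst.
have d2 : `|gconv (Num.sqrt v) f 0 - gconv (Num.sqrt v) g 0| <= e / 3.
  rewrite distrC /gconv; case: ifP => [_|_]; first exact: gf3.
  have i1 := intg_shift_bounded (Num.sqrt v) 0 (smooth2_m0 sg) (smooth2_b0 sg).
  have i2 := intg_shift_bounded (Num.sqrt v) 0 mf fM.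
  rewrite -RintB//.
  rewrite -[leRHS](Rint_cst (normal_prob 0 (Num.sqrt v) : probability (measurableTypeR R) R)).
  apply: Rint_norm_le => //; first exact: intgB.
  exact: intg_cst.
have := lerD (lerD d2 hn) d1.
move=> h; apply: le_trans (le_trans _ h) _; last by lra.
apply: le_trans (ler_distD (\int[P]_w g (L n w)) _ _) _; rewrite lerD2r.
exact: ler_distD.
Qed.

End convergence_in_law.

(** * Averages of i.i.d. variables *)

Section sample_averages.
Context dT (T : measurableType dT) (R : realType) (P : probability T R).
Context dE (E : measurableType dE) (X : nat -> {RV P >-> E}).
Hypothesis X_iid : iid X.
Implicit Types (u v : E -> R).

Definition avg n u w := n%:R^-1 * \sum_(1 <= j < n.+1) u (X j w).

Lemma measurable_avg n u : measurable_fun setT u -> measurable_fun setT (avg n u).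
Proof.
move=> mu; apply: measurable_funM => //; elim: n => [|n ih].
  by under eq_fun do rewrite big_geq//; exact: measurable_cst.
under eq_fun do rewrite big_nat_recr//=.
by apply: measurable_funD => //; exact: measurableT_comp.
Qed.

Lemma intg_sqr_intg u : measurable_fun setT u ->
  intg P (fun w => u (X 0%N w) ^+ 2) -> intg P (fun w => u (X 0%N w)).
Proof.
move=> mu iu2; apply: intg_dom (intgD (intg_cst P 1) iu2) _ => [|w].
  exact: measurableT_comp.
by rewrite ler_norml; apply/andP; split; nra.
Qed.

Lemma iid_prod i j u v : i != j -> measurable_fun setT u -> measurable_fun setT v ->
  intg P (fun w => u (X 0%N w)) -> intg P (fun w => v (X 0%N w)) ->
  intg P (fun w => u (X i w) * v (X j w)) /\
  \int[P]_w (u (X i w) * v (X j w)) =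
  (\int[P]_w u (X 0%N w)) * \int[P]_w v (X 0%N w).
Proof.
move=> ij mu mv iu iv; have iui := iid_intg X_iid i mu iu.
have ivj := iid_intg X_iid j mv iv.
have mk : measurable_fun setT (fun z : E * E => u z.1 * v z.2).
  by apply: measurable_funM; exact: measurableT_comp.
have mnu : measurable_fun setT (fun x => `|u x|) by exact: measurableT_comp.
have mnv : measurable_fun setT (fun x => `|v x|) by exact: measurableT_comp.
have dom x y : `|u x * v y| <= `|u x| * `|v y| by rewrite normrM.
have [h1 h2] := indep_fubini (iid_pair X_iid ij) mk mnu mnv dom
  (intg_norm iui) (intg_norm ivj).
split=> //; rewrite h2 /=.
transitivity (\int[P]_w (u (X i w) * \int[P]_v0 v (X j v0))).
  by apply: eq_Rint => w; rewrite RintZ.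
under eq_Rintegral do rewrite mulrC.
rewrite RintZ// mulrC !(iid_Rint X_iid)//.
Qed.

Lemma sum_sqr n u : measurable_fun setT u ->
  intg P (fun w => u (X 0%N w) ^+ 2) -> \int[P]_w u (X 0%N w) = 0 ->
  intg P (fun w => (\sum_(1 <= j < n.+1) u (X j w)) ^+ 2) /\
  \int[P]_w ((\sum_(1 <= j < n.+1) u (X j w)) ^+ 2) =
    n%:R * \int[P]_w (u (X 0%N w) ^+ 2).
Proof.
move=> mu iu2 Eu; have iu := intg_sqr_intg mu iu2.
have mu2 : measurable_fun setT (fun x => u x ^+ 2) by exact: measurable_funX.
elim: n => [|n [ih1 ih2]].
  under eq_fun do rewrite big_geq// expr0n/=.
  by rewrite mul0r Rint0; split => //; exact: intg0.
have e w : (\sum_(1 <= j < n.+2) u (X j w)) ^+ 2 =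
  ((\sum_(1 <= j < n.+1) u (X j w)) ^+ 2 +
  2 * \sum_(1 <= j < n.+1) (u (X j w) * u (X n.+1 w))) + u (X n.+1 w) ^+ 2.
  by rewrite big_nat_recr//= sqrrD -mulr_suml mulr_natl -mulr_natl mulr_natl.
have cross j : (1 <= j < n.+1)%N -> intg P (fun w => u (X j w) * u (X n.+1 w)) /\
    \int[P]_w (u (X j w) * u (X n.+1 w)) = 0.
  move=> /andP[_ jn]; have jn' : j != n.+1 by rewrite ltn_eqF.
  by have [h1 h2] := iid_prod jn' mu mu iu iu; split=> //; rewrite h2 Eu mul0r.
have scross : intg P (fun w => \sum_(1 <= j < n.+1) (u (X j w) * u (X n.+1 w))) /\
   \int[P]_w (\sum_(1 <= j < n.+1) (u (X j w) * u (X n.+1 w))) = 0.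
  (* Integrability of a sum is available for families integrable at every index, so the summand is
     extended by 0 outside the range. *)
  pose F j w := if (1 <= j < n.+1)%N then u (X j w) * u (X n.+1 w) else 0.
  have iF j : intg P (F j).
    rewrite /F; have [jn|_] := boolP (1 <= j < n.+1)%N; last exact: intg0.
    exact: (cross j jn).1.
  have eF w : \sum_(1 <= j < n.+1) (u (X j w) * u (X n.+1 w)) =
      \sum_(1 <= j < n.+1) F j w.
    by apply: eq_big_nat => j jn; rewrite /F jn.
  split; first by apply: eq_intg (intg_sum _ iF) => w; rewrite eF.
  under eq_Rintegral do rewrite eF; rewrite Rint_sum// big_nat big1// => j jn.
  by rewrite /F jn; exact: (cross j jn).2.
have in1 := iid_intg X_iid n.+1 mu2 iu2.
have i12 : intg P (fun w => (\sum_(1 <= j < n.+1) u (X j w)) ^+ 2 +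
  2 * \sum_(1 <= j < n.+1) (u (X j w) * u (X n.+1 w))).
  by apply: intgD => //; apply: intgZ; exact: scross.1.
split; first by apply: eq_intg (intgD i12 in1) => w; rewrite e.
under eq_Rintegral do rewrite e.
rewrite RintD// RintD//; last by apply: intgZ; exact: scross.1.
rewrite RintZ ?scross.2 ?mulr0 ?addr0 ?ih2; last exact: scross.1.
by rewrite (iid_Rint X_iid n.+1 mu2 iu2) -natr1 mulrDl mul1r.
Qed.

Lemma avg_sqr n u : (0 < n)%N -> measurable_fun setT u ->
  intg P (fun w => u (X 0%N w) ^+ 2) -> \int[P]_w u (X 0%N w) = 0 ->
  intg P (fun w => avg n u w ^+ 2) /\
  \int[P]_w (avg n u w ^+ 2) = n%:R^-1 * \int[P]_w (u (X 0%N w) ^+ 2).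
Proof.
move=> n0 mu iu2 Eu; have [h1 h2] := sum_sqr n mu iu2 Eu.
have e w : avg n u w ^+ 2 = n%:R ^- 2 * (\sum_(1 <= j < n.+1) u (X j w)) ^+ 2.
  by rewrite exprMn exprVn.
split; first by apply: eq_intg (intgZ _ h1) => w; rewrite e.
under eq_Rintegral do rewrite e.
rewrite RintZ// h2 mulrA; congr (_ * _).
by field; rewrite pnatr_eq0 -lt0n.
Qed.

(** The second moment of the normalised average is that of [u], whatever [n]; by |x| <= 1 + x^2 it
    bounds the first absolute moment, to which Markov's inequality applies. *)
Lemma OP_avg u : measurable_fun setT u ->
  intg P (fun w => u (X 0%N w) ^+ 2) -> \int[P]_w u (X 0%N w) = 0 ->
  OP P (fun n w => Num.sqrt n%:R * avg n u w).
Proof.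
move=> mu iu2 Eu.
have key n : (0 < n)%N -> intg P (fun w => (Num.sqrt n%:R * avg n u w) ^+ 2) /\
    \int[P]_w ((Num.sqrt n%:R * avg n u w) ^+ 2) = \int[P]_w (u (X 0%N w) ^+ 2).
  move=> n0; have [h1 h2] := avg_sqr n0 mu iu2 Eu.
  have e w : (Num.sqrt n%:R * avg n u w) ^+ 2 = n%:R * avg n u w ^+ 2.
    by rewrite exprMn sqr_sqrtr.
  split; first by apply: eq_intg (intgZ _ h1) => w; rewrite e.
  under eq_Rintegral do rewrite e.
  by rewrite RintZ// h2 mulrA mulfV ?mul1r// pnatr_eq0 -lt0n.
have le1 (x : R) : `|x| <= 1 + x ^+ 2.
  by rewrite ler_norml; apply/andP; split; nra.
have key2 n : (0 < n)%N -> intg P (fun w => `|Num.sqrt n%:R * avg n u w|).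
  move=> n0; apply: intg_dom (intgD (intg_cst P 1) (key n n0).1) _ => [|w].
    apply: measurableT_comp => //; apply: measurable_funM => //.
    exact: measurable_avg.
  by rewrite normr_id.
apply: (@OP_mean _ _ _ _ _ (1 + \int[P]_w (u (X 0%N w) ^+ 2))).
  by near=> n; apply: key2; near: n; exact: nbhs_infty_gt.
near=> n; have n0 : (0 < n)%N by near: n; exact: nbhs_infty_gt.
rewrite -(key n n0).2 -[X in X + _](Rint_cst P) -RintD; last 2 first.
- exact: intg_cst.
- exact: (key n n0).1.
apply: Rint_le; [exact: key2|apply: intgD; [exact: intg_cst|exact: (key n n0).1]|].
by move=> w; exact: le1.
Unshelve. all: by end_near. Qed.

(* Truncation: no moment beyond the first is available. *)
Lemma wlln u : measurable_fun setT u -> intg P (fun w => u (X 0%N w)) ->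
  oP P (fun n w => avg n u w - \int[P]_v u (X 0%N v)).
Proof.
move=> mu iu; set m := \int[P]_v u (X 0%N v).
have iavg n v : measurable_fun setT v -> intg P (fun w => v (X 0%N w)) ->
    intg P (avg n v) /\
    ((0 < n)%N -> \int[P]_w avg n v w = \int[P]_w v (X 0%N w)).
  move=> mv iv; have ij j := iid_intg X_iid j mv iv.
  split; first by apply: intgZ; exact: intg_sum.
  move=> n0; rewrite /avg RintZ; last exact: intg_sum.
  rewrite Rint_sum//; under eq_bigr do rewrite (iid_Rint X_iid)//.
  rewrite sumr_const_nat subn1/= -[X in _ * X]mulr_natl mulrA mulVf ?mul1r//.
  by rewrite pnatr_eq0 -lt0n.
apply: (@oP_mean _ _ _ _ _ (fun n => \int[P]_w `|avg n u w - m|)).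
- near=> n; apply: intg_norm; apply: intgB; last exact: intg_cst.
  exact: (iavg n u mu iu).1.
- by near=> n.
apply/cvgrPdist_le => e e0.
pose tr (K : nat) x := Num.max (- K%:R) (Num.min (u x) K%:R).
have mtr K : measurable_fun setT (tr K).
  by apply: measurable_maxr => //; exact: measurable_minr.
have trE K x : [/\ `|tr K x| <= K%:R, `|u x - tr K x| <= `|u x| &
    `|u x| <= K%:R -> tr K x = u x].
  have K0 : 0 <= K%:R :> R by [].
  rewrite /tr; case: (leP (u x) K%:R) => h1; last first.
    rewrite max_r; last by lra.
    split; [by rewrite ger0_norm|by rewrite !ger0_norm; lra|].
    by rewrite ler_norml => /andP[]; lra.
  case: (leP (- K%:R) (u x)) => h2.
    by split; rewrite ?subrr ?normr0// ler_norml h1 h2.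
  split; first by rewrite normrN ger0_norm.
    by rewrite opprK !ltr0_norm; lra.
  by rewrite ler_norml => /andP[]; lra.
have trK K x : `|tr K x| <= K%:R by have [] := trE K x.
have tru K x : `|u x - tr K x| <= `|u x| by have [] := trE K x.
have lim : (\int[P]_w `|u (X 0%N w) - tr K (X 0%N w)|) @[K --> \oo] --> (0 : R).
  rewrite -(Rint0 P); apply: (dct_real (g := fun w => `|u (X 0%N w)|)) => //.
  - move=> K; apply: measurableT_comp => //.
    by apply: measurable_funB; exact: measurableT_comp.
  - move=> w; apply: cvg_near_cst; near=> K.
    have : `|u (X 0%N w)| <= K%:R by near: K; exact: nbhs_infty_ger.
    by have [_ _ /[apply] ->] := trE K (X 0%N w); rewrite subrr normr0.
  - exact: intg_norm.
  - by move=> K w; rewrite normr_id.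
have e40 : 0 < e / 4 by rewrite divr_gt0.
have [K hK] : exists K, \int[P]_w `|u (X 0%N w) - tr K (X 0%N w)| <= e / 4.
  have /cvgrPdist_le/(_ _ e40) [K _ hK] := lim; exists K.
  by have := hK K (leqnn K); rewrite /= sub0r normrN => /(le_trans (ler_norm _)).
pose mK := \int[P]_w tr K (X 0%N w).
have itr : intg P (fun w => tr K (X 0%N w)).
  by apply: (@intg_bounded _ _ _ P _ K%:R) => //; exact: measurableT_comp.
have mKK : `|mK| <= K%:R.
  by rewrite -(Rint_cst P K%:R); apply: Rint_norm_le => //; exact: intg_cst.
pose v x := tr K x - mK.
have mv : measurable_fun setT v by apply: measurable_funB.
have vK x : `|v x| <= 2 * K%:R.
  by rewrite (le_trans (ler_normB _ _))// mulr_natl mulr2n lerD.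
have iv2 : intg P (fun w => v (X 0%N w) ^+ 2).
  apply: (@intg_bounded _ _ _ P _ ((2 * K%:R) ^+ 2)) => [|w].
    by apply: measurable_funX; exact: measurableT_comp.
  by rewrite normrX lerXn2r ?nnegrE.
have Ev : \int[P]_w v (X 0%N w) = 0.
  by rewrite RintB ?Rint_cst ?subrr//; exact: intg_cst.
pose d x := `|u x - tr K x|.
have md : measurable_fun setT d.
  by apply: measurableT_comp => //; exact: measurable_funB.
have idd : intg P (fun w => d (X 0%N w)).
  apply: intg_dom (intg_norm iu) _ => [|w]; first exact: measurableT_comp.
  by rewrite normr_id.
pose V := \int[P]_w (v (X 0%N w) ^+ 2).
(* The deviation splits into the average clipping error, the shift of the mean caused by clipping,
   each at most [e / 4], and the centred clipped average. For the latter |y| <= q + y^2 / q with q =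
   [e / 4] brings in the second moment, of order 1/n. *)
have bnd n : (0 < n)%N -> \int[P]_w `|avg n u w - m| <=
    e / 4 + e / 4 + (e / 4 + (e / 4)^-1 * (n%:R^-1 * V)).
  move=> n0; have [iv2n Ev2n] := avg_sqr n0 mv iv2 Ev.
  have [id1 Ed1] := iavg n d md idd.
  apply: (@le_trans _ _ (\int[P]_w (avg n d w + e / 4 +
      (e / 4 + (e / 4)^-1 * avg n v w ^+ 2)))); last first.
    rewrite RintD; last 2 first.
    - by apply: intgD => //; exact: intg_cst.
    - by apply: intgD; [exact: intg_cst|exact: intgZ].
    rewrite RintD//; last exact: intg_cst.
    rewrite RintD; [|exact: intg_cst|exact: intgZ].
    rewrite !Rint_cst Ed1// RintZ// Ev2n -/V.
    by rewrite lerD2r lerD2r.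
  apply: Rint_le.
  - by apply: intg_norm; apply: intgB; [exact: (iavg n u mu iu).1|exact: intg_cst].
  - apply: intgD; first by apply: intgD => //; exact: intg_cst.
    by apply: intgD; [exact: intg_cst|exact: intgZ].
  move=> w.
  have dec : avg n u w - m = avg n (fun x => u x - tr K x) w + avg n v w + (mK - m).
    rewrite /avg /v -mulrDr -big_split/=.
    under [in RHS]eq_bigr do rewrite addrA subrK.
    rewrite sumrB sumr_const_nat subn1/= mulrBr -[mK *+ n]mulr_natl mulrA mulVf.
      by rewrite mul1r; lra.
    by rewrite pnatr_eq0 -lt0n.
  have t1 : `|avg n (fun x => u x - tr K x) w| <= avg n d w.
    rewrite /avg normrM ger0_norm ?invr_ge0// ler_wpM2l ?invr_ge0//.
    exact: ler_norm_sum.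
  have t2 : `|mK - m| <= e / 4.
    rewrite distrC /m /mK -RintB//; apply: le_trans hK.
    by apply: Rint_norm_le => //; exact: intgB.
  have t3 : `|avg n v w| <= e / 4 + (e / 4)^-1 * avg n v w ^+ 2.
    move: (avg n v w) (e / 4) e40 => y q q0; rewrite -(ler_pM2l q0).
    have -> : q * (q + q^-1 * y ^+ 2) = q * q + `|y| ^+ 2.
      by rewrite real_normK ?num_real//; field; rewrite gt_eqF.
    by have := sqr_ge0 (q - `|y|); have := normr_ge0 y; nra.
  rewrite dec; apply: (le_trans (ler_normD _ _)); rewrite -addrA.
  apply: (le_trans (lerD (ler_normD _ _) (lexx _))).
  by move: t1 t2 t3; lra.
have limV : (e / 4 + e / 4 + (e / 4 + (e / 4)^-1 * (n%:R^-1 * V))) @[n --> \oo] -->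
    e / 4 + e / 4 + (e / 4 + (e / 4)^-1 * (0 * V)).
  apply: cvgD; first exact: cvg_cst.
  apply: cvgD; first exact: cvg_cst.
  apply: cvgMr; apply: cvgMl.
  apply/cvgrPdist_le => r r0; near=> n.
  rewrite sub0r normrN ger0_norm ?invr_ge0// invf_ple ?posrE//.
    by near: n; exact: nbhs_infty_ger.
  by rewrite ltr0n; near: n; exact: nbhs_infty_gt.
have lt_e : e / 4 + e / 4 + (e / 4 + (e / 4)^-1 * (0 * V)) < e.
  by rewrite mul0r mulr0; lra.
have small := cvgr_le _ limV _ lt_e.
near=> n; rewrite sub0r normrN ger0_norm; last exact: Rint_ge0.
apply: (le_trans (bnd n _)); first by near: n; exact: nbhs_infty_gt.
by near: n; exact: small.
Unshelve. all: by end_near. Qed.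

End sample_averages.

(** * Inverse square roots of symmetric matrices *)

Section euclidean.
Context (R : realType) (d : nat).
Implicit Types (x y u v : 'cV[R]_d) (A B C D : 'M[R]_d) (c r : R).

Lemma dotvE x y : dotv x y = \sum_i x i ord0 * y i ord0.
Proof. by rewrite /dotv mxE; apply: eq_bigr => i _; rewrite mxE. Qed.

Lemma dotvC x y : dotv x y = dotv y x.
Proof. by rewrite !dotvE; apply: eq_bigr => i _; rewrite mulrC. Qed.

Lemma dotvDr x y v : dotv x (y + v) = dotv x y + dotv x v.
Proof. by rewrite /dotv mulmxDr mxE. Qed.

Lemma dotvDl x y v : dotv (x + y) v = dotv x v + dotv y v.
Proof. by rewrite !(dotvC _ v) dotvDr. Qed.

Lemma dotvZr c x y : dotv x (c *: y) = c * dotv x y.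
Proof. by rewrite /dotv -scalemxAr mxE. Qed.

Lemma dotvZl c x y : dotv (c *: x) y = c * dotv x y.
Proof. by rewrite !(dotvC _ y) dotvZr. Qed.

Lemma dotvNr x y : dotv x (- y) = - dotv x y.
Proof. by rewrite -scaleN1r dotvZr mulN1r. Qed.

Lemma dotvBr x y v : dotv x (y - v) = dotv x y - dotv x v.
Proof. by rewrite dotvDr dotvNr. Qed.

Lemma dotv_mulmx A x y : dotv x (A *m y) = dotv (A^T *m x) y.
Proof. by rewrite /dotv mulmxA trmx_mul trmxK. Qed.

Lemma dotvv_ge0 x : 0 <= dotv x x.
Proof. by rewrite dotvE sumr_ge0// => i _; rewrite -expr2 sqr_ge0. Qed.

Lemma dotvv_eq0 x : dotv x x = 0 -> x = 0.
Proof.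
rewrite dotvE => /eqP; rewrite psumr_eq0; last by move=> i _; rewrite -expr2 sqr_ge0.
move=> /allP h; apply/matrixP => i j; rewrite mxE (ord1 j).
have := h i; rewrite mem_index_enum => /(_ isT) /=.
by rewrite -expr2 sqrf_eq0 => /eqP.
Qed.

Lemma enorm_ge0 x : 0 <= enorm x. Proof. exact: sqrtr_ge0. Qed.

Lemma enorm_sqr x : enorm x ^+ 2 = dotv x x.
Proof. by rewrite sqr_sqrtr// dotvv_ge0. Qed.

Lemma quadratic_disc (a b c : R) : (forall t, 0 <= a + 2 * b * t + c * t ^+ 2) ->
  0 <= c -> b ^+ 2 <= a * c.
Proof.
move=> h c0; have [c00|cn0] := eqVneq c 0.
  have [->|bn0] := eqVneq b 0; first by rewrite c00 expr0n/= mulr0.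
  (* When [c = 0] and [b] is not 0, the affine function takes the value -1 at this point. *)
  have := h (- (a + 1) / (2 * b)); rewrite c00 mul0r addr0 mulrC divfK; last by lra.
  by rewrite ?mulf_neq0//; lra.
have cp : 0 < c by rewrite lt_neqAle eq_sym cn0.
have := h (- b / c).
have -> : a + 2 * b * (- b / c) + c * (- b / c) ^+ 2 = (a * c - b ^+ 2) / c by field.
by rewrite pmulr_lge0 ?invr_gt0// subr_ge0.
Qed.

Definition psd A := A^T = A /\ forall v, 0 <= dotv v (A *m v).

(** The discriminant of the form of [A] along the line [u + t *: v]. The case [A = 1] is the
    Euclidean inequality; general [A] serves the eigenvalue bounds. *)
Lemma psd_CS A u v : psd A ->
  dotv u (A *m v) ^+ 2 <= dotv u (A *m u) * dotv v (A *m v).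
Proof.
move=> [As Ap]; apply: quadratic_disc; last exact: Ap.
move=> t; have := Ap (u + t *: v).
rewrite mulmxDr -scalemxAr !dotvDl !dotvDr !dotvZl !dotvZr.
rewrite (dotv_mulmx _ v u) As (dotvC _ u).
by move=> h; apply: le_trans h _; rewrite le_eqVlt; apply/orP; left; apply/eqP; ring.
Qed.

Lemma dotv_CS u v : `|dotv u v| <= enorm u * enorm v.
Proof.
have h : psd (1%:M : 'M[R]_d).
  by split; [rewrite trmx1|move=> w; rewrite mul1mx dotvv_ge0].
have := psd_CS u v h; rewrite !mul1mx -!enorm_sqr -exprMn => h2.
by rewrite -(ler_pXn2r (n := 2)) ?nnegrE ?mulr_ge0 ?enorm_ge0// real_normK ?num_real.
Qed.

Lemma enormD u v : enorm (u + v) <= enorm u + enorm v.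
Proof.
rewrite -(ler_pXn2r (n := 2)) ?nnegrE ?addr_ge0 ?enorm_ge0//.
rewrite sqrrD !enorm_sqr dotvDl !dotvDr (dotvC v u).
have := dotv_CS u v; rewrite ler_norml => /andP[_]; lra.
Qed.

Lemma enormZ c u : enorm (c *: u) = `|c| * enorm u.
Proof.
by rewrite /enorm dotvZl dotvZr mulrA -expr2 sqrtrM ?sqr_ge0// sqrtr_sqr.
Qed.

Lemma enormN u : enorm (- u) = enorm u.
Proof. by rewrite -scaleN1r enormZ normrN1 mul1r. Qed.

Lemma enormB u v : enorm (u - v) <= enorm u + enorm v.
Proof. by rewrite -(enormN v) enormD. Qed.

Lemma enorm_eq0 u : enorm u = 0 -> u = 0.
Proof. by move=> h; apply: dotvv_eq0; rewrite -enorm_sqr h expr0n. Qed.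

Lemma coord_le_enorm u i : `|u i ord0| <= enorm u.
Proof.
rewrite -(ler_pXn2r (n := 2)) ?nnegrE ?enorm_ge0// enorm_sqr real_normK ?num_real//.
rewrite dotvE (bigD1 i)//= -expr2 lerDl sumr_ge0// => j _.
by rewrite -expr2 sqr_ge0.
Qed.

Lemma enorm_delta (i : 'I_d) : enorm (delta_mx i ord0 : 'cV[R]_d) = 1.
Proof.
rewrite /enorm dotvE (bigD1 i)//= big1; last first.
  by move=> j ji; rewrite !mxE (negbTE ji) mul0r.
by rewrite !mxE !eqxx mul1r addr0 sqrtr1.
Qed.

Lemma enorm_le_sum u : enorm u <= \sum_i `|u i ord0|.
Proof.
have -> : u = \sum_i u i ord0 *: delta_mx i ord0.
  by rewrite {1}(matrix_sum_delta u); apply: eq_bigr => i _; rewrite big_ord1.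
have gen (s : seq 'I_d) : enorm (\sum_(i <- s) u i ord0 *: delta_mx i ord0) <=
    \sum_(i <- s) `|u i ord0|.
  elim: s => [|i s ih]; first by rewrite !big_nil /enorm dotvE big1 ?sqrtr0// => i _; rewrite mxE mul0r.
  rewrite !big_cons; apply: le_trans (enormD _ _) _.
  by rewrite lerD// enormZ enorm_delta mulr1.
apply: le_trans (gen _) _; rewrite le_eqVlt; apply/orP; left; apply/eqP.
apply: eq_bigr => i _; congr `|_|.
rewrite summxE (bigD1 i)//= big1 ?addr0; first by rewrite !mxE !eqxx mulr1.
by move=> j ji; rewrite !mxE eq_sym (negbTE ji) mulr0.
Qed.

(** An operator norm bound as a relation: no supremum has to be formed, and constants propagate
    through sums and products. *)
Definition opb A c := forall v, enorm (A *m v) <= c * enorm v.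

Lemma opb_le A c c' : c <= c' -> opb A c -> opb A c'.
Proof. by move=> cc h v; apply: le_trans (h v) _; rewrite ler_wpM2r ?enorm_ge0. Qed.

Lemma opbD A B c c' : opb A c -> opb B c' -> opb (A + B) (c + c').
Proof.
move=> hA hB v; rewrite mulmxDl mulrDl; apply: le_trans (enormD _ _) _.
exact: lerD.
Qed.

Lemma opbZ A c k : opb A c -> opb (k *: A) (`|k| * c).
Proof. by move=> hA v; rewrite -scalemxAl enormZ -mulrA ler_wpM2l. Qed.

Lemma opbN A c : opb A c -> opb (- A) c.
Proof. by move=> hA v; rewrite mulNmx enormN. Qed.

Lemma opbM A B c c' : 0 <= c -> opb A c -> opb B c' -> opb (A *m B) (c * c').
Proof.
move=> c0 hA hB v; rewrite -mulmxA; apply: le_trans (hA _) _.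
by rewrite -mulrA ler_wpM2l.
Qed.

Lemma opb0 : opb 0 0.
Proof.
move=> v; rewrite mul0mx mul0r /enorm dotvE big1 ?sqrtr0// => i _.
by rewrite !mxE mul0r.
Qed.

Lemma opb1 : opb 1%:M 1.
Proof. by move=> v; rewrite mul1mx mul1r. Qed.

Lemma opb_entry A c i j : opb A c -> `|A i j| <= c.
Proof.
move=> /(_ (delta_mx j ord0)); rewrite enorm_delta mulr1; apply: le_trans.
by apply: le_trans (coord_le_enorm _ i); rewrite -colE mxE.
Qed.

(** An upper bound for the operator norm that is visibly a measurable function of the entries and
    whose stochastic order can be read off entry by entry. *)
Definition mx_l1 A : R := \sum_i \sum_j `|A i j|.

Lemma mx_l1_ge0 A : 0 <= mx_l1 A.
Proof. by apply: sumr_ge0 => i _; apply: sumr_ge0. Qed.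

Lemma opb_l1 A : opb A (mx_l1 A).
Proof.
move=> v; apply: le_trans (enorm_le_sum _) _.
rewrite /mx_l1 mulr_suml; apply: ler_sum => i _; rewrite mxE mulr_suml.
apply: le_trans (ler_norm_sum _ _ _) _; apply: ler_sum => j _.
by rewrite normrM ler_wpM2l// coord_le_enorm.
Qed.

Lemma dotv_opb A c v : opb A c -> `|dotv v (A *m v)| <= c * enorm v ^+ 2.
Proof.
move=> hA; apply: le_trans (dotv_CS _ _) _; rewrite mulrC expr2 mulrA.
by rewrite ler_wpM2r ?enorm_ge0.
Qed.

(** Cauchy-Schwarz for the form of [A] at y = A v and v gives |y|^4 <= (r |y|^2) (r |v|^2). *)
Lemma psd_opb A r : psd A -> 0 <= r ->
  (forall v, dotv v (A *m v) <= r * enorm v ^+ 2) -> opb A r.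
Proof.
move=> pA r0 h v; have := psd_CS (A *m v) v pA; set y := A *m v.
rewrite -enorm_sqr; have [->|yn0] := eqVneq (enorm y) 0.
  by rewrite mulr_ge0 ?enorm_ge0.
have y0 : 0 < enorm y by rewrite lt_neqAle eq_sym yn0 enorm_ge0.
move=> /le_trans/(_ (ler_pM (pA.2 _) (pA.2 _) (h y) (h v))).
have -> : r * enorm y ^+ 2 * (r * enorm v ^+ 2) = (enorm y * (r * enorm v)) ^+ 2 by ring.
rewrite ler_pXn2r ?nnegrE ?mulr_ge0 ?enorm_ge0 ?sqr_ge0//.
by rewrite expr2 ler_pM2l.
Qed.

Lemma trmxB_psd A : A^T = A -> (1%:M - A)^T = 1%:M - A.
Proof. by move=> As; rewrite linearB/= trmx1 As. Qed.

Lemma dotv_subid A v : dotv v ((1%:M - A) *m v) = enorm v ^+ 2 - dotv v (A *m v).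
Proof. by rewrite mulmxBl mul1mx dotvBr enorm_sqr. Qed.

End euclidean.

Lemma cvgn_sum (R : realType) (I : Type) (s : seq I) (F : I -> nat -> R) (l : I -> R) :
  (forall i, F i k @[k --> \oo] --> l i) ->
  (\sum_(i <- s) F i k) @[k --> \oo] --> \sum_(i <- s) l i.
Proof.
move=> h; elim: s => [|i s ih].
  by rewrite big_nil; under eq_fun do rewrite big_nil; exact: cvg_cst.
by rewrite big_cons; under eq_fun do rewrite big_cons; exact: cvgD.
Qed.

(** * Square roots of positive definite matrices by iteration *)

Section square_root.
Context (R : realType) (d : nat).
Implicit Types (N A B C Y : 'M[R]_d) (r : R).

(** A fixed point Y of Y = (N + Y^2) / 2 satisfies (1 - Y)^2 = 1 - N. The iteration replaces
    diagonalisation, and since its steps are polynomial in [N] the root is a measurable function of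
    [N]. *)
Fixpoint sqrt_iter N k : 'M[R]_d :=
  if k is k'.+1 then 2^-1 *: (N + sqrt_iter N k' *m sqrt_iter N k') else 0.

Lemma sqrt_iter_opb N r k : 0 <= r -> r <= 1 -> opb N r -> opb (sqrt_iter N k) r.
Proof.
move=> r0 r1 hN; elim: k => [|k ih] /=; first exact: opb_le (@opb0 R d).
have h := opbZ 2^-1 (opbD hN (opbM r0 ih ih)).
apply: opb_le h; rewrite ger0_norm ?invr_ge0//.
have : r * r <= r by rewrite ler_piMr.
by lra.
Qed.

Lemma sqrt_iter_sym N k : N^T = N -> (sqrt_iter N k)^T = sqrt_iter N k.
Proof.
move=> Ns; elim: k => [|k ih] /=; first by rewrite trmx0.
by rewrite linearZ linearD/= trmx_mul ih Ns.
Qed.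

(** With Z the previous difference, the next one is half of Y' Z + Z Y for two iterates Y' and Y of
    norm at most [r], hence smaller by a factor [r]. *)
Lemma sqrt_iter_diff N r k : 0 <= r -> r <= 1 -> opb N r ->
  opb (sqrt_iter N k.+1 - sqrt_iter N k) (r ^+ k).
Proof.
move=> r0 r1 hN; elim: k => [|k ih].
  by rewrite subr0 expr0; apply: (opb_le r1); exact: sqrt_iter_opb.
have -> : sqrt_iter N k.+2 - sqrt_iter N k.+1 = 2^-1 *: (
  sqrt_iter N k.+1 *m (sqrt_iter N k.+1 - sqrt_iter N k) +
  (sqrt_iter N k.+1 - sqrt_iter N k) *m sqrt_iter N k).
  rewrite [sqrt_iter N k.+2]/= {3}[sqrt_iter N k.+1]/= -/(sqrt_iter N k.+1).
  rewrite -scalerBr mulmxBr mulmxBl addrA subrK; congr (_ *: _).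
  by rewrite opprD addrACA subrr add0r.
have hk := sqrt_iter_opb k r0 r1 hN; have hk1 := sqrt_iter_opb k.+1 r0 r1 hN.
have h := opbZ 2^-1 (opbD (opbM r0 hk1 ih) (opbM (exprn_ge0 k r0) ih hk)).
apply: opb_le h; rewrite ger0_norm ?invr_ge0// exprS.
by rewrite (mulrC (r ^+ k)); lra.
Qed.

Definition sqrt_lim N : 'M[R]_d := \matrix_(i, j) limn (fun k => sqrt_iter N k i j).

Lemma sqrt_iter_cvg N r i j : 0 <= r -> r < 1 -> opb N r ->
  sqrt_iter N k i j @[k --> \oo] --> sqrt_lim N i j.
Proof.
move=> r0 r1 hN; rewrite mxE.
pose y k := sqrt_iter N k i j; rewrite -/y.
have dy k : `|y k.+1 - y k| <= r ^+ k.
  have := opb_entry i j (sqrt_iter_diff k r0 (ltW r1) hN).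
  by rewrite mxE [X in _ + X]mxE.
pose D k := y k.+1 - y k.
have -> : y = series D.
  apply/funext => k; rewrite /series/= telescope_sumr//.
  by rewrite [y 0%N]mxE subr0.
apply: normed_cvg; apply: (@series_le_cvg _ _ (geometric 1 r)).
- by move=> k /=.
- by move=> k /=; rewrite mul1r exprn_ge0.
- by move=> k /=; rewrite mul1r; exact: dy.
- by apply: is_cvg_geometric_series; rewrite ger0_norm.
Qed.

(** The recursion, the symmetry and the norm bound pass to the entrywise limit; the resulting fixed
    point equation is the claimed square. *)
Lemma sqrt_limP N r : N^T = N -> 0 <= r -> r < 1 -> opb N r ->
  [/\ (sqrt_lim N)^T = sqrt_lim N, opb (sqrt_lim N) r &
    (1%:M - sqrt_lim N) *m (1%:M - sqrt_lim N) = 1%:M - N].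
Proof.
move=> Ns r0 r1 hN; have cv i j := @sqrt_iter_cvg N r i j r0 r1 hN.
have Yeq : sqrt_lim N = 2^-1 *: (N + sqrt_lim N *m sqrt_lim N).
  apply/matrixP => i j.
  have c1 : sqrt_iter N k.+1 i j @[k --> \oo] --> sqrt_lim N i j.
    by have := cv i j; rewrite -(cvg_shiftS (fun k => sqrt_iter N k i j)).
  have c2 : sqrt_iter N k.+1 i j @[k --> \oo] -->
      (2^-1 *: (N + sqrt_lim N *m sqrt_lim N)) i j.
    have -> : (fun k => sqrt_iter N k.+1 i j) = (fun k => 2^-1 * (N i j +
        \sum_l sqrt_iter N k i l * sqrt_iter N k l j)).
      by apply/funext => k; rewrite [LHS]mxE mxE; congr (_ * (_ + _)); rewrite mxE.
    have -> : (2^-1 *: (N + sqrt_lim N *m sqrt_lim N)) i j = 2^-1 * (N i j +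
        \sum_l sqrt_lim N i l * sqrt_lim N l j).
      by rewrite [LHS]mxE mxE; congr (_ * (_ + _)); rewrite mxE.
    apply: cvgMr; apply: cvgD; first exact: cvg_cst.
    by apply: cvgn_sum => l; apply: cvgM; exact: cv.
  by apply: (cvg_unique _ c1 c2).
have Ys : (sqrt_lim N)^T = sqrt_lim N.
  apply/matrixP => i j; rewrite mxE.
  have e : (fun k => sqrt_iter N k i j) = (fun k => sqrt_iter N k j i).
    by apply/funext => k; rewrite -[in LHS](sqrt_iter_sym k Ns) mxE.
  have := cv i j; rewrite e => h.
  exact: (cvg_unique (@Rhausdorff R) (cv j i) h).
split=> //; last first.
  rewrite mulmxBl !mulmxBr !mul1mx mulmx1.
  have e2 : sqrt_lim N *m sqrt_lim N = 2 *: sqrt_lim N - N.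
    by rewrite [in RHS]Yeq scalerA mulfV// scale1r (addrC N) addrK.
  rewrite e2 scaler_nat mulr2n; move: (sqrt_lim N) => Y.
  by apply/matrixP => i j; rewrite !mxE; ring.
move=> v.
have lim2 : enorm (sqrt_lim N *m v) ^+ 2 <= (r * enorm v) ^+ 2.
  rewrite enorm_sqr dotvE.
  have cvv : (\sum_i (sqrt_iter N k *m v) i ord0 * (sqrt_iter N k *m v) i ord0)
     @[k --> \oo] --> \sum_i (sqrt_lim N *m v) i ord0 * (sqrt_lim N *m v) i ord0.
    have ci i : (sqrt_iter N k *m v) i ord0 @[k --> \oo] --> (sqrt_lim N *m v) i ord0.
      rewrite mxE; under eq_fun do rewrite mxE.
      by apply: cvgn_sum => l; apply: cvgMl; exact: cv.
    by apply: cvgn_sum => l; apply: cvgM; exact: ci.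
  apply: (cvgr_to_le cvv); near=> k.
  rewrite -dotvE -enorm_sqr ler_pXn2r ?nnegrE ?mulr_ge0 ?enorm_ge0//.
  exact: (sqrt_iter_opb k r0 (ltW r1) hN).
by move: lim2; rewrite ler_pXn2r ?nnegrE ?mulr_ge0 ?enorm_ge0.
Unshelve. all: by end_near. Qed.

Lemma pd_psd A : sympd A -> psd A.
Proof.
move=> [As Ap]; split => // v; have [->|v0] := eqVneq v 0; last exact/ltW/Ap.
by rewrite mulmx0 dotvE sumr_ge0// => i _; rewrite mxE mul0r.
Qed.

Lemma pd_unit A : sympd A -> A \in unitmx.
Proof.
move=> [As Ap]; rewrite -unitmx_tr -row_free_unit -kermx_eq0.
apply/negPn/negP => /rowV0Pn [v /sub_kermxP vA v0].
have vT0 : v^T != 0 by apply: contra v0 => /eqP h; rewrite -[v]trmxK h trmx0.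
have e : A *m v^T = 0 by rewrite -[A]trmxK -trmx_mul vA trmx0.
by have := Ap _ vT0; rewrite e dotvE big1 ?ltxx// => i _; rewrite [X in _ * X]mxE mulr0.
Qed.

(** With D = B - C, B D + D C = B^2 - C^2 = 0, so the traces of D B D and D C D add up to 0. Each is
    a sum of nonnegative form values at the columns of D; hence both vanish, and positivity of [B]
    forces every column to be 0. *)
Lemma sympd_unique B C : sympd B -> sympd C -> B *m B = C *m C -> B = C.
Proof.
move=> pB pC BC; pose D := B - C.
have Ds : D^T = D by rewrite linearB/= pB.1 pC.1.
have h : B *m D + D *m C = 0.
  by rewrite mulmxBr mulmxBl BC addrA subrK subrr.
have tr0 : \tr (D *m B *m D) + \tr (D *m C *m D) = 0.
  rewrite -[X in _ + X]mxtrace_mulC mulmxA -mxtraceD -!mulmxA -mulmxDr.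
  by rewrite h mulmx0 mxtrace0.
have trE' M (F : 'M[R]_d) : F^T = F ->
    \tr (F *m M *m F) = \sum_i dotv (col i F) (M *m col i F).
  move=> Fs; apply: eq_bigr => i _; rewrite /dotv -{1}Fs -mulmxA [LHS]mxE [RHS]mxE.
  apply: eq_bigr => k _; congr (_ * _); first by rewrite !mxE.
  by rewrite [LHS]mxE [RHS]mxE; apply: eq_bigr => l _; rewrite [in RHS]mxE.
have trE M := trE' M D Ds.
have pB' := pd_psd pB; have pC' := pd_psd pC.
have sB : \tr (D *m B *m D) = 0.
  apply/eqP; rewrite eq_le; apply/andP; split; last first.
    by rewrite trE; apply: sumr_ge0 => i _; exact: pB'.2.
  have : 0 <= \tr (D *m C *m D) by rewrite trE; apply: sumr_ge0 => i _; exact: pC'.2.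
  by move: tr0; lra.
have cz i : col i D = 0.
  apply/eqP; apply/negPn/negP => ci0; have := pB.2 _ ci0.
  move/eqP: sB; rewrite trE psumr_eq0; last by move=> k _; exact: pB'.2.
  by move=> /allP/(_ i); rewrite mem_index_enum => /(_ isT)/eqP ->; rewrite ltxx.
apply/eqP; rewrite -subr_eq0; apply/eqP/matrixP => i j.
by have /matrixP/(_ i ord0) := cz j; rewrite !mxE.
Qed.

(** Larger than the operator norm of [A], so that for positive definite [A] the matrix 1 - A /
    [sqrt_scale A] has norm below 1. The added 1 makes it at least 1. *)
Definition sqrt_scale A : R := mx_l1 A + 1.

Definition pd_sqrt A : 'M[R]_d := Num.sqrt (sqrt_scale A) *:
  (1%:M - sqrt_lim (1%:M - (sqrt_scale A)^-1 *: A)).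

(** The least eigenvalue of [A] is at least the inverse of the norm of its inverse; this is
    Cauchy-Schwarz for the form of [A] at [v] and [invmx A *m v]. *)
Lemma pd_lower A : sympd A -> forall v,
  enorm v ^+ 2 <= sqrt_scale (invmx A) * dotv v (A *m v).
Proof.
move=> pA v; have Au := pd_unit pA; have [As _] := pA.
set s := sqrt_scale _; have s0 : 0 < s by rewrite ltr_wpDl// mx_l1_ge0.
pose x := invmx A *m v; have Ax : A *m x = v by rewrite mulKVmx.
have := psd_CS v x (pd_psd pA); rewrite Ax -enorm_sqr.
have hx : dotv x v <= s * enorm v ^+ 2.
  rewrite dotvC; apply: le_trans (ler_norm _) _.
  apply: dotv_opb; apply: (opb_le _ (opb_l1 (invmx A))).
  by rewrite /s /sqrt_scale lerDl.
have [->|vn0] := eqVneq (enorm v) 0.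
  rewrite expr0n/= => _; rewrite mulr_ge0 ?(ltW s0)//; exact: (pd_psd pA).2.
have v0 : 0 < enorm v ^+ 2 by rewrite exprn_gt0// lt_neqAle eq_sym vn0 enorm_ge0.
move=> h; rewrite -(ler_pM2l v0) -expr2; apply: le_trans h _.
have -> : enorm v ^+ 2 * (s * dotv v (A *m v)) = dotv v (A *m v) * (s * enorm v ^+ 2).
  by ring.
by rewrite ler_wpM2l// (pd_psd pA).2.
Qed.

Lemma pd_contraction A : sympd A -> exists r,
  [/\ 0 <= r, r < 1 & opb (1%:M - (sqrt_scale A)^-1 *: A) r].
Proof.
move=> pA; have [As _] := pA.
set t := sqrt_scale A; have t1 : 1 <= t by rewrite lerDr mx_l1_ge0.
have t0 : 0 < t := lt_le_trans ltr01 t1.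
set s := sqrt_scale (invmx A); have s1 : 1 <= s by rewrite lerDr mx_l1_ge0.
have s0 : 0 < s := lt_le_trans ltr01 s1.
set N := 1%:M - t^-1 *: A.
have Ns : N^T = N by apply: trmxB_psd; rewrite linearZ/= As.
have Nv v : dotv v (N *m v) = enorm v ^+ 2 - t^-1 * dotv v (A *m v).
  by rewrite dotv_subid -scalemxAl dotvZr.
have pN : psd N.
  split=> // v; rewrite Nv subr_ge0 ler_pdivrMl//.
  apply: le_trans (ler_norm _) _; apply: dotv_opb; apply: opb_le (opb_l1 A).
  by rewrite lerDl.
(* The form of [A] is at least 1 / s by [pd_lower], so that of A / t is at least 1 / (s t). *)
pose r := 1 - (s * t)^-1.
have r1 : r < 1 by rewrite ltrBlDr ltrDl invr_gt0 mulr_gt0.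
have r0 : 0 <= r.
  by rewrite subr_ge0 invf_le1 ?mulr_gt0// -[1]mulr1 ler_pM.
exists r; split => //; apply: psd_opb => // v; rewrite Nv /r mulrBl mul1r lerD2l lerN2.
have := pd_lower pA v; rewrite -/s => h.
rewrite ler_pdivrMl ?mulr_gt0// mulrA.
by have -> : s * t / t = s by field; rewrite gt_eqF.
Qed.

Lemma pd_sqrtP A : sympd A -> sympd (pd_sqrt A) /\ pd_sqrt A *m pd_sqrt A = A.
Proof.
move=> pA; have [As _] := pA; have [r [r0 r1]] := pd_contraction pA.
rewrite /pd_sqrt; set t := sqrt_scale A; set N := 1%:M - t^-1 *: A => hN.
have t0 : 0 < t by rewrite ltr_wpDl// mx_l1_ge0.
have Ns : N^T = N by apply: trmxB_psd; rewrite linearZ/= As.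
have [Ys hY Y2] := sqrt_limP Ns r0 r1 hN.
split; last first.
  rewrite -scalemxAl -scalemxAr scalerA -expr2 sqr_sqrtr ?(ltW t0)// Y2.
  by rewrite /N subKr scalerA mulfV ?gt_eqF// scale1r.
split; first by rewrite linearZ/= trmxB_psd.
move=> v v0; rewrite -scalemxAl dotvZr mulr_gt0 ?sqrtr_gt0//.
have ev : 0 < enorm v.
  rewrite lt_neqAle enorm_ge0 andbT eq_sym; apply: contra v0 => /eqP h.
  exact/eqP/enorm_eq0.
rewrite dotv_subid subr_gt0.
apply: le_lt_trans (ler_norm _) _; apply: le_lt_trans (dotv_opb v hY) _.
by rewrite gtr_pMl// exprn_gt0.
Qed.

Lemma pd_inv A : sympd A -> sympd (invmx A).
Proof.
move=> pA; have Au := pd_unit pA; have [As Ap] := pA.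
split; first by rewrite trmx_inv As.
move=> v v0; have x0 : invmx A *m v != 0.
  by apply: contra v0 => /eqP h; rewrite -(mulKVmx Au v) h mulmx0.
by have := Ap _ x0; rewrite mulKVmx// dotvC.
Qed.

(** The choice operator returns some positive definite root; by uniqueness it is the constructed
    one. *)
Lemma invsqrtmx_pd A : sympd A -> invsqrtmx A = pd_sqrt (invmx A).
Proof.
move=> pA; have [p1 p2] := pd_sqrtP (pd_inv pA).
have : [set B | sympd B /\ B *m B = invmx A] (pd_sqrt (invmx A)) by [].
rewrite /invsqrtmx => /(xgetI 0) [q1 q2].
by apply: sympd_unique => //; rewrite q2 p2.
Qed.

(** For singular [A] the library sets [invmx A = A], and a positive definite root of [A] would make
    it invertible. No root exists, so the default value is taken. *)
Lemma invsqrtmx_singular A : A \notin unitmx -> invsqrtmx A = 0.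
Proof.
move=> Au; rewrite /invsqrtmx; apply: xgetPN => B [pB BB].
have AE : A = B *m B by rewrite BB /invmx (negbTE Au).
by move: Au; rewrite AE unitmx_mul (pd_unit pB).
Qed.

(** If the form vanishes at [v], Cauchy-Schwarz at A v and v gives A v = 0. *)
Lemma psd_unit_pd A : psd A -> A \in unitmx -> sympd A.
Proof.
move=> pA Au; have [As Ap] := pA; split => // v v0.
rewrite lt_neqAle Ap andbT; apply/negP => /eqP h.
have := psd_CS (A *m v) v pA; rewrite -h mulr0 -enorm_sqr => h2.
have : enorm (A *m v) = 0.
  have : enorm (A *m v) ^+ 2 ^+ 2 == 0 by rewrite eq_le h2 sqr_ge0.
  by rewrite !sqrf_eq0 => /eqP.
by move=> /enorm_eq0 Av; case/eqP: v0; rewrite -(mulKmx Au v) Av mulmx0.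
Qed.

(** Let B be the root, D = B - 1, E = A - 1. From (B + 1) D = - A^(-1) E, |A^(-1)| <= 2 and |D v| <=
    |(B + 1) D v| comes |D| <= 2e. Expanding B A B = 1 gives 2D + E = - (D D + D E + E D + D E D),
    whose half has norm at most 4 e^2 + 2 e^3, and [e <= 2^-1] makes this at most 5 e^2. *)
Lemma invsqrtmx_expansion A e : A^T = A -> opb (A - 1%:M) e -> e <= 2^-1 -> 0 <= e ->
  [/\ opb (invsqrtmx A) 2, opb (invsqrtmx A - 1%:M) (2 * e) &
    opb (invsqrtmx A - 1%:M + 2^-1 *: (A - 1%:M)) (5 * e ^+ 2)].
Proof.
move=> As hE e2 e0; pose E := A - 1%:M.
have AE v : dotv v (A *m v) = enorm v ^+ 2 + dotv v (E *m v).
  by rewrite /E mulmxBl mul1mx dotvBr enorm_sqr; lra.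
have lowA v : 2^-1 * enorm v ^+ 2 <= dotv v (A *m v).
  have := dotv_opb v hE; rewrite AE ler_norml => /andP[h _].
  have := sqr_ge0 (enorm v); nra.
have pA : sympd A.
  split => // v v0; apply: lt_le_trans (lowA v); rewrite mulr_gt0 ?invr_gt0//.
  rewrite exprn_gt0// lt_neqAle enorm_ge0 andbT eq_sym.
  by apply: contra v0 => /eqP h; exact/eqP/enorm_eq0.
have Au := pd_unit pA.
have [p1 p2] := pd_sqrtP (pd_inv pA).
rewrite invsqrtmx_pd//; set B := pd_sqrt _ in p1 p2 *.
have inv2 : opb (invmx A) 2.
  move=> v; set x := invmx A *m v; have Ax : A *m x = v by rewrite mulKVmx.
  have h := dotv_CS x v; have := lowA x; rewrite Ax => h2.
  have {}h : 2^-1 * enorm x ^+ 2 <= enorm x * enorm v.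
    by apply: le_trans h2 _; apply: le_trans (ler_norm _) h.
  have [->|xn0] := eqVneq (enorm x) 0; first by rewrite mulr_ge0 ?enorm_ge0.
  have x0 : 0 < enorm x by rewrite lt_neqAle eq_sym xn0 enorm_ge0.
  by move: h; rewrite expr2 mulrCA ler_pM2l// => h; lra.
pose D := B - 1%:M.
have BB1 : B *m B - 1%:M = - (invmx A *m E).
  by rewrite p2 /E mulmxBr mulVmx// mulmx1 opprB.
have hD : opb D (2 * e).
  move=> v.
  have e1 : (B + 1%:M) *m (D *m v) = - (invmx A *m E *m v).
    rewrite mulmxA -mulNmx -BB1; congr (_ *m _).
    by rewrite /D mulmxBr mulmxDl mulmxDl !mulmx1 !mul1mx opprD addrA addrK.
  have e3 : enorm (D *m v) <= enorm ((B + 1%:M) *m (D *m v)).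
    set y := D *m v; rewrite -(ler_pXn2r (n := 2)) ?nnegrE ?enorm_ge0//.
    rewrite mulmxDl mul1mx !enorm_sqr dotvDl !dotvDr.
    have h1 : 0 <= dotv y (B *m y) by exact: (pd_psd p1).2.
    by have := dotvv_ge0 (B *m y); rewrite (dotvC (B *m y) y); lra.
  apply: le_trans e3 _; rewrite e1 enormN.
  exact: (opbM (ler0n R 2) inv2 hE).
have hB : opb B 2.
  have -> : B = D + 1%:M by rewrite subrK.
  by apply: opb_le (opbD hD (@opb1 R d)); lra.
split => //.
have BAB : B *m A *m B = 1%:M.
  have Bu := pd_unit p1; have : B *m B *m A = 1%:M by rewrite p2 mulVmx.
  rewrite -mulmxA => h; have AE' : A = invmx B *m invmx B.
    by rewrite -[invmx B *m _]mulmx1 -h !mulmxA mulmxKV// mulVmx// mul1mx.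
  by rewrite AE' mulmxA mulmxV// mul1mx mulVmx.
have e4 : D + 2^-1 *: E = - (2^-1 *: (D *m D + D *m E + E *m D + D *m E *m D)).
  have alg (F G : 'M[R]_d) : (F + 1%:M) *m (G + 1%:M) *m (F + 1%:M) = 1%:M ->
      F + F + G + (F *m F + F *m G + G *m F + F *m G *m F) = 0.
    rewrite !mulmxDr !mulmxDl !mul1mx !mulmx1.
    move/(congr1 (fun M => M - 1%:M)); rewrite subrr => <-.
    by apply/matrixP => i j; rewrite !mxE; ring.
  have h : D + D + E + (D *m D + D *m E + E *m D + D *m E *m D) = 0.
    by apply: alg; rewrite /D /E !subrK.
  have half (F G : 'M[R]_d) : F + 2^-1 *: G = 2^-1 *: (F + F + G).
    by apply/matrixP => i j; rewrite !mxE; field.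
  rewrite half.
  by rewrite -scalerN; congr (_ *: _); apply/eqP; rewrite -addr_eq0 h.
rewrite -/D -/E e4; apply: opbN.
have c0 : 0 <= 2 * e by rewrite mulr_ge0.
have h := opbZ 2^-1 (opbD (opbD (opbD (opbM c0 hD hD) (opbM c0 hD hE))
  (opbM e0 hE hD)) (opbM (mulr_ge0 c0 e0) (opbM c0 hD hE) hD)).
apply: opb_le h; rewrite ger0_norm ?invr_ge0//.
have : e ^+ 2 * e <= e ^+ 2 * 2^-1 by rewrite ler_wpM2l ?sqr_ge0.
by move: (sqr_ge0 e); lra.
Qed.

End square_root.

(** * Measurability of matrix functions and Gaussian weights on R^d *)

Section measurable_matrices.
Context dT (T : measurableType dT) (R : realType).

Definition mmx m n (M : T -> 'M[R]_(m, n)) :=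
  forall i j, measurable_fun setT (fun w => M w i j).

(** The inverse is [f] times a real power of the nonnegative [f ^+ 2]; where [f] vanishes both sides
    are 0. *)
Lemma measurable_inv (f : T -> R) : measurable_fun setT f ->
  measurable_fun setT (fun w => (f w)^-1).
Proof.
move=> mf; have -> : (fun w => (f w)^-1) = (fun w => f w * (f w ^+ 2) `^ (-1)).
  apply/funext => w; rewrite powR_inv1 ?sqr_ge0//.
  have [->|f0] := eqVneq (f w) 0; first by rewrite invr0 mul0r.
  by field.
apply: measurable_funM => //.
have m2 : measurable_fun setT (fun w => f w ^+ 2) by exact: measurable_funX.
exact: (measurableT_comp (@measurable_powR R (-1)) m2).
Qed.

Lemma measurable_sqrt (f : T -> R) : measurable_fun setT f ->
  measurable_fun setT (fun w => Num.sqrt (f w)).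
Proof.
move=> mf; apply: measurableT_comp => //; apply: continuous_measurable.
exact: sqrt_continuous.
Qed.

Lemma measurable_bigsum (I : Type) (s : seq I) (F : I -> T -> R) :
  (forall i, measurable_fun setT (F i)) ->
  measurable_fun setT (fun w => \sum_(i <- s) F i w).
Proof.
move=> mF; elim: s => [|i s ih].
  by under eq_fun do rewrite big_nil; exact: measurable_cst.
by under eq_fun do rewrite big_cons; exact: measurable_funD.
Qed.

Lemma measurable_bigprod (I : Type) (s : seq I) (F : I -> T -> R) :
  (forall i, measurable_fun setT (F i)) ->
  measurable_fun setT (fun w => \prod_(i <- s) F i w).
Proof.
move=> mF; elim: s => [|i s ih].
  by under eq_fun do rewrite big_nil; exact: measurable_cst.
by under eq_fun do rewrite big_cons; exact: measurable_funM.
Qed.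

Lemma mmx_mul m n p (M : T -> 'M[R]_(m, n)) (N : T -> 'M[R]_(n, p)) :
  mmx M -> mmx N -> mmx (fun w => M w *m N w).
Proof.
move=> mM mN i j; under eq_fun do rewrite mxE.
by apply: measurable_bigsum => k; exact: measurable_funM.
Qed.

Lemma mmxD m n (M N : T -> 'M[R]_(m, n)) :
  mmx M -> mmx N -> mmx (fun w => M w + N w).
Proof. by move=> mM mN i j; under eq_fun do rewrite mxE; exact: measurable_funD. Qed.

Lemma mmxB m n (M N : T -> 'M[R]_(m, n)) :
  mmx M -> mmx N -> mmx (fun w => M w - N w).
Proof. by move=> mM mN i j; under eq_fun do rewrite !mxE; exact: measurable_funB. Qed.

Lemma mmxZ m n (f : T -> R) (M : T -> 'M[R]_(m, n)) :
  measurable_fun setT f -> mmx M -> mmx (fun w => f w *: M w).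
Proof. by move=> mf mM i j; under eq_fun do rewrite mxE; exact: measurable_funM. Qed.

Lemma mmx_tr m n (M : T -> 'M[R]_(m, n)) : mmx M -> mmx (fun w => (M w)^T).
Proof. by move=> mM i j; under eq_fun do rewrite mxE; exact: mM. Qed.

Lemma mmx_cst m n (A : 'M[R]_(m, n)) : mmx (fun=> A).
Proof. by move=> i j; exact: measurable_cst. Qed.

Lemma mmx_sum m n (I : Type) (s : seq I) (F : I -> T -> 'M[R]_(m, n)) :
  (forall i, mmx (F i)) -> mmx (fun w => \sum_(i <- s) F i w).
Proof.
move=> mF i j; under eq_fun do rewrite summxE.
by apply: measurable_bigsum => k; exact: mF.
Qed.

Lemma measurable_det n (M : T -> 'M[R]_n) : mmx M ->
  measurable_fun setT (fun w => \det (M w)).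
Proof.
move=> mM; rewrite /determinant; apply: measurable_bigsum => s.
by apply: measurable_funM => //; apply: measurable_bigprod => i; exact: mM.
Qed.

Lemma mmx_adj n (M : T -> 'M[R]_n) : mmx M -> mmx (fun w => \adj (M w)).
Proof.
move=> mM i j; under eq_fun do rewrite mxE /cofactor.
apply: measurable_funM => //; apply: measurable_det => k l.
by under eq_fun do rewrite !mxE; exact: mM.
Qed.

Lemma mmx_if m n (b : T -> bool) (M N : T -> 'M[R]_(m, n)) :
  measurable_fun setT b -> mmx M -> mmx N -> mmx (fun w => if b w then M w else N w).
Proof.
move=> mb mM mN i j.
have -> : (fun w => (if b w then M w else N w) i j) =
  (fun w => if b w then M w i j else N w i j) by apply/funext => w; case: (b w).
exact: measurable_fun_ifT.
Qed.

Lemma measurable_unitmx n (M : T -> 'M[R]_n) : mmx M ->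
  measurable_fun setT (fun w => M w \in unitmx).
Proof.
move=> mM; have -> : (fun w => M w \in unitmx) = (fun w => ~~ (\det (M w) == 0)).
  by apply/funext => w; rewrite unitmxE unitfE.
apply: (measurableT_comp (f := negb)) => //.
by apply: measurable_fun_eqr => //; exact: measurable_det.
Qed.

Lemma mmx_sqrt_iter n (N : T -> 'M[R]_n) k : mmx N -> mmx (fun w => sqrt_iter (N w) k).
Proof.
move=> mN; elim: k => [|k ih] /=; first exact: mmx_cst.
by apply: mmxZ => //; apply: mmxD => //; exact: mmx_mul.
Qed.

(** The root is an entrywise limit of polynomial iterates; positive definiteness at every [w]
    ensures that the limit exists there. *)
Lemma mmx_pd_sqrt n (A : T -> 'M[R]_n) : mmx A -> (forall w, sympd (A w)) ->
  mmx (fun w => pd_sqrt (A w)).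
Proof.
move=> mA pA.
have ms : measurable_fun setT (fun w => sqrt_scale (A w)).
  apply: measurable_funD => //; apply: measurable_bigsum => i.
  by apply: measurable_bigsum => j; exact: measurableT_comp.
rewrite /pd_sqrt; apply: mmxZ; first exact: measurable_sqrt.
apply: mmxB; first exact: mmx_cst.
have mN : mmx (fun w => 1%:M - (sqrt_scale (A w))^-1 *: A w).
  by apply: mmxB; [exact: mmx_cst|apply: mmxZ => //; exact: measurable_inv].
move=> i j; apply: (measurable_fun_cvg (h := fun k w =>
  sqrt_iter (1%:M - (sqrt_scale (A w))^-1 *: A w) k i j)).
  by move=> k; exact: (mmx_sqrt_iter k mN).
move=> w _; have [r [r0 r1 hN]] := pd_contraction (pA w).
exact: sqrt_iter_cvg r0 r1 hN.
Qed.

(* Off the invertible matrices the argument is replaced by 1, to stay within the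
   positive definite ones. *)
Lemma mmx_invsqrt n (S : T -> 'M[R]_n) : mmx S -> (forall w, psd (S w)) ->
  mmx (fun w => invsqrtmx (S w)).
Proof.
move=> mS pS; pose A w := if S w \in unitmx then (\det (S w))^-1 *: \adj (S w) else 1%:M.
have pA w : sympd (A w).
  rewrite /A; case: ifPn => Su.
    have -> : (\det (S w))^-1 *: \adj (S w) = invmx (S w) by rewrite /invmx Su.
    exact/pd_inv/psd_unit_pd.
  split; first by rewrite trmx1.
  move=> v v0; rewrite mul1mx lt_neqAle dotvv_ge0 andbT eq_sym.
  by apply: contra v0 => /eqP /dotvv_eq0 ->.
have mA : mmx A.
  apply: mmx_if; [exact: measurable_unitmx| |exact: mmx_cst].
  apply: mmxZ; last exact: mmx_adj.
  exact/measurable_inv/measurable_det.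
have -> : (fun w => invsqrtmx (S w)) =
    (fun w => if S w \in unitmx then pd_sqrt (A w) else 0).
  apply/funext => w; rewrite /A; case: ifPn => Su; last exact: invsqrtmx_singular.
  by rewrite invsqrtmx_pd; [rewrite /invmx Su|exact: psd_unit_pd].
by apply: mmx_if; [exact: measurable_unitmx|exact: mmx_pd_sqrt|exact: mmx_cst].
Qed.

End measurable_matrices.

(** * Lebesgue measure on R^d: Gaussian integrals and reflection *)

Section lebesgue_facts.
Context (R : realType).
Local Notation lam := (@lebesgue_measure R).

Lemma measurable_enorm d : measurable_fun setT (@enorm R d).
Proof.
apply: measurable_sqrt; under eq_fun do rewrite dotvE.
by apply: measurable_bigsum => i; apply: measurable_funM; exact: measurable_coord.
Qed.

Lemma measurable_expsq d (b : R) :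
  measurable_fun setT (fun t : 'cV[R]_d => expR (- b * enorm t ^+ 2)).
Proof.
apply: measurableT_comp => //; apply: measurable_funM => //.
by apply: measurable_funX; exact: measurable_enorm.
Qed.

Lemma enorm_cv_cons d (p : measurableTypeR R * 'cV[R]_d) :
  enorm (cv_cons p) ^+ 2 = p.1 ^+ 2 + enorm p.2 ^+ 2.
Proof.
rewrite !enorm_sqr !dotvE; rewrite (@big_split_ord _ _ _ 1 d)/= big_ord1.
rewrite /cv_cons; congr (_ + _).
  have e1 : col_mx (p.1)%:M p.2 (lshift d ord0) ord0 = p.1.
    by apply: etrans (col_mxEu (p.1)%:M p.2 ord0 ord0) _; rewrite mxE eqxx.
  by rewrite expr2; congr (_ * _); exact: e1.
apply: eq_bigr => i _.
have e1 : col_mx (p.1)%:M p.2 (rshift 1 i) ord0 = p.2 i ord0.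
  exact: (col_mxEd (p.1)%:M p.2 i ord0).
by congr (_ * _); exact: e1.
Qed.

Lemma intg_cons d (f : 'cV[R]_d.+1 -> R) : measurable_fun setT f ->
  (lam \x lebesgue_cV d)%E.-integrable setT (EFin \o (fun p => f (cv_cons p))) ->
  intg (lebesgue_cV d.+1) f.
Proof.
move=> mf hf; apply: (integrable_pushforward (@measurable_cv_cons R d)) => //.
exact/measurable_EFinP.
Qed.

Lemma intg_gauss1 (b : R) : 0 < b -> intg lam (fun x => expR (- b * x ^+ 2)).
Proof.
(* With s^2 = 1 / (2b) the function is the density of N(0, s^2) up to its peak value. *)
move=> b0; pose s : R := Num.sqrt (2 * b)^-1.
have b20 : 0 < (2 * b)^-1 by rewrite invr_gt0 mulr_gt0.
have s0 : s != 0 by rewrite gt_eqF// sqrtr_gt0.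
apply: eq_intg (intgZ (normal_peak s)^-1 (integrable_normal_pdf 0 s)) => x.
rewrite normal_pdfE// mulrA mulVf ?mul1r; last by rewrite gt_eqF// normal_peak_gt0.
rewrite /normal_fun subr0 sqr_sqrtr ?(ltW b20)//; congr expR.
by rewrite -(mulr_natr (2 * b)^-1 2); field; rewrite gt_eqF.
Qed.

Lemma intg_gauss d (b : R) : 0 < b ->
  intg (lebesgue_cV d) (fun t : 'cV[R]_d => expR (- b * enorm t ^+ 2)).
Proof.
move=> b0; elim: d => [|d ih].
  apply: intg_ge0 => [|t|]; [exact: measurable_expsq|exact: expR_ge0|].
  have mE : measurable_fun setT (fun t : 'cV[R]_0 => (expR (- b * enorm t ^+ 2))%:E).
    by apply/measurable_EFinP; exact: measurable_expsq.
  by rewrite [X in (X < _)%E](integral_dirac (0 : 'cV[R]_0) measurableT mE) diracT mul1e ltry.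
apply: intg_cons; first exact: measurable_expsq.
have mk : measurable_fun setT (fun p : measurableTypeR R * 'cV[R]_d =>
    expR (- b * enorm (cv_cons p) ^+ 2)).
  by apply: (measurableT_comp (measurable_expsq b)); exact: measurable_cv_cons.
apply: (dom_intg12 mk _ (intg_gauss1 b0) ih) => x y.
by rewrite enorm_cv_cons ger0_norm ?expR_ge0// -expRD mulrDr.
Qed.

Lemma measurable_opp_cV d : measurable_fun setT (fun t : 'cV[R]_d => - t).
Proof.
apply: measurable_fun_mx => i j; under eq_fun do rewrite mxE.
by apply: measurable_funN; exact: measurable_coord.
Qed.

(** By induction on [d]: the image of the product measure under the reflection [phi] of both factors
    agrees with it on rectangles, hence everywhere. *)
Lemma lebesgue_cV_opp d (A : set 'cV[R]_d) : measurable A ->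
  pushforward (lebesgue_cV d) (fun t : 'cV[R]_d => - t) A = lebesgue_cV d A.
Proof.
elim: d A => [|d ih] A mA.
  have tN (t : 'cV[R]_0) : - t = t by rewrite [LHS]flatmx0 [RHS]flatmx0.
  rewrite /pushforward; congr (lebesgue_cV 0 _).
  by apply/seteqP; split => t; rewrite /preimage/= tN.
pose phi (p : measurableTypeR R * 'cV[R]_d) : measurableTypeR R * 'cV[R]_d := (- p.1, - p.2).
have mphi : measurable_fun setT phi.
  apply/measurable_fun_pairP; split.
    by apply: measurable_funN.
  exact: (measurableT_comp (@measurable_opp_cV d)).
have consN p : cv_cons (phi p) = - cv_cons p.
  rewrite /cv_cons /phi/= raddfN/=.
  by rewrite -opp_col_mx.
pose m' : {measure set (measurableTypeR R * 'cV[R]_d) -> \bar R} :=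
  measure_function_pushforward__canonical__measure_function_Measure
    (lam \x lebesgue_cV d)%E mphi.
have m'E (B : set (measurableTypeR R * 'cV[R]_d)) : measurable B ->
    (lam \x lebesgue_cV d)%E B = m' B.
  apply: product_measure_unique => C D mC mD.
  pose opp1 (x : measurableTypeR R) : measurableTypeR R := - (x : R).
  pose opp2 (t : 'cV[R]_d) : 'cV[R]_d := - t.
  transitivity (lam (opp1 @^-1` C) * lebesgue_cV d (opp2 @^-1` D))%E; last first.
    by congr (_ * _)%E; [exact: lebesgue_measureN|exact: ih].
  apply: (@product_measure1E _ _ _ _ _ lam (lebesgue_cV d)).
    rewrite -[X in measurable X]setTI.
    exact: (measurable_funN (@measurable_id _ (measurableTypeR R) setT)).
  by rewrite -[X in measurable X]setTI; exact: measurable_opp_cV.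
rewrite /= /lebesgue_cons /pushforward m'E; last first.
  have mopp : measurable ((fun t : 'cV[R]_d.+1 => - t : 'cV[R]_d.+1) @^-1` A).
    by rewrite -[X in measurable X]setTI; exact: measurable_opp_cV.
  by rewrite -[X in measurable X]setTI; exact: (@measurable_cv_cons R d _ _ mopp).
rewrite /m' /= /pushforward; congr ((_ \x _)%E _).
by apply/seteqP; split => p; rewrite /preimage/= consN ?opprK.
Qed.

Lemma Rint_odd d (f : 'cV[R]_d -> R) : intg (lebesgue_cV d) f ->
  (forall t, f (- t) = - f t) -> \int[lebesgue_cV d]_t f t = 0.
Proof.
move=> hf fN; have mf := intg_measurable hf.
have e : \int[lebesgue_cV d]_t f t = \int[lebesgue_cV d]_t f (- t).
  apply: EFin_inj; rewrite -!RintE//; last first.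
    by apply: eq_intg (intgN hf) => t; rewrite fN.
  pose opp2 (t : 'cV[R]_d) : 'cV[R]_d := - t.
  transitivity (\int[pushforward (lebesgue_cV d) opp2]_x (f x)%:E)%E.
    apply/esym; apply: eq_measure_integral; first exact: measurable_opp_cV.
    by move=> mopp A mA _; exact: lebesgue_cV_opp.
  rewrite (integral_pushforward (phi := opp2) (@measurable_opp_cV d))//.
    exact/measurable_EFinP.
  have : intg (lebesgue_cV d) (fun t => - f t) by exact: intgN.
  by apply: eq_integrable => // t _; rewrite /= fN.
have : \int[lebesgue_cV d]_t f (- t) = - \int[lebesgue_cV d]_t f t.
  rewrite -mulN1r -RintZ//; apply: eq_Rint => t; by rewrite fN mulN1r.
by rewrite -e => h; lra.
Qed.

(** All bounds are stated in powers of this function: being at least 1 it is monotone in the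
    exponent, and its square is integrable when fourth moments are finite. *)
Definition growth d (t : 'cV[R]_d) : R := 1 + enorm t ^+ 2.

Lemma growth_ge1 d (t : 'cV[R]_d) : 1 <= growth t.
Proof. by rewrite lerDl sqr_ge0. Qed.

Lemma measurable_growth d : measurable_fun setT (@growth d).
Proof. by apply: measurable_funD => //; apply: measurable_funX; exact: measurable_enorm. Qed.

Lemma measurable_weight d (a : R) : measurable_fun setT (@weight R d a).
Proof. exact: measurable_expsq. Qed.

(** One term of the exponential series bounds [growth t ^+ k.+1] by a multiple of exp((a/2) growth),
    which uses up half of the exponent of the weight; the other half is an integrable Gaussian. *)
Lemma intg_growth_weight d (a : R) k : 0 < a ->
  intg (lebesgue_cV d) (fun t => growth t ^+ k * weight a t).
Proof.
move=> a0; have a20 : 0 < a / 2 by rewrite divr_gt0.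
pose C : R := k.+1`!%:R / (a / 2) ^+ k.+1 * expR (a / 2).
apply: intg_dom (intgZ C (intg_gauss d a20)) _ => [|t].
  apply: measurable_funM; last exact: measurable_weight.
  by apply: measurable_funX; exact: measurable_growth.
have g1 := growth_ge1 t; have g0 : 0 <= growth t by apply: le_trans g1.
rewrite ger0_norm; last by rewrite mulr_ge0 ?exprn_ge0 ?expR_ge0.
have gk : growth t ^+ k <= growth t ^+ k.+1 by rewrite exprS ler_peMl ?exprn_ge0.
apply: (@le_trans _ _ (growth t ^+ k.+1 * weight a t)).
  by rewrite ler_wpM2r ?expR_ge0.
have h : growth t ^+ k.+1 <= k.+1`!%:R / (a / 2) ^+ k.+1 * expR (a / 2 * growth t).
  have := expR_ge1Dxn k (mulr_ge0 (ltW a20) g0); rewrite exprMn => h.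
  rewrite mulrAC ler_pdivlMr ?exprn_gt0//.
  have f0 : 0 < k.+1`!%:R :> R by rewrite ltr0n fact_gt0.
  have := ler_wpM2l (ltW f0) h; rewrite mulrDr mulrCA mulfV ?gt_eqF// mulr1.
  by move: (growth t ^+ k.+1) ((a / 2) ^+ k.+1) (expR _) => x y z; lra.
apply: (le_trans (ler_wpM2r (expR_ge0 _) h)).
rewrite /C; set K := _ / _; have K0 : 0 <= K by rewrite divr_ge0 ?exprn_ge0 ?(ltW a20).
clearbody K; rewrite -!mulrA -!expRD ler_wpM2l// ler_expR /growth; lra.
Qed.

End lebesgue_facts.

(** * Differentiation of trigonometric sums and means *)

Section directional.
Context (R : realType) (d : nat).
Implicit Types (t x : 'cV[R]_d).

(** A quadratic bound on the increment identifies the directional derivative. Such a bound can be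
    summed and integrated, so sums and means are differentiated by the same argument. *)
Lemma pderiv_quadratic (f : 'cV[R]_d -> R) (i : 'I_d) t (D C : R) :
  (forall h, `|f (h *: delta_mx i ord0 + t) - f t - h * D| <= C * h ^+ 2) ->
  pderiv i f t = D.
Proof.
move=> hf; rewrite /pderiv /derive; apply: cvg_lim => //.
have C0 : 0 <= C by have := hf 1; rewrite expr1n mulr1; apply: le_trans.
apply/cvgrPdist_le => e e0; near=> h.
have h0 : h != 0 by near: h; exact: nbhs_dnbhs_neq.
rewrite distrC.
have -> : h^-1 *: (f (h *: delta_mx i ord0 + t) - f t) - D =
    h^-1 * (f (h *: delta_mx i ord0 + t) - f t - h * D).
  by rewrite mulrBr mulKf.
rewrite normrM normfV ler_pdivrMl ?normr_gt0//.
apply: le_trans (hf h) _.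
have -> : h ^+ 2 = `|h| * `|h| by rewrite -expr2 real_normK ?num_real.
rewrite mulrCA ler_wpM2l//.
have : `|h| <= e / (C + 1).
  near: h; apply/nbhs_dnbhs; apply/nbhs_ballP; exists (e / (C + 1)) => /=.
    by rewrite divr_gt0// ltr_wpDl.
  by move=> y /=; rewrite /ball/= sub0r normrN => /ltW.
move=> h1; apply: (@le_trans _ _ ((C + 1) * (e / (C + 1)))).
  by rewrite ler_pM// lerDl.
by rewrite mulrC divfK// gt_eqF// ltr_wpDl.
Unshelve. all: by end_near. Qed.

Definition CSminus (y : R) : R := cos y - sin y.

Lemma CSplus_le2 (y : R) : `|CSplus y| <= 2.
Proof. by rewrite (le_trans (ler_normD _ _))// [2]mulr2n lerD ?cos_le1 ?sin_le1. Qed.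

Lemma CSminus_le2 (y : R) : `|CSminus y| <= 2.
Proof. by rewrite (le_trans (ler_normB _ _))// [2]mulr2n lerD ?cos_le1 ?sin_le1. Qed.

(* [p1] is the derivative of [p], which is cos, sin or a combination of both. *)
Definition trig (p p1 : R -> R) := [/\ measurable_fun setT p, measurable_fun setT p1,
  forall y, `|p y| <= 2, forall y, `|p1 y| <= 2 &
  forall u v, `|p (u + v) - p u - p1 u * v| <= 2 * v ^+ 2].

Lemma trig_opp p p1 : trig p p1 -> trig (fun y => - p y) (fun y => - p1 y).
Proof.
move=> [m0 m1 b0 b1 t]; split.
- exact: measurable_funN.
- exact: measurable_funN.
- by move=> y; rewrite normrN.
- by move=> y; rewrite normrN.
- by move=> u v; have := t u v; rewrite -normrN mulNr opprB opprB; congr (`|_| <= _); ring.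
Qed.

Lemma measurable_cos : measurable_fun setT (@cos R).
Proof. apply: continuous_measurable; exact: continuous_cos. Qed.

Lemma measurable_sin : measurable_fun setT (@sin R).
Proof. apply: continuous_measurable; exact: continuous_sin. Qed.

Lemma measurable_CSplus : measurable_fun setT (@CSplus R).
Proof. by apply: measurable_funD; [exact: measurable_cos|exact: measurable_sin]. Qed.

Lemma measurable_CSminus : measurable_fun setT CSminus.
Proof. by apply: measurable_funB; [exact: measurable_cos|exact: measurable_sin]. Qed.

Lemma trig_cos : trig (@cos R) (fun y => - sin y).
Proof.
split; [exact: measurable_cos| |move=> y|move=> y|move=> u v].
- by apply: measurable_funN; exact: measurable_sin.
- by rewrite (le_trans (cos_le1 y))// ler1n.
- by rewrite normrN (le_trans (sin_le1 y))// ler1n.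
- rewrite mulNr opprK (le_trans (cos_taylor u v))//.
  by have := sqr_ge0 v; lra.
Qed.

Lemma trig_sin : trig (@sin R) (@cos R).
Proof.
split; [exact: measurable_sin|exact: measurable_cos|move=> y|move=> y|move=> u v].
- by rewrite (le_trans (sin_le1 y))// ler1n.
- by rewrite (le_trans (cos_le1 y))// ler1n.
- rewrite (le_trans (sin_taylor u v))//.
  by have := sqr_ge0 v; lra.
Qed.

Lemma trig_CSplus : trig (@CSplus R) CSminus.
Proof.
split; [exact: measurable_CSplus|exact: measurable_CSminus|exact: CSplus_le2|
  exact: CSminus_le2|move=> u v].
have := cos_taylor u v; have := sin_taylor u v; rewrite /CSplus /CSminus !ler_norml.
by move=> /andP[? ?] /andP[? ?]; apply/andP; split; lra.
Qed.

Lemma trig_CSminus : trig CSminus (fun y => - CSplus y).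
Proof.
split; [exact: measurable_CSminus|apply: measurable_funN; exact: measurable_CSplus
  |exact: CSminus_le2|by move=> y; rewrite normrN; exact: CSplus_le2|move=> u v].
have := cos_taylor u v; have := sin_taylor u v; rewrite /CSplus /CSminus !ler_norml.
by move=> /andP[? ?] /andP[? ?]; apply/andP; split; lra.
Qed.

Lemma dotv_delta h (i : 'I_d) t x :
  dotv (h *: delta_mx i ord0 + t) x = dotv t x + h * x i ord0.
Proof.
rewrite dotvDl dotvZl addrC; congr (_ + _ * _).
rewrite dotvE (bigD1 i)//= big1 ?addr0; first by rewrite !mxE !eqxx mul1r.
by move=> j ji; rewrite !mxE (negbTE ji) mul0r.
Qed.

Lemma pderiv_trig_sum (n : nat) (c : nat -> R) (y : nat -> 'cV[R]_d) p p1 i t :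
  trig p p1 ->
  pderiv i (fun t => \sum_(1 <= j < n.+1) c j * p (dotv t (y j))) t =
  \sum_(1 <= j < n.+1) c j * y j i ord0 * p1 (dotv t (y j)).
Proof.
move=> [_ _ _ _ tr]; apply: (pderiv_quadratic
  (C := \sum_(1 <= j < n.+1) `|c j| * (2 * y j i ord0 ^+ 2))) => h.
rewrite mulr_sumr -sumrB -sumrB mulr_suml.
apply: le_trans (ler_norm_sum _ _ _) _; apply: ler_sum => j _.
rewrite dotv_delta.
have -> : c j * p (dotv t (y j) + h * y j i ord0) - c j * p (dotv t (y j)) -
    h * (c j * y j i ord0 * p1 (dotv t (y j))) =
  c j * (p (dotv t (y j) + h * y j i ord0) - p (dotv t (y j)) -
    p1 (dotv t (y j)) * (h * y j i ord0)) by ring.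
rewrite normrM -mulrA ler_wpM2l//; apply: le_trans (tr _ _) _.
by rewrite exprMn mulrCA mulrA -mulrA [h ^+ 2 * _]mulrC mulrA.
Qed.

Lemma coord_le_growth x (i : 'I_d) : `|x i ord0| <= growth x.
Proof.
apply: le_trans (coord_le_enorm x i) _; rewrite /growth.
by have := sqr_ge0 (enorm x - 1); have := sqr_ge0 (enorm x); nra.
Qed.

Lemma coord2_le_growth x (i j : 'I_d) : `|x i ord0 * x j ord0| <= growth x.
Proof.
rewrite normrM; apply: le_trans (ler_pM _ _ (coord_le_enorm x i) (coord_le_enorm x j)) _ => //.
by rewrite -expr2 lerDr.
Qed.

Lemma growth_ge0 x : 0 <= growth x. Proof. exact: le_trans (growth_ge1 x). Qed.

Lemma measurable_dotvr t : measurable_fun setT (fun x : 'cV[R]_d => dotv t x).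
Proof.
under eq_fun do rewrite dotvE; apply: measurable_bigsum => i.
by apply: measurable_funM => //; exact: measurable_coord.
Qed.

Variable mu : probability 'cV[R]_d R.

(** Differentiation under the integral: the Taylor bound of [p] is integrated, the integrable factor
    being [|q x| * growth x]. *)
Lemma pderiv_trig_mean (q : 'cV[R]_d -> R) p p1 i t :
  trig p p1 -> measurable_fun setT q -> intg mu (fun x => `|q x| * growth x) ->
  pderiv i (fun t => \int[mu]_x (q x * p (dotv t x))) t =
  \int[mu]_x (q x * x i ord0 * p1 (dotv t x)).
Proof.
move=> [m0 m1 b0 b1 tr] mq iq.
have i0 s : intg mu (fun x => q x * p (dotv s x)).
  apply: intg_dom (intgZ 2 iq) _ => [|x].
    by apply: measurable_funM => //; apply: measurableT_comp => //; exact: measurable_dotvr.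
  rewrite normrM mulrC -mulrCA mulrC; apply: ler_pM => //.
  by rewrite (le_trans (b0 _))// ler_peMr// growth_ge1.
have i1 : intg mu (fun x => q x * x i ord0 * p1 (dotv t x)).
  apply: intg_dom (intgZ 2 iq) _ => [|x].
    apply: measurable_funM; last by apply: measurableT_comp => //; exact: measurable_dotvr.
    by apply: measurable_funM => //; exact: measurable_coord.
  rewrite !normrM (mulrC 2); apply: ler_pM => //.
  by apply: ler_wpM2l => //; exact: coord_le_growth.
apply: (pderiv_quadratic (C := \int[mu]_x (2 * (`|q x| * growth x)))) => h.
rewrite -RintZ// -RintB// -RintB; [|exact: intgB|exact: intgZ].
rewrite mulrC -RintZ; last exact: intgZ.
apply: Rint_norm_le.
- by apply: intgB; [exact: intgB|exact: intgZ].
- by do 2 apply: intgZ.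
- move=> x; rewrite dotv_delta.
have -> : q x * p (dotv t x + h * x i ord0) - q x * p (dotv t x) -
    h * (q x * x i ord0 * p1 (dotv t x)) =
  q x * (p (dotv t x + h * x i ord0) - p (dotv t x) -
    p1 (dotv t x) * (h * x i ord0)) by ring.
rewrite normrM; apply: le_trans (ler_wpM2l _ (tr _ _)) _ => //.
have -> : `|q x| * (2 * (h * x i ord0) ^+ 2) = h ^+ 2 * (2 * (`|q x| * x i ord0 ^+ 2)) by ring.
rewrite ler_wpM2l ?sqr_ge0// ler_wpM2l// ler_wpM2l//.
by apply: le_trans (ler_norm _) _; rewrite expr2; exact: coord2_le_growth.
Qed.

End directional.

(** * The limit quantities as integrals *)

Section limit_formulas.
Context (R : realType) (d : nat) dT (T : measurableType dT) (P : probability T R).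
Variable X : {RV P >-> 'cV[R]_d}.
Let mu : probability _ R := distribution P X.
Hypothesis i4 : intg mu (fun x => growth x ^+ 2).
Implicit Types (x y t : 'cV[R]_d).

Lemma intg_growth2 (C : R) (f : 'cV[R]_d -> R) : measurable_fun setT f ->
  (forall x, `|f x| <= C * growth x ^+ 2) -> intg mu f.
Proof. by move=> mf fC; apply: intg_dom (intgZ C i4) fC. Qed.

Lemma expectE (f : 'cV[R]_d -> R) : measurable_fun setT f -> intg mu f ->
  expect P (fun w => f (X w)) = \int[mu]_x f x.
Proof.
move=> mf hf; rewrite /expect unlock; apply/esym.
by apply: (Rint_distr (Y := X) mf); apply/intg_distr.
Qed.

Definition gfun x t : R := (enorm x ^+ 2 + enorm t ^+ 2 - d%:R) * CSplus (dotv t x).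

(* [dgfun i x t] is the partial derivative of [gfun x t] in the i-th coordinate of [x]. *)
Definition dgfun (i : 'I_d) x t : R := 2 * x i ord0 * CSplus (dotv t x) +
  (enorm x ^+ 2 + enorm t ^+ 2 - d%:R) * t i ord0 * CSminus (dotv t x).

Let coordm (i : 'I_d) : measurable_fun setT (fun x : 'cV[R]_d => x i ord0).
Proof. exact: measurable_coord. Qed.

Let enorm2m : measurable_fun setT (fun x : 'cV[R]_d => enorm x ^+ 2).
Proof. by apply: measurable_funX; exact: measurable_enorm. Qed.

Let trigm (p : R -> R) t : measurable_fun setT p ->
  measurable_fun setT (fun x => p (dotv t x)).
Proof. by move=> mp; apply: measurableT_comp => //; exact: measurable_dotvr. Qed.

Lemma growth_sqr_ge (x : 'cV[R]_d) : growth x <= growth x ^+ 2.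
Proof. by rewrite expr2 ler_peMr ?growth_ge0// growth_ge1. Qed.

Lemma enorm2_le_growth (x : 'cV[R]_d) : enorm x ^+ 2 <= growth x.
Proof. by rewrite lerDr. Qed.

(** Coefficients that leave room for one more coordinate: times a coordinate and a bounded
    trigonometric factor they stay of order [growth x ^+ 2], so one differentiation under the
    integral is allowed. *)
Let moment (q : 'cV[R]_d -> R) := measurable_fun setT q /\ forall x, `|q x| <= growth x.

Let moment1 : moment (fun=> 1).
Proof. by split => // x; rewrite normr1 growth_ge1. Qed.

Let moment_coord i : moment (fun x => x i ord0).
Proof. by split => // x; exact: coord_le_growth. Qed.

Let moment_coord2 i j : moment (fun x => x i ord0 * x j ord0).
Proof. by split => [|x]; [exact: measurable_funM|exact: coord2_le_growth]. Qed.

Let moment_sqr : moment (fun x => enorm x ^+ 2).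
Proof. by split => // x; rewrite ger0_norm ?sqr_ge0// enorm2_le_growth. Qed.

Let moment_sqrN : moment (fun x => - enorm x ^+ 2).
Proof.
by split => [|x]; [exact: measurable_funN|rewrite normrN; exact: moment_sqr.2].
Qed.

Let intg_moment q p p1 t : moment q -> trig p p1 -> intg mu (fun x => q x * p (dotv t x)).
Proof.
move=> [mq bq] [mp _ bp _ _]; apply: (intg_growth2 (C := 2)) => [|x].
  by apply: measurable_funM => //; exact: trigm.
rewrite normrM mulrC; apply: ler_pM => //.
by apply: le_trans (bq x) _; exact: growth_sqr_ge.
Qed.

Let intg_moment1 q i p p1 t : moment q -> trig p p1 ->
  intg mu (fun x => q x * x i ord0 * p (dotv t x)).
Proof.
move=> [mq bq] [mp _ bp _ _]; apply: (intg_growth2 (C := 2)) => [|x].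
  by apply: measurable_funM => //; [exact: measurable_funM|exact: trigm].
rewrite !normrM mulrC; apply: ler_pM => //.
by rewrite expr2; apply: ler_pM => //; exact: coord_le_growth.
Qed.

Let pderivF q p p1 i t : moment q -> trig p p1 ->
  pderiv i (fun t => \int[mu]_x (q x * p (dotv t x))) t =
  \int[mu]_x (q x * x i ord0 * p1 (dotv t x)).
Proof.
move=> [mq bq] tp; apply: pderiv_trig_mean => //.
apply: (intg_growth2 (C := 1)) => [|x].
  by apply: measurable_funM; [exact: measurableT_comp|exact: measurable_growth].
rewrite mul1r normrM normr_id (ger0_norm (growth_ge0 x)) expr2.
by rewrite ler_wpM2r ?growth_ge0.
Qed.

Let oneF p t : \int[mu]_x (1 * p (dotv t x)) = \int[mu]_x p (dotv t x).
Proof. by apply: eq_Rint => x; rewrite mul1r. Qed.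

Let sumF (p : R -> R) p1 t : trig p p1 ->
  \sum_(i < d) \int[mu]_x (x i ord0 * x i ord0 * p (dotv t x)) =
  \int[mu]_x (enorm x ^+ 2 * p (dotv t x)).
Proof.
move=> tp; rewrite -Rint_sum; last by move=> i; exact: (intg_moment _ (moment_coord2 i i) tp).
by apply: eq_Rint => x; rewrite -mulr_suml; congr (_ * _); rewrite enorm_sqr dotvE.
Qed.

Lemma psi_plusE t : psi_plus P X t = \int[mu]_x (1 * CSplus (dotv t x)).
Proof.
have ic := intg_moment t moment1 (trig_cos R); have js := intg_moment t moment1 (trig_sin R).
have i1 : intg mu (fun x => cos (dotv t x)) by apply: eq_intg ic => x; rewrite mul1r.
have i2 : intg mu (fun x => sin (dotv t x)) by apply: eq_intg js => x; rewrite mul1r.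
rewrite oneF /psi_plus (expectE (intg_measurable i1) i1).
rewrite (expectE (intg_measurable i2) i2).
by rewrite -RintD.
Qed.

Lemma psi_minusE t : psi_minus P X t = \int[mu]_x (1 * CSminus (dotv t x)).
Proof.
have ic := intg_moment t moment1 (trig_cos R); have js := intg_moment t moment1 (trig_sin R).
have i1 : intg mu (fun x => cos (dotv t x)) by apply: eq_intg ic => x; rewrite mul1r.
have i2 : intg mu (fun x => sin (dotv t x)) by apply: eq_intg js => x; rewrite mul1r.
rewrite oneF /psi_minus (expectE (intg_measurable i1) i1).
rewrite (expectE (intg_measurable i2) i2).
by rewrite -RintB.
Qed.

Let tCS := @trig_CSplus R.
Let tCM := @trig_CSminus R.
Let tNCS := trig_opp tCS.

Let dpsi_plus i : pderiv i (psi_plus P X) =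
  fun t => \int[mu]_x (x i ord0 * CSminus (dotv t x)).
Proof.
apply/funext => t; have -> : psi_plus P X = fun t => \int[mu]_x (1 * CSplus (dotv t x)).
  by apply/funext => s; exact: psi_plusE.
by rewrite (pderivF i t moment1 tCS); apply: eq_Rint => x; rewrite mul1r.
Qed.

Let dpsi_minus i : pderiv i (psi_minus P X) =
  fun t => \int[mu]_x (x i ord0 * - CSplus (dotv t x)).
Proof.
apply/funext => t; have -> : psi_minus P X = fun t => \int[mu]_x (1 * CSminus (dotv t x)).
  by apply/funext => s; exact: psi_minusE.
by rewrite (pderivF i t moment1 tCM); apply: eq_Rint => x; rewrite mul1r.
Qed.

Let hess_plus i j t : pderiv i (pderiv j (psi_plus P X)) t =
  - \int[mu]_x (x i ord0 * x j ord0 * CSplus (dotv t x)).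
Proof.
rewrite dpsi_plus (pderivF i t (moment_coord j) tCM).
rewrite -mulN1r -RintZ; last exact: intg_moment (moment_coord2 i j) tCS.
by apply: eq_Rint => x; ring.
Qed.

Let lap_plus : laplacian (psi_plus P X) =
  fun t => \int[mu]_x (- enorm x ^+ 2 * CSplus (dotv t x)).
Proof.
apply/funext => t; rewrite /laplacian; under eq_bigr do rewrite hess_plus.
rewrite sumrN (sumF t tCS) -mulN1r -RintZ; last exact: intg_moment moment_sqr tCS.
by apply: eq_Rint => x; ring.
Qed.

Let dlap_plus i t : pderiv i (laplacian (psi_plus P X)) t =
  - \int[mu]_x (enorm x ^+ 2 * x i ord0 * CSminus (dotv t x)).
Proof.
rewrite lap_plus (pderivF i t moment_sqrN tCS) -mulN1r -RintZ.
  by apply: eq_Rint => x; ring.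
exact: intg_moment1 moment_sqr tCM.
Qed.

Let lap_minus t : laplacian (psi_minus P X) t =
  - \int[mu]_x (enorm x ^+ 2 * CSminus (dotv t x)).
Proof.
rewrite /laplacian.
have e i : pderiv i (pderiv i (psi_minus P X)) t =
    - \int[mu]_x (x i ord0 * x i ord0 * CSminus (dotv t x)).
  rewrite dpsi_minus (pderivF i t (moment_coord i) tNCS) -mulN1r -RintZ.
    by apply: eq_Rint => x; ring.
  exact: intg_moment (moment_coord2 i i) tCM.
by under eq_bigr do rewrite e; rewrite sumrN (sumF t tCM).
Qed.

(** Under the integral, minus the Laplacian multiplies by |x|^2, and the definition of [zfun]
    collapses to a single mean. *)
Lemma zfunE t : zfun P X t = \int[mu]_x gfun x t.
Proof.
have j1 := intg_moment t moment1 tCS; have j2 := intg_moment t moment_sqr tCS.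
rewrite /zfun lap_plus psi_plusE -RintZ//.
rewrite -(mulN1r (\int[mu]_x (- enorm x ^+ 2 * CSplus (dotv t x)))) -RintZ; last first.
  exact: intg_moment moment_sqrN tCS.
rewrite -RintD; [|by apply: intgZ; exact: intg_moment moment_sqrN tCS|exact: intgZ].
by apply: eq_Rint => x; rewrite /gfun; ring.
Qed.

Let intg_dg i t : intg mu (fun x => dgfun i x t) /\ \int[mu]_x dgfun i x t =
  2 * \int[mu]_x (x i ord0 * CSplus (dotv t x)) + t i ord0 *
   (\int[mu]_x (enorm x ^+ 2 * CSminus (dotv t x)) +
    (enorm t ^+ 2 - d%:R) * \int[mu]_x (1 * CSminus (dotv t x))).
Proof.
have j1 := intg_moment t (moment_coord i) tCS.
have j2 := intg_moment t moment_sqr tCM; have j3 := intg_moment t moment1 tCM.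
have e x : 2 * (x i ord0 * CSplus (dotv t x)) + t i ord0 *
    (enorm x ^+ 2 * CSminus (dotv t x) +
     (enorm t ^+ 2 - d%:R) * (1 * CSminus (dotv t x))) = dgfun i x t.
  by rewrite /dgfun; ring.
have j23 : intg mu (fun x => enorm x ^+ 2 * CSminus (dotv t x) +
     (enorm t ^+ 2 - d%:R) * (1 * CSminus (dotv t x))) by apply: intgD => //; exact: intgZ.
split; first by apply: eq_intg e _; apply: intgD; exact: intgZ.
under eq_Rintegral do rewrite -e.
rewrite RintD; [|exact: intgZ..].
by rewrite (RintZ _ j1) (RintZ _ j23) RintD ?(RintZ _ j3)//; exact: intgZ.
Qed.

Let intg_dgx i j t : intg mu (fun x => dgfun i x t * x j ord0) /\
  \int[mu]_x (dgfun i x t * x j ord0) =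
  2 * \int[mu]_x (x i ord0 * x j ord0 * CSplus (dotv t x)) + t i ord0 *
   (\int[mu]_x (enorm x ^+ 2 * x j ord0 * CSminus (dotv t x)) +
    (enorm t ^+ 2 - d%:R) * \int[mu]_x (x j ord0 * CSminus (dotv t x))).
Proof.
have j1 := intg_moment t (moment_coord2 i j) tCS.
have j2 := intg_moment1 j t moment_sqr tCM; have j3 := intg_moment t (moment_coord j) tCM.
have e x : 2 * (x i ord0 * x j ord0 * CSplus (dotv t x)) + t i ord0 *
    (enorm x ^+ 2 * x j ord0 * CSminus (dotv t x) +
     (enorm t ^+ 2 - d%:R) * (x j ord0 * CSminus (dotv t x))) = dgfun i x t * x j ord0.
  by rewrite /dgfun; ring.
have j23 : intg mu (fun x => enorm x ^+ 2 * x j ord0 * CSminus (dotv t x) +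
     (enorm t ^+ 2 - d%:R) * (x j ord0 * CSminus (dotv t x))).
  by apply: intgD => //; exact: intgZ.
split; first by apply: eq_intg e _; apply: intgD; exact: intgZ.
under eq_Rintegral do rewrite -e.
rewrite RintD; [|exact: intgZ..].
by rewrite (RintZ _ j1) (RintZ _ j23) RintD ?(RintZ _ j3)//; exact: intgZ.
Qed.

(** Identifies the closed formula with the outcome of a first-order expansion. The means of
    [dgfun i y t * y j ord0] multiply the covariance error, with the factor -1/2 of the inverse
    square root, and the means of [dgfun i y t] multiply the sample mean; both are expressed by
    derivatives of [psi_plus] and [psi_minus]. *)
Lemma hstarE x t : hstar P X x t = gfun x t - zfun P X t
  - 2^-1 * \sum_i \sum_j (\int[mu]_y (dgfun i y t * y j ord0)) *
      (x i ord0 * x j ord0 - (i == j)%:R)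
  - \sum_i (\int[mu]_y dgfun i y t) * x i ord0.
Proof.
rewrite /hstar; set q := enorm t ^+ 2 - d%:R.
pose A i j := \int[mu]_y (y i ord0 * y j ord0 * CSplus (dotv t y)).
pose B j := \int[mu]_y (enorm y ^+ 2 * y j ord0 * CSminus (dotv t y)).
pose C j := \int[mu]_y (y j ord0 * CSminus (dotv t y)).
pose S i := \int[mu]_y (y i ord0 * CSplus (dotv t y)).
pose LM := \int[mu]_y (enorm y ^+ 2 * CSminus (dotv t y)).
have T2 : ((2^-1 *: (grad (laplacian (psi_plus P X)) t)^T
      - (2^-1 * q) *: (grad (psi_plus P X) t)^T)
     *m (x *m x^T - 1%:M) *m t) ord0 ord0 =
    - 2^-1 * \sum_i \sum_j t i ord0 * (B j + q * C j) * (x i ord0 * x j ord0 - (i == j)%:R).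
  rewrite mxE mulr_sumr; apply: eq_bigr => i _; rewrite mxE mulr_suml mulr_sumr.
  apply: eq_bigr => j _; rewrite !mxE big_ord1 !mxE dlap_plus dpsi_plus -/(B j) -/(C j).
  by rewrite (eq_sym j i); ring.
have T5 : dotv x (hessian (psi_plus P X) t *m x) =
    - \sum_i \sum_j A i j * (x i ord0 * x j ord0).
  rewrite dotvE -sumrN; apply: eq_bigr => i _; rewrite mxE mulr_sumr -sumrN.
  by apply: eq_bigr => j _; rewrite mxE hess_plus -/(A i j); ring.
have T3 : dotv (grad (psi_minus P X) t) x = - \sum_i S i * x i ord0.
  rewrite dotvE -sumrN; apply: eq_bigr => i _; rewrite mxE dpsi_minus.
  rewrite -mulNr; congr (_ * _); rewrite -mulN1r -RintZ.
    by apply: eq_Rint => y; ring.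
  exact: intg_moment (moment_coord i) tCS.
(* This trace cancels the Laplacian contained in [- zfun], which leaves the last term of [hstar]. *)
have sA : \sum_i A i i = - laplacian (psi_plus P X) t.
  by rewrite /laplacian -sumrN; apply: eq_bigr => i _; rewrite hess_plus opprK.
have E1 : \sum_i \sum_j (\int[mu]_y (dgfun i y t * y j ord0)) *
      (x i ord0 * x j ord0 - (i == j)%:R) =
   2 * \sum_i \sum_j A i j * (x i ord0 * x j ord0) - 2 * \sum_i A i i +
   \sum_i \sum_j t i ord0 * (B j + q * C j) * (x i ord0 * x j ord0 - (i == j)%:R).
  rewrite !mulr_sumr -sumrB -big_split; apply: eq_bigr => i _.
  have -> : A i i = \sum_j A i j * (i == j)%:R.
    rewrite (bigD1 i)//= eqxx mulr1 big1 ?addr0// => j ji.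
    by rewrite eq_sym (negbTE ji) mulr0.
  rewrite /= !mulr_sumr -sumrB -big_split; apply: eq_bigr => j _ /=.
  by rewrite (intg_dgx i j t).2 -/(A i j) -/(B j) -/(C j) -/q; ring.
have E2 : \sum_i (\int[mu]_y dgfun i y t) * x i ord0 =
   2 * \sum_i S i * x i ord0 + (LM + q * psi_minus P X t) * dotv t x.
  rewrite dotvE !mulr_sumr -big_split; apply: eq_bigr => i _ /=.
  by rewrite (intg_dg i t).2 -/(S i) -/LM -/q psi_minusE; ring.
rewrite T2 T5 T3 E1 E2 lap_minus -/LM.
rewrite /zfun -/q sA /gfun -addrA -/q.
by field.
Qed.

End limit_formulas.

(** * The kernels gamma and eta *)

Lemma RintZr dm (M : measurableType dm) (R : realType) (m : {measure set M -> \bar R})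
  (f : M -> R) (c : R) : intg m f -> \int[m]_x (f x * c) = (\int[m]_x f x) * c.
Proof.
by move=> hf; rewrite mulrC -RintZ//; apply: eq_Rint => x; rewrite mulrC.
Qed.

Lemma weight_dom (R : realType) (b h u v w : R) : `|b| <= h * (u * v) -> 0 <= w ->
  `|b * w| <= h * u * (v * w).
Proof.
move=> bh w0; have -> : h * u * (v * w) = h * (u * v) * w by ring.
by rewrite normrM (ger0_norm w0) ler_wpM2r.
Qed.

Section kernels.
Context (R : realType) (d : nat) dT (T : measurableType dT) (P : probability T R).
Variable X : {RV P >-> 'cV[R]_d}.
Let mu : probability _ R := distribution P X.
Hypothesis i4 : intg mu (fun x => growth x ^+ 2).
Variable a : R.
Hypothesis a0 : 0 < a.
Let leb := @lebesgue_cV R d.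
Implicit Types (x y t : 'cV[R]_d) (f : 'cV[R]_d -> 'cV[R]_d -> R).

(* Kernels f(x, t) for which all the integrals below converge. *)
Definition tame (m : nat) f :=
  measurable_fun setT (fun p : 'cV[R]_d * 'cV[R]_d => f p.1 p.2) /\
  exists H, exists k, 0 <= H /\
    forall x t, `|f x t| <= H * (growth x ^+ m * growth t ^+ k).

Lemma growth_pow_le t (k l : nat) : (k <= l)%N -> growth t ^+ k <= growth t ^+ l.
Proof. by move=> kl; rewrite ler_weXn2l// growth_ge1. Qed.

Lemma growth_pow_ge0 t (k : nat) : 0 <= growth t ^+ k.
Proof. by rewrite exprn_ge0 ?growth_ge0. Qed.

Lemma growth_pow_ge1 t (k : nat) : 1 <= growth t ^+ k.
Proof. by rewrite -[1](expr0 (growth t)) growth_pow_le. Qed.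

Lemma tame_weaken m m' f : (m <= m')%N -> tame m f -> tame m' f.
Proof.
move=> mm [mf [H [k [H0 h]]]]; split=> //; exists H, k; split=> // x t.
apply: le_trans (h x t) _; rewrite ler_wpM2l// ler_wpM2r ?growth_pow_ge0//.
exact: growth_pow_le.
Qed.

Lemma tameD m f g : tame m f -> tame m g -> tame m (fun x t => f x t + g x t).
Proof.
move=> [mf [H [k [H0 h]]]] [mg [H' [k' [H0' h']]]]; split.
  exact: measurable_funD.
exists (H + H'), (maxn k k'); split; first exact: addr_ge0.
move=> x t; rewrite (le_trans (ler_normD _ _))// mulrDl lerD//.
  apply: le_trans (h x t) _; rewrite ler_wpM2l// ler_wpM2l ?growth_pow_ge0//.
  by apply: growth_pow_le; exact: leq_maxl.
apply: le_trans (h' x t) _; rewrite ler_wpM2l// ler_wpM2l ?growth_pow_ge0//.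
by apply: growth_pow_le; exact: leq_maxr.
Qed.

Lemma tameM m m' f g : tame m f -> tame m' g -> tame (m + m') (fun x t => f x t * g x t).
Proof.
move=> [mf [H [k [H0 h]]]] [mg [H' [k' [H0' h']]]]; split.
  exact: measurable_funM.
exists (H * H'), (k + k')%N; split; first exact: mulr_ge0.
move=> x t; rewrite normrM !exprD.
have -> : H * H' * (growth x ^+ m * growth x ^+ m' * (growth t ^+ k * growth t ^+ k')) =
  H * (growth x ^+ m * growth t ^+ k) * (H' * (growth x ^+ m' * growth t ^+ k')) by ring.
by rewrite ler_pM.
Qed.

Lemma tame_x m (q : 'cV[R]_d -> R) H : measurable_fun setT q -> 0 <= H ->
  (forall x, `|q x| <= H * growth x ^+ m) -> tame m (fun x _ => q x).
Proof.
move=> mq H0 h; split; first exact: measurableT_comp.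
by exists H, 0%N; split=> // x t; rewrite expr0 mulr1.
Qed.

Lemma tame_t m (q : 'cV[R]_d -> R) H k : measurable_fun setT q -> 0 <= H ->
  (forall t, `|q t| <= H * growth t ^+ k) -> tame m (fun _ t => q t).
Proof.
move=> mq H0 h; split; first exact: measurableT_comp.
exists H, k; split=> // x t; apply: le_trans (h t) _; rewrite ler_wpM2l//.
by rewrite ler_peMl ?growth_pow_ge0// growth_pow_ge1.
Qed.

Lemma tame_cst m c : tame m (fun _ _ => c).
Proof.
apply: (@tame_t _ _ `|c| 0) => // t; by rewrite expr0 mulr1.
Qed.

Lemma tameZ m c f : tame m f -> tame m (fun x t => c * f x t).
Proof. by move=> hf; have := tameM (tame_cst 0 c) hf; rewrite add0n. Qed.

Lemma tameN m f : tame m f -> tame m (fun x t => - f x t).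
Proof.
move=> /(tameZ (-1)) [mf h]; split.
  by under eq_fun do rewrite -mulN1r.
by have [H [k [H0 hH]]] := h; exists H, k; split=> // x t; rewrite -mulN1r.
Qed.

Lemma tameB m f g : tame m f -> tame m g -> tame m (fun x t => f x t - g x t).
Proof. by move=> hf /tameN; exact: tameD. Qed.

Lemma tame_sum m (I : Type) (s : seq I) (F : I -> 'cV[R]_d -> 'cV[R]_d -> R) :
  (forall i, tame m (F i)) -> tame m (fun x t => \sum_(i <- s) F i x t).
Proof.
move=> hF; elim: s => [|i s ih].
  rewrite (_ : (fun x t => _) = (fun _ _ => 0)); first exact: tame_cst.
  by apply/funext => x; apply/funext => t; rewrite big_nil.
rewrite (_ : (fun x t => _) = (fun x t => F i x t + \sum_(i <- s) F i x t)).
  exact: tameD.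
by apply/funext => x; apply/funext => t; rewrite big_cons.
Qed.

Lemma tame_xcoord (i : 'I_d) : tame 1 (fun x _ => x i ord0).
Proof.
apply: (@tame_x _ _ 1) => // [|x]; first exact: measurable_coord.
by rewrite mul1r expr1 coord_le_growth.
Qed.

Lemma tame_tcoord m (i : 'I_d) : tame m (fun _ t => t i ord0).
Proof.
apply: (@tame_t _ _ 1 1) => // [|t]; first exact: measurable_coord.
by rewrite mul1r expr1 coord_le_growth.
Qed.

Lemma tame_xcoord2 (i j : 'I_d) : tame 1 (fun x _ => x i ord0 * x j ord0).
Proof.
apply: (@tame_x _ _ 1) => // [|x].
  by apply: measurable_funM; exact: measurable_coord.
by rewrite mul1r expr1 coord2_le_growth.
Qed.

Lemma tame_xsqr : tame 1 (fun x _ => enorm x ^+ 2).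
Proof.
apply: (@tame_x _ _ 1) => // [|x]; first by apply: measurable_funX; exact: measurable_enorm.
by rewrite mul1r expr1 ger0_norm ?sqr_ge0// enorm2_le_growth.
Qed.

Lemma tame_tsqr m : tame m (fun _ t => enorm t ^+ 2).
Proof.
apply: (@tame_t _ _ 1 1) => // [|x]; first by apply: measurable_funX; exact: measurable_enorm.
by rewrite mul1r expr1 ger0_norm ?sqr_ge0// enorm2_le_growth.
Qed.

Lemma tame_trig (p p1 : R -> R) : trig p p1 -> tame 0 (fun x t => p (dotv t x)).
Proof.
move=> [mp _ bp _ _]; split.
  apply: measurableT_comp => //; under eq_fun do rewrite dotvE.
  apply: measurable_bigsum => i; apply: measurable_funM.
    exact: (measurableT_comp (measurable_coord i ord0) measurable_snd).
  exact: (measurableT_comp (measurable_coord i ord0) measurable_fst).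
by exists 2, 0%N; split=> // x t; rewrite !expr0 !mulr1.
Qed.

Lemma tame_quad : tame 1 (fun x t => enorm x ^+ 2 + enorm t ^+ 2 - d%:R).
Proof.
apply: tameB; last exact: tame_cst.
by apply: tameD; [exact: tame_xsqr|exact: tame_tsqr].
Qed.

Lemma tame_gfun : tame 1 (@gfun R d).
Proof. exact: (tameM tame_quad (tame_trig (trig_CSplus R))). Qed.

Lemma tame_dgfun i : tame 1 (@dgfun R d i).
Proof.
apply: tameD.
  apply: (tameM (m := 1) (m' := 0)); last exact: tame_trig (trig_CSplus R).
  by apply: tameZ; exact: tame_xcoord.
apply: (tameM (m := 1) (m' := 0)); last exact: tame_trig (trig_CSminus R).
exact: (tameM (m := 1) (m' := 0) tame_quad (tame_tcoord 0 i)).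
Qed.

Lemma tame_intg_x f t : tame 2 f -> intg mu (fun x => f x t).
Proof.
move=> [mf [H [k [H0 h]]]].
apply: (@intg_growth2 _ _ _ _ _ _ i4 (H * growth t ^+ k)) => [|x].
  exact: (measurableT_comp mf (measurable_pair2 t)).
by rewrite -mulrA (mulrC (growth t ^+ k)); exact: h.
Qed.

Lemma tame_mean_weight f : tame 2 f ->
  intg leb (fun t => (\int[mu]_x f x t) * weight a t) /\
  exists H, exists k, 0 <= H /\ forall t, `|\int[mu]_x f x t| <= H * growth t ^+ k.
Proof.
move=> hf; have [mf [H [k [H0 h]]]] := hf.
have i42 : intg mu (fun x => H * growth x ^+ 2) by exact: intgZ.
split.
  have mk : measurable_fun setT (fun p : 'cV[R]_d * 'cV[R]_d => f p.1 p.2 * weight a p.2).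
    apply: measurable_funM => //; apply: measurableT_comp => //.
    exact: measurable_weight.
  have dom x t : `|f x t * weight a t| <= H * growth x ^+ 2 * (growth t ^+ k * weight a t).
    by apply: weight_dom => //; exact: expR_ge0.
  apply: eq_intg (dom_intgG (m1 := mu) (m2 := leb) mk dom i42 (intg_growth_weight d k a0)) => t /=.
  by rewrite RintZr//; exact: tame_intg_x.
exists (H * \int[mu]_x growth x ^+ 2), k; split.
  by rewrite mulr_ge0// Rint_ge0// => x; exact: growth_pow_ge0.
move=> t; rewrite -mulrA (mulrC (\int[mu]_x _)) mulrA -RintZ//.
apply: Rint_norm_le; [exact: tame_intg_x|exact: intgZ|move=> x].
by rewrite -mulrA (mulrC (growth t ^+ k)); exact: h.
Qed.

Lemma tame_mean m f : tame 2 f -> tame m (fun _ t => \int[mu]_x f x t).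
Proof.
move=> hf; have [h1 [H [k [H0 hH]]]] := tame_mean_weight hf.
apply: (tame_t _ _ H0 hH).
(* Fubini yields measurability in the presence of the weight, which is then divided out. *)
have -> : (fun t => \int[mu]_x f x t) =
    (fun t => (\int[mu]_x f x t) * weight a t * expR (a * enorm t ^+ 2)).
  apply/funext => t; rewrite -mulrA /weight -expRD mulNr addNr expR0 mulr1//.
apply: measurable_funM; first exact: intg_measurable h1.
by have := @measurable_expsq R d (- a); rewrite opprK.
Qed.

Lemma tame_zfun m : tame m (fun _ t => zfun P X t).
Proof.
rewrite (_ : (fun _ t => zfun P X t) = (fun (_ : 'cV[R]_d) t => \int[mu]_x gfun x t)).
  by apply: tame_mean; apply: tame_weaken tame_gfun.
by apply/funext => x; apply/funext => t; rewrite (zfunE i4).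
Qed.

Let zw t := zfun P X t * weight a t.

Lemma tame_fubini f : tame 2 f ->
  [/\ forall x, intg leb (fun t => f x t * zw t),
      intg mu (fun x => \int[leb]_t (f x t * zw t)) &
      \int[leb]_t ((\int[mu]_x f x t) * zw t) = \int[mu]_x \int[leb]_t (f x t * zw t)].
Proof.
move=> hf; have [mfz [H [k [H0 h]]]] := tameM hf (tame_zfun 0).
rewrite addn0 in h.
have mk : measurable_fun setT (fun p : 'cV[R]_d * 'cV[R]_d => f p.1 p.2 * zw p.2).
  under eq_fun do rewrite /zw mulrA.
  apply: measurable_funM => //; apply: measurableT_comp => //.
  exact: measurable_weight.
have dom x t : `|f x t * zw t| <= H * growth x ^+ 2 * (growth t ^+ k * weight a t).
  by rewrite /zw mulrA; apply: weight_dom => //; exact: expR_ge0.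
have iH : intg mu (fun x => H * growth x ^+ 2) by exact: intgZ.
have iw := intg_growth_weight d k a0.
split.
- by move=> x; exact: (dom_intg2 (m2 := leb) mk dom iw x).
- exact: (dom_intgF (m1 := mu) (m2 := leb) mk dom iH iw).
rewrite (dom_fubini (m1 := mu) (m2 := leb) mk dom iH iw).
by apply: eq_Rint => t /=; rewrite RintZr//; exact: tame_intg_x.
Qed.

Lemma tame_int_bound m f : (m <= 2)%N -> tame m f ->
  exists2 K, 0 <= K & forall x, `|\int[leb]_t (f x t * zw t)| <= K * growth x ^+ m.
Proof.
move=> m2 hf; have [mfz [H [k [H0 h]]]] := tameM hf (tame_zfun 0).
rewrite addn0 in h; have iw := intg_growth_weight d k a0.
exists (H * \int[leb]_t (growth t ^+ k * weight a t)).
  by rewrite mulr_ge0// Rint_ge0// => t; rewrite mulr_ge0 ?growth_pow_ge0 ?expR_ge0.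
move=> x; have [ix _ _] := tame_fubini (tame_weaken m2 hf).
rewrite mulrAC -RintZ//; apply: Rint_norm_le => //; first exact: intgZ.
by move=> t; rewrite /zw mulrA; apply: weight_dom => //; exact: expR_ge0.
Qed.

Definition gamma x := \int[leb]_t (gfun x t * zw t).
(** The partial derivative of [gamma] taken under the integral; it acts as a derivative only through
    the bound [gamma_taylor]. *)
Definition dgamma i x := \int[leb]_t (dgfun i x t * zw t).

Lemma measurable_tame_int f : tame 2 f -> measurable_fun setT (fun x => \int[leb]_t (f x t * zw t)).
Proof. by move=> hf; have [_ h _] := tame_fubini hf; exact: intg_measurable h. Qed.

Let g2 : tame 2 (@gfun R d). Proof. exact: tame_weaken tame_gfun. Qed.
Let dg2 i : tame 2 (@dgfun R d i). Proof. exact: tame_weaken (tame_dgfun i). Qed.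

Lemma measurable_gamma : measurable_fun setT gamma.
Proof. exact: measurable_tame_int. Qed.

Lemma measurable_dgamma i : measurable_fun setT (dgamma i).
Proof. exact: measurable_tame_int. Qed.

Lemma gamma_bound : exists2 K, 0 <= K & forall x, `|gamma x| <= K * growth x.
Proof.
have [K K0 h] := tame_int_bound (leqnSn 1) tame_gfun.
by exists K => // x; have := h x; rewrite expr1.
Qed.

Lemma dgamma_bound i : exists2 K, 0 <= K & forall x, `|dgamma i x| <= K * growth x.
Proof.
have [K K0 h] := tame_int_bound (leqnSn 1) (tame_dgfun i).
by exists K => // x; have := h x; rewrite expr1.
Qed.

(** With u = t.x and v = t.D the remainder splits into [q] times the Taylor remainder of CS^+, a
    product of two first-order increments, and |D|^2 CS^+(u + v). Their constants are 2 (d + 1), 4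
    and 2, so 10 leaves slack. *)
Lemma gfun_taylor x t (D : 'cV[R]_d) :
  `|gfun (x + D) t - gfun x t - \sum_i dgfun i x t * D i ord0| <=
  (2 * (d%:R + 1) + 10) * (growth x * growth t ^+ 2) * enorm D ^+ 2.
Proof.
set q := enorm x ^+ 2 + enorm t ^+ 2 - d%:R; set u := dotv t x; set v := dotv t D.
have xD : enorm (x + D) ^+ 2 = enorm x ^+ 2 + 2 * dotv x D + enorm D ^+ 2.
  by rewrite !enorm_sqr dotvDl !dotvDr (dotvC D x); ring.
have -> : \sum_i dgfun i x t * D i ord0 = 2 * dotv x D * CSplus u + q * CSminus u * v.
  rewrite /v !dotvE mulr_sumr mulr_suml mulr_sumr -big_split; apply: eq_bigr => i _ /=.
  by rewrite /dgfun -/u -/q; ring.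
rewrite /gfun dotvDr -/u -/v xD.
have [_ _ _ _ /(_ u v) tr] := trig_CSplus R.
have CSb := CSplus_le2 (u + v).
set r := CSplus (u + v) - CSplus u - CSminus u * v in tr.
have -> : (enorm x ^+ 2 + 2 * dotv x D + enorm D ^+ 2 + enorm t ^+ 2 - d%:R) *
    CSplus (u + v) - (enorm x ^+ 2 + enorm t ^+ 2 - d%:R) * CSplus u -
    (2 * dotv x D * CSplus u + q * CSminus u * v) =
  q * r + 2 * dotv x D * (CSplus (u + v) - CSplus u) + enorm D ^+ 2 * CSplus (u + v).
  by rewrite /r /q; ring.
have lip : `|CSplus (u + v) - CSplus u| <= 2 * `|v|.
  have := cos_lip u v; have := sin_lip u v; rewrite /CSplus !ler_norml.
  by move=> /andP[? ?] /andP[? ?]; apply/andP; split; lra.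
have hv : `|v| <= enorm t * enorm D := dotv_CS t D.
have hx : `|dotv x D| <= enorm x * enorm D := dotv_CS x D.
have e0 := enorm_ge0 D; have et0 := enorm_ge0 t; have ex0 := enorm_ge0 x.
have gx1 := growth_ge1 x; have gt1 := growth_ge1 t.
have gx0 := growth_ge0 x; have gt0 := growth_ge0 t.
have gxt : growth x * growth t <= growth x * growth t ^+ 2.
  by rewrite ler_wpM2l// growth_sqr_ge.
have hq : `|q| <= (d%:R + 1) * (growth x * growth t).
  have d0 : 0 <= d%:R :> R by [].
  have h1 : 1 + enorm x ^+ 2 + enorm t ^+ 2 <= growth x * growth t.
    by rewrite /growth; have := mulr_ge0 (sqr_ge0 (enorm x)) (sqr_ge0 (enorm t)); lra.
  have sx := sqr_ge0 (enorm x); have st := sqr_ge0 (enorm t).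
  have h2 : d%:R * 1 <= d%:R * (growth x * growth t) by rewrite ler_wpM2l//; lra.
  by rewrite /q ler_norml; apply/andP; split; lra.
have v2 : v ^+ 2 <= growth t * enorm D ^+ 2.
  have -> : v ^+ 2 = `|v| ^+ 2 by rewrite real_normK ?num_real.
  apply: (@le_trans _ _ ((enorm t * enorm D) ^+ 2)).
    by rewrite lerXn2r ?nnegrE ?mulr_ge0.
  by rewrite exprMn ler_wpM2r ?sqr_ge0// enorm2_le_growth.
have p1 : `|q * r| <= 2 * (d%:R + 1) * (growth x * growth t ^+ 2) * enorm D ^+ 2.
  rewrite normrM; apply: (@le_trans _ _ ((d%:R + 1) * (growth x * growth t) *
    (2 * (growth t * enorm D ^+ 2)))).
    by apply: ler_pM => //; apply: le_trans tr _; rewrite ler_wpM2l.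
  by rewrite le_eqVlt; apply/orP; left; apply/eqP; ring.
have p2 : `|2 * dotv x D * (CSplus (u + v) - CSplus u)| <=
    4 * (growth x * growth t ^+ 2) * enorm D ^+ 2.
  rewrite !normrM (ger0_norm (ler0n R 2)).
  apply: (@le_trans _ _ (2 * (enorm x * enorm D) * (2 * (enorm t * enorm D)))).
    apply: ler_pM; [by rewrite mulr_ge0|by []|by rewrite ler_wpM2l|].
    by apply: le_trans lip _; rewrite ler_wpM2l.
  have -> : 2 * (enorm x * enorm D) * (2 * (enorm t * enorm D)) =
    4 * (enorm x * enorm t) * enorm D ^+ 2 by ring.
  rewrite ler_wpM2r ?sqr_ge0// ler_wpM2l//; apply: le_trans gxt.
  apply: ler_pM => //; rewrite /growth.
    by have := sqr_ge0 (enorm x - 1); have := sqr_ge0 (enorm x); nra.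
  by have := sqr_ge0 (enorm t - 1); have := sqr_ge0 (enorm t); nra.
have p3 : `|enorm D ^+ 2 * CSplus (u + v)| <= 2 * (growth x * growth t ^+ 2) * enorm D ^+ 2.
  rewrite normrM (ger0_norm (sqr_ge0 _)) mulrC ler_wpM2r ?sqr_ge0//.
  apply: le_trans CSb _; rewrite -[leLHS]mulr1 ler_wpM2l//.
  by apply: le_trans gxt; rewrite -[1]mulr1 ler_pM.
have G0 : 0 <= (growth x * growth t ^+ 2) * enorm D ^+ 2.
  by rewrite mulr_ge0 ?sqr_ge0// mulr_ge0// exprn_ge0.
apply: le_trans (ler_normD _ _) _; apply: le_trans (lerD (ler_normD _ _) (lexx _)) _.
move: p1 p2 p3 G0; rewrite -!mulrA.
by move: (growth x * (growth t ^+ 2 * enorm D ^+ 2)) => G; lra.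
Qed.

(** The bound for [gfun] integrated against |z| w. A single power of [growth x] is essential: for
    residuals |D|^2 contributes another one, and only the square is integrable. *)
Lemma gamma_taylor : exists2 K, 0 <= K & forall x (D : 'cV[R]_d),
  `|gamma (x + D) - gamma x - \sum_i dgamma i x * D i ord0| <=
  K * growth x * enorm D ^+ 2.
Proof.
have [mz [H [k [H0 hz]]]] := tame_zfun 0.
have iw := intg_growth_weight d k.+2 a0.
pose C : R := 2 * (d%:R + 1) + 10.
have C0 : 0 <= C by rewrite addr_ge0// mulr_ge0// addr_ge0.
pose I := \int[leb]_t (growth t ^+ k.+2 * weight a t).
exists (C * H * I).
  rewrite !mulr_ge0// Rint_ge0// => t.
  by rewrite mulr_ge0 ?growth_pow_ge0 ?expR_ge0.
move=> x D; have [ig _ _] := tame_fubini g2.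
have idg i := let: And3 h _ _ := tame_fubini (dg2 i) in h.
have isum : intg leb (fun t => \sum_i dgfun i x t * zw t * D i ord0).
  by apply: intg_sum => i; apply: eq_intg (intgZ (D i ord0) (idg i x)) => t; rewrite mulrC.
have -> : \sum_i dgamma i x * D i ord0 = \int[leb]_t (\sum_i dgfun i x t * zw t * D i ord0).
  rewrite Rint_sum; last first.
    by move=> i; apply: eq_intg (intgZ (D i ord0) (idg i x)) => t; rewrite mulrC.
  by apply: eq_bigr => i _; apply: esym; exact: (RintZr (D i ord0) (idg i x)).
rewrite -RintB// -RintB//; last exact: intgB.
have -> : C * H * I * growth x * enorm D ^+ 2 =
    (C * H * growth x * enorm D ^+ 2) * I by ring.
rewrite /I -RintZ//; apply: Rint_norm_le.
- by apply: intgB => //; exact: intgB.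
- exact: intgZ.
- move=> t; have -> : gfun (x + D) t * zw t - gfun x t * zw t -
      \sum_i dgfun i x t * zw t * D i ord0 =
    (gfun (x + D) t - gfun x t - \sum_i dgfun i x t * D i ord0) * zw t.
    rewrite !mulrBl; congr (_ - _); rewrite mulr_suml; apply: eq_bigr => i _; ring.
  rewrite /zw mulrA !normrM (ger0_norm (expR_ge0 _)) mulrA ler_wpM2r ?expR_ge0//.
  have hz' : `|zfun P X t| <= H * growth t ^+ k by have := hz 0 t; rewrite expr0 mul1r.
  apply: le_trans (ler_pM _ _ (gfun_taylor x t D) hz') _ => //.
  rewrite -/C (_ : growth t ^+ k.+2 = growth t ^+ 2 * growth t ^+ k); last by rewrite -exprD.
  by rewrite le_eqVlt; apply/orP; left; apply/eqP; ring.
Qed.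

Let am i j t := \int[mu]_y (dgfun i y t * y j ord0).
Let bm i t := \int[mu]_y dgfun i y t.

Let dgx2 i j : tame 2 (fun y t => dgfun i y t * y j ord0).
Proof. exact: (tameM (m := 1) (m' := 1) (tame_dgfun i) (tame_xcoord j)). Qed.

Lemma tame_hstar : tame 1 (hstar P X).
Proof.
have -> : hstar P X = fun x t => gfun x t - zfun P X t
  - 2^-1 * \sum_i \sum_j am i j t * (x i ord0 * x j ord0 - (i == j)%:R)
  - \sum_i bm i t * x i ord0.
  by apply/funext => x; apply/funext => t; rewrite (hstarE i4).
apply: tameB; last first.
  apply: tame_sum => i; apply: (tameM (m := 0) (m' := 1)); last exact: tame_xcoord.
  exact: (tame_mean 0 (dg2 i)).
apply: tameB; first by apply: tameB; [exact: tame_gfun|exact: tame_zfun].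
apply: tameZ; apply: tame_sum => i; apply: tame_sum => j.
apply: (tameM (m := 0) (m' := 1)); first exact: (tame_mean 0 (dgx2 i j)).
by apply: tameB; [exact: tame_xcoord2|exact: tame_cst].
Qed.

Definition eta x := \int[leb]_t (hstar P X x t * zw t).

(** One of the two factors z(t) is written as the mean of [gfun], and the integrals are
    exchanged. *)
Lemma Gamma_limE : Gamma_lim P X a = \int[mu]_x gamma x.
Proof.
have [_ _ <-] := tame_fubini g2; apply: eq_Rint => t.
by rewrite -(zfunE i4) /zw expr2 mulrA.
Qed.

Lemma etaE x : eta x = gamma x - \int[mu]_y gamma y
  - 2^-1 * \sum_i \sum_j (\int[mu]_y (dgamma i y * y j ord0)) *
      (x i ord0 * x j ord0 - (i == j)%:R)
  - \sum_i (\int[mu]_y dgamma i y) * x i ord0.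
Proof.
have [ig _ Eg] := tame_fubini g2.
have iz : intg leb (fun t => zfun P X t * zw t).
  by have [h _ _] := tame_fubini (tame_zfun 2); exact: h 0.
have iam i j : intg leb (fun t => am i j t * zw t) /\
    \int[leb]_t (am i j t * zw t) = \int[mu]_y (dgamma i y * y j ord0).
  split; first by have [h _ _] := tame_fubini (tame_mean 2 (dgx2 i j)); exact: h 0.
  have [_ _ ->] := tame_fubini (dgx2 i j); apply: eq_Rint => y.
  have [idg _ _] := tame_fubini (dg2 i).
  rewrite /dgamma mulrC -RintZ//; apply: eq_Rint => t; ring.
have ibm i : intg leb (fun t => bm i t * zw t) /\
    \int[leb]_t (bm i t * zw t) = \int[mu]_y dgamma i y.
  split; first by have [h _ _] := tame_fubini (tame_mean 2 (dg2 i)); exact: h 0.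
  by have [_ _ ->] := tame_fubini (dg2 i).
pose c i j := x i ord0 * x j ord0 - (i == j)%:R.
have e t : hstar P X x t * zw t = gfun x t * zw t - zfun P X t * zw t -
   \sum_i \sum_j (2^-1 * c i j) * (am i j t * zw t) -
   \sum_i x i ord0 * (bm i t * zw t).
  rewrite (hstarE i4) !mulrBl; congr (_ - _ - _ - _).
    rewrite mulr_sumr mulr_suml; apply: eq_bigr => i _.
    by rewrite mulr_sumr mulr_suml; apply: eq_bigr => j _; rewrite -/(am i j t) -/(c i j); ring.
  by rewrite mulr_suml; apply: eq_bigr => i _; rewrite -/(bm i t); ring.
rewrite /eta; under eq_Rintegral do rewrite e.
have i1 : intg leb (fun t => \sum_i x i ord0 * (bm i t * zw t)).
  by apply: intg_sum => i; apply: intgZ; exact: (ibm i).1.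
have i2i i : intg leb (fun t => \sum_j (2^-1 * c i j) * (am i j t * zw t)).
  by apply: intg_sum => j; apply: intgZ; exact: (iam i j).1.
have i2 : intg leb (fun t => \sum_i \sum_j (2^-1 * c i j) * (am i j t * zw t)).
  exact: intg_sum.
rewrite RintB//; last by apply: intgB => //; apply: intgB.
rewrite RintB//; last exact: intgB.
rewrite RintB//; congr (_ - _ - _ - _).
- rewrite -Eg; apply: eq_Rint => t; by rewrite (zfunE i4).
- rewrite Rint_sum// mulr_sumr; apply: eq_bigr => i _.
  rewrite Rint_sum; last by move=> j; apply: intgZ; exact: (iam i j).1.
  rewrite mulr_sumr; apply: eq_bigr => j _.
  by rewrite (RintZ _ (iam i j).1) (iam i j).2 -/(c i j); ring.
- rewrite Rint_sum; last by move=> i; apply: intgZ; exact: (ibm i).1.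
  by apply: eq_bigr => i _; rewrite (RintZ _ (ibm i).1) (ibm i).2 mulrC.
Qed.

Lemma measurable_eta : measurable_fun setT eta.
Proof. by apply: measurable_tame_int; exact: tame_weaken tame_hstar. Qed.

Lemma eta_bound : exists2 K, 0 <= K & forall x, `|eta x| <= K * growth x.
Proof.
have [K K0 h] := tame_int_bound (leqnSn 1) tame_hstar.
by exists K => // x; have := h x; rewrite expr1.
Qed.

Lemma tame_eta : tame 1 (fun x _ => eta x).
Proof.
have [K K0 h] := eta_bound; apply: (@tame_x _ _ K) => //; first exact: measurable_eta.
Qed.

(** [Kstar] is the mean of a product, so Fubini, used once in t and once in s, turns the double
    integral into the mean of the square of [eta]; the factor 4 is that of 2 [eta]. *)
Lemma sigma2E : sigma2 P X a = \int[mu]_x ((2 * eta x) ^+ 2).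
Proof.
have hh s : tame 2 (fun x t => hstar P X x s * hstar P X x t).
  apply: (tameM (m := 1) (m' := 1)) tame_hstar.
  have [mh [H [k [H0 h]]]] := tame_hstar.
  apply: (@tame_x _ _ (H * growth s ^+ k)).
  - exact: (measurableT_comp mh (measurable_pair2 s)).
  - by rewrite mulr_ge0 ?growth_pow_ge0.
  - by move=> x; rewrite -mulrA (mulrC (growth s ^+ k)); exact: h.
have [ih _ _] := tame_fubini (tame_weaken (leqnSn 1) tame_hstar).
have inner s : \int[leb]_t (Kstar P X s t * zfun P X s * zfun P X t *
     weight a s * weight a t) = zw s * \int[mu]_x (hstar P X x s * eta x).
  have e t : Kstar P X s t * zfun P X s * zfun P X t * weight a s * weight a t =
      zw s * ((\int[mu]_x (hstar P X x s * hstar P X x t)) * zw t).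
    have ix := tame_intg_x t (hh s).
    rewrite /Kstar (expectE (intg_measurable ix) ix) /zw; ring.
  under eq_Rintegral do rewrite e.
  have [_ _ E] := tame_fubini (hh s); rewrite RintZ.
    rewrite E; congr (_ * _); apply: eq_Rint => x; rewrite /eta -RintZ//.
    by apply: eq_Rint => t; rewrite mulrA.
  by have [h _ _] := tame_fubini (tame_mean 2 (hh s)); exact: h 0.
rewrite /sigma2; under eq_Rintegral do rewrite inner mulrC.
have he : tame 2 (fun x t => hstar P X x t * eta x).
  exact: (tameM (m := 1) (m' := 1) tame_hstar tame_eta).
have [_ ie2 ->] := tame_fubini he.
have E x : \int[leb]_t (hstar P X x t * eta x * zw t) = eta x ^+ 2.
  transitivity (\int[leb]_t (eta x * (hstar P X x t * zw t))).
    by apply: eq_Rint => t; rewrite mulrAC mulrC.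
  by rewrite RintZ// expr2.
have ie : intg mu (fun x => eta x ^+ 2) by apply: eq_intg ie2 => x; rewrite E.
under eq_Rintegral do rewrite E.
by rewrite -RintZ//; apply: eq_Rint => x; ring.
Qed.

End kernels.

(** * The test statistic of a fixed sample *)

Section sample_means.
Context (R : realType).
Implicit Types (n : nat) (f g : nat -> R) (c : R).

Definition smean n f : R := n%:R^-1 * \sum_(1 <= j < n.+1) f j.

Lemma eq_smean n f g : f =1 g -> smean n f = smean n g.
Proof. by move=> fg; congr (_ * _); apply: eq_bigr => j _. Qed.

Lemma smeanD n f g : smean n (fun j => f j + g j) = smean n f + smean n g.
Proof. by rewrite /smean big_split mulrDr. Qed.

Lemma smeanZ n c f : smean n (fun j => c * f j) = c * smean n f.
Proof. by rewrite /smean -mulr_sumr mulrCA. Qed.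

Lemma smeanB n f g : smean n (fun j => f j - g j) = smean n f - smean n g.
Proof. by rewrite /smean sumrB mulrBr. Qed.

Lemma smean_cst n c : (0 < n)%N -> smean n (fun=> c) = c.
Proof.
move=> n0; rewrite /smean sumr_const_nat subSS subn0 -(mulr_natl c n) mulrA mulVf ?mul1r//.
by rewrite pnatr_eq0 -lt0n.
Qed.

Lemma smean_sum (I : Type) (s : seq I) n (F : I -> nat -> R) :
  smean n (fun j => \sum_(i <- s) F i j) = \sum_(i <- s) smean n (F i).
Proof. by rewrite /smean exchange_big mulr_sumr. Qed.

Lemma smean_le n f g : (forall j, f j <= g j) -> smean n f <= smean n g.
Proof. by move=> fg; rewrite ler_wpM2l ?invr_ge0//; apply: ler_sum. Qed.

Lemma smean_norm n f : `|smean n f| <= smean n (fun j => `|f j|).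
Proof.
rewrite /smean normrM ger0_norm ?invr_ge0// ler_wpM2l ?invr_ge0//.
exact: ler_norm_sum.
Qed.

Lemma smean_ge0 n f : (forall j, 0 <= f j) -> 0 <= smean n f.
Proof. by move=> f0; rewrite mulr_ge0 ?invr_ge0// sumr_ge0. Qed.

End sample_means.

Section complex_parts.
Context (R : realType).

Lemma sum_Complex (I : Type) (s : seq I) (f g : I -> R) :
  \sum_(i <- s) Complex (f i) (g i) = Complex (\sum_(i <- s) f i) (\sum_(i <- s) g i).
Proof.
elim: s => [|i s ih]; first by rewrite !big_nil.
by rewrite !big_cons ih.
Qed.

Lemma natV_complex n (u v : R) :
  n%:R^-1 * Complex u v = Complex (n%:R^-1 * u) (n%:R^-1 * v).
Proof.
have -> : (n%:R^-1 : R[i]) = real_complex R n%:R^-1 by rewrite fmorphV rmorph_nat.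
by apply/eqP; rewrite eq_complex/= !mul0r subr0 addr0 !eqxx.
Qed.

Lemma normc_sqr (u v : R) : Normc.normc (Complex u v) ^+ 2 = u ^+ 2 + v ^+ 2.
Proof. by rewrite /= sqr_sqrtr// addr_ge0 ?sqr_ge0. Qed.

Context (d : nat).
Implicit Types (t : 'cV[R]_d).

Lemma laplacian_trig_sum (n : nat) (y : nat -> 'cV[R]_d) (p p1 : R -> R) t :
  trig p p1 -> trig p1 (fun s => - p s) ->
  laplacian (fun t => smean n (fun j => p (dotv t (y j)))) t =
  - smean n (fun j => enorm (y j) ^+ 2 * p (dotv t (y j))).
Proof.
move=> tp tp1.
have e1 i : pderiv i (fun t => smean n (fun j => p (dotv t (y j)))) =
    fun t => \sum_(1 <= j < n.+1) (n%:R^-1 * y j i ord0) * p1 (dotv t (y j)).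
  apply/funext => s; rewrite -(pderiv_trig_sum n (fun=> n%:R^-1) y i s tp).
  by congr pderiv; apply/funext => u; rewrite /smean mulr_sumr.
rewrite /laplacian; under eq_bigr do rewrite e1 (pderiv_trig_sum _ _ _ _ _ tp1).
rewrite exchange_big /smean mulr_sumr -sumrN; apply: eq_bigr => j _ /=.
rewrite enorm_sqr (dotvE (y j)) mulr_suml mulr_sumr -sumrN; apply: eq_bigr => i _; ring.
Qed.

End complex_parts.

(** * The statistic as the integral of a squared average *)

Section fixed_sample.
Context (R : realType) (d : nat) (a : R).
Hypothesis a0 : 0 < a.
Let leb := @lebesgue_cV R d.
Implicit Types (t : 'cV[R]_d) (n : nat) (x y : nat -> 'cV[R]_d).

(** Averaged over the residuals, [cosfun] and [sinfun] are, up to sign, the real and imaginary parts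
    of the function whose modulus enters the statistic. *)
Definition cosfun (x t : 'cV[R]_d) : R := (enorm x ^+ 2 + enorm t ^+ 2 - d%:R) * cos (dotv t x).
Definition sinfun (x t : 'cV[R]_d) : R := (enorm x ^+ 2 + enorm t ^+ 2 - d%:R) * sin (dotv t x).

(** Functions of t alone are treated as kernels constant in the first argument, so that the calculus
    of tame kernels also serves a fixed sample. *)
Lemma tame_fix m (f : 'cV[R]_d -> 'cV[R]_d -> R) (x : 'cV[R]_d) : tame m f ->
  tame 0 (fun _ t => f x t).
Proof.
move=> [mf [H [k [H0 h]]]]; apply: (@tame_t _ _ _ _ (H * growth x ^+ m) k) => [||t].
- exact: (measurableT_comp mf (measurable_pair1 x)).
- by rewrite mulr_ge0// growth_pow_ge0.
- by rewrite -mulrA; exact: h.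
Qed.

Lemma tame_smean n (f : 'cV[R]_d -> 'cV[R]_d -> R) m y : tame m f ->
  tame 0 (fun _ t => smean n (fun j => f (y j) t)).
Proof.
by move=> hf; apply: tameZ; apply: tame_sum => j; exact: tame_fix hf.
Qed.

Lemma tame_intg_t (h : 'cV[R]_d -> R) : tame 0 (fun _ t => h t) ->
  intg leb (fun t => h t * weight a t).
Proof.
move=> [mh [H [k [H0 hH]]]].
apply: intg_dom (intgZ H (intg_growth_weight d k a0)) _ => [|t].
  apply: measurable_funM; last exact: measurable_weight.
  exact: (measurableT_comp mh (measurable_pair1 (0 : 'cV[R]_d))).
rewrite normrM (ger0_norm (expR_ge0 _)) mulrA ler_wpM2r ?expR_ge0//.
by have := hH 0 t; rewrite expr0 mul1r.
Qed.

Lemma dotvNl (x y : 'cV[R]_d) : dotv (- x) y = - dotv x y.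
Proof. by rewrite -scaleN1r dotvZl mulN1r. Qed.

Lemma ecf_norm n x t : let y := scaled_residual n x in
  Normc.normc (claplacian (ecf n x) t
     - real_complex R (enorm t ^+ 2 - d%:R) * ecf n x t) ^+ 2 =
  smean n (fun j => cosfun (y j) t) ^+ 2 + smean n (fun j => sinfun (y j) t) ^+ 2.
Proof.
move=> y; pose c (p : R -> R) t : R := smean n (fun j => p (dotv t (y j))).
have E u : ecf n x u = Complex (c (@cos R) u) (c (@sin R) u).
  by rewrite /ecf /expi sum_Complex natV_complex.
have ER : (fun u => complex.Re (ecf n x u)) = c (@cos R) by apply/funext => u; rewrite E.
have EI : (fun u => complex.Im (ecf n x u)) = c (@sin R) by apply/funext => u; rewrite E.
rewrite /claplacian ER EI.
have tNc : trig (fun s => - sin s) (fun s => - @cos R s) := trig_opp (trig_sin R).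
rewrite (laplacian_trig_sum n y t (trig_cos R) tNc).
rewrite (laplacian_trig_sum n y t (trig_sin R) (trig_cos R)) E.
set q := enorm t ^+ 2 - d%:R; set A := smean _ _; set B := smean _ _.
have -> : Complex (- A) (- B) - real_complex R q * Complex (c (@cos R) t) (c (@sin R) t) =
    Complex (- A - q * c (@cos R) t) (- B - q * c (@sin R) t).
  by apply/eqP; rewrite eq_complex/= !mul0r subr0 addr0 !eqxx.
rewrite normc_sqr -[in LHS]sqrrN -[X in _ + X]sqrrN !opprD !opprK /c -!smeanZ -!smeanD.
by congr (_ ^+ 2 + _ ^+ 2); apply: eq_smean => j; rewrite /cosfun /sinfun /q; ring.
Qed.

Definition zhat n y t := smean n (fun j => gfun (y j) t).

Lemma tame_zhat n y m : tame m (fun _ t => zhat n y t).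
Proof. by apply: tame_weaken (tame_smean n y (@tame_gfun R d)). Qed.

Lemma test_statE n x : test_stat n x a =
  n%:R * \int[leb]_t (zhat n (scaled_residual n x) t ^+ 2 * weight a t).
Proof.
rewrite /test_stat; set y := scaled_residual n x; congr (_ * _).
pose C t := smean n (fun j => cosfun (y j) t).
pose S t := smean n (fun j => sinfun (y j) t).
have tC : tame 0 (fun _ t => C t).
  apply: (@tame_smean n cosfun 1).
  exact: (tameM (m := 1) (m' := 0) (tame_quad R d) (tame_trig d (trig_cos R))).
have tS : tame 0 (fun _ t => S t).
  apply: (@tame_smean n sinfun 1).
  exact: (tameM (m := 1) (m' := 0) (tame_quad R d) (tame_trig d (trig_sin R))).
have tCC := tameM tC tC; have tSS := tameM tS tS; have tCS := tameM tC tS.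
have iCS : intg leb (fun t => C t * S t * weight a t) by exact: tame_intg_t.
have i1 : intg leb (fun t => (C t * C t + S t * S t) * weight a t).
  by apply: tame_intg_t; exact: tameD.
have odd : \int[leb]_t (C t * S t * weight a t) = 0.
  apply: Rint_odd => // t.
  have eN : enorm (- t) = enorm t := enormN t.
  have -> : C (- t) = C t.
    by apply: eq_smean => j; rewrite /cosfun eN dotvNl cosN.
  have -> : S (- t) = - S t.
    rewrite -mulN1r -smeanZ; apply: eq_smean => j.
    by rewrite /sinfun eN dotvNl sinN; ring.
  by rewrite /weight eN mulrN mulNr.
transitivity (\int[leb]_t ((C t * C t + S t * S t) * weight a t)).
  by apply: eq_Rint => t; rewrite ecf_norm -!expr2.
transitivity (\int[leb]_t ((C t * C t + S t * S t) * weight a t + 2 * (C t * S t * weight a t))).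
  by rewrite RintD ?(RintZ _ iCS) ?odd ?mulr0 ?addr0//; exact: intgZ.
apply: eq_Rint => t; have -> : zhat n y t = C t + S t.
  by rewrite /zhat /C /S -smeanD; apply: eq_smean => j; rewrite /gfun /CSplus /cosfun /sinfun mulrDr.
by move: (weight a t) (C t) (S t) => *; ring.
Qed.

End fixed_sample.

(** * Linearization of the scaled residuals *)

Lemma dotv_outer (R : realType) (d : nat) (u v : 'cV[R]_d) :
  dotv v (u *m u^T *m v) = dotv u v ^+ 2.
Proof.
rewrite -mulmxA [u^T *m v]mx11_scalar mul_mx_scalar dotvZr expr2.
by congr (_ * _); exact: dotvC.
Qed.

Section sample_moments.
Context (R : realType) (d n : nat) (x : nat -> 'cV[R]_d).

Lemma sample_meanE i : sample_mean n x i ord0 = smean n (fun j => x j i ord0).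
Proof. by rewrite mxE summxE. Qed.

Lemma sample_covE i k : (0 < n)%N -> sample_cov n x i k =
  smean n (fun j => x j i ord0 * x j k ord0) - sample_mean n x i ord0 * sample_mean n x k ord0.
Proof.
move=> n0; rewrite mxE summxE -/(smean n _).
set m := sample_mean n x.
transitivity (smean n (fun j => x j i ord0 * x j k ord0 - m i ord0 * x j k ord0
    - m k ord0 * x j i ord0 + m i ord0 * m k ord0)).
  by apply: eq_smean => j; rewrite mxE big_ord1 !mxE; ring.
rewrite smeanD !smeanB !smeanZ smean_cst// -!sample_meanE -/m; ring.
Qed.

Lemma sample_cov_psd : psd (sample_cov n x).
Proof.
split.
  rewrite /sample_cov linearZ/= linear_sum/=; congr (_ *: _).
  by apply: eq_bigr => j _; rewrite trmx_mul trmxK.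
move=> v; rewrite /sample_cov -scalemxAl dotvZr mulr_ge0 ?invr_ge0//.
rewrite mulmx_suml; elim/big_rec : _ => [|j y _ h].
  by rewrite /dotv mulmx0 mxE.
by rewrite dotvDr addr_ge0// dotv_outer sqr_ge0.
Qed.

End sample_moments.

(** * Deterministic bounds for the residuals of a fixed sample *)

Section residuals.
Context (R : realType) (d n : nat) (x : nat -> 'cV[R]_d).
Hypothesis n0 : (0 < n)%N.
Let m := sample_mean n x.
Let S := sample_cov n x.
Let B := invsqrtmx S.
Let y := scaled_residual n x.

(** The one scalar in which all errors are measured; of order n^(-1/2) in probability. *)
Definition sample_dev : R := mx_l1 (S - 1%:M) + enorm m.
Let eps := sample_dev.

Hypothesis small : eps <= 2^-1.

Let delta j := (B - 1%:M) *m x j - B *m m.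

Lemma residualE j : y j = x j + delta j.
Proof.
rewrite /y /scaled_residual /delta -/S -/B -/m mulmxBr mulmxBl mul1mx.
by rewrite addrA addrCA subrr addr0.
Qed.

Lemma sample_dev_ge0 : 0 <= eps.
Proof. by rewrite addr_ge0 ?mx_l1_ge0 ?enorm_ge0. Qed.

Let e1 : mx_l1 (S - 1%:M) <= eps. Proof. by rewrite lerDl enorm_ge0. Qed.
Let e2 : enorm m <= eps. Proof. by rewrite lerDr mx_l1_ge0. Qed.

Lemma sample_invsqrt : [/\ opb B 2, opb (B - 1%:M) (2 * eps) &
  opb (B - 1%:M + 2^-1 *: (S - 1%:M)) (5 * eps ^+ 2)].
Proof.
apply: invsqrtmx_expansion => //; first exact: (sample_cov_psd n x).1.
- exact: (opb_le e1 (@opb_l1 _ _ _)).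
- exact: sample_dev_ge0.
Qed.

Lemma residual_le j : enorm (delta j) <= 2 * eps * (1 + enorm (x j)).
Proof.
have [B2 D2 _] := sample_invsqrt.
apply: le_trans (enormB _ _) _; rewrite mulrDr mulr1 addrC lerD//.
by apply: le_trans (B2 _) _; rewrite ler_wpM2l.
Qed.

Lemma residual_le1 j : enorm (delta j) <= 4 * eps * growth (x j).
Proof.
apply: le_trans (residual_le j) _.
have -> : 4 * eps * growth (x j) = 2 * eps * (2 * growth (x j)) by ring.
rewrite ler_wpM2l ?mulr_ge0 ?sample_dev_ge0// /growth.
by have := sqr_ge0 (enorm (x j) - 1); have := sqr_ge0 (enorm (x j)); nra.
Qed.

Lemma residual_le2 j : enorm (delta j) ^+ 2 <= 8 * eps ^+ 2 * growth (x j).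
Proof.
have h := residual_le j; have ep := sample_dev_ge0; have ex := enorm_ge0 (x j).
apply: (@le_trans _ _ ((2 * eps * (1 + enorm (x j))) ^+ 2)).
  by rewrite lerXn2r ?nnegrE ?enorm_ge0// !mulr_ge0// addr_ge0.
have -> : 8 * eps ^+ 2 * growth (x j) = 4 * eps ^+ 2 * (2 * growth (x j)) by ring.
rewrite !exprMn -natrX ler_wpM2l ?mulr_ge0 ?sqr_ge0// /growth.
by have := sqr_ge0 (enorm (x j) - 1); nra.
Qed.

Let G2 := smean n (fun j => growth (x j) ^+ 2).

(** Taylor expansion of [g] at each observation. The three terms on the right stem from the
    quadratic remainder, from replacing the sample averages of dg x and dg by arbitrary [A] and [b],
    and from replacing B - 1 by - (S - 1) / 2 and B m by m. Every one carries a factor [eps] times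
    something that becomes small. The 6 rounds up 5 + 1/2, for the inverse square root and for the
    product of sample means in [S]. *)
Lemma residual_linearization (g : 'cV[R]_d -> R) (dg : 'I_d -> 'cV[R]_d -> R)
    (K : R) (A : 'I_d -> 'I_d -> R) (b : 'I_d -> R) : 0 <= K ->
  (forall v D, `|g (v + D) - g v - \sum_i dg i v * D i ord0| <=
     K * growth v * enorm D ^+ 2) ->
  `|smean n (fun j => g (y j)) - smean n (fun j => g (x j)) +
    (2^-1 * \sum_i \sum_k A i k * (smean n (fun j => x j i ord0 * x j k ord0) - (i == k)%:R) +
    \sum_i b i * m i ord0)| <=
  eps * (8 * K * eps * G2 +
    \sum_i \sum_k (2 * `|smean n (fun j => dg i (x j) * x j k ord0) - A i k| + 6 * eps * `|A i k|) +
    \sum_i (2 * `|smean n (fun j => dg i (x j)) - b i| + 2 * eps * `|b i|)).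
Proof.
move=> K0 hg; have [B2 D2 DE] := sample_invsqrt; have ep := sample_dev_ge0.
pose Q i k := smean n (fun j => dg i (x j) * x j k ord0).
pose q i := smean n (fun j => dg i (x j)).
pose r j := g (y j) - g (x j) - \sum_i dg i (x j) * delta j i ord0.
have hr j : `|r j| <= 8 * K * eps ^+ 2 * growth (x j) ^+ 2.
  rewrite /r residualE; apply: le_trans (hg _ _) _.
  have -> : 8 * K * eps ^+ 2 * growth (x j) ^+ 2 =
    K * growth (x j) * (8 * eps ^+ 2 * growth (x j)) by ring.
  by rewrite ler_wpM2l ?residual_le2// mulr_ge0 ?growth_ge0.
have lin : smean n (fun j => \sum_i dg i (x j) * delta j i ord0) =
    \sum_i \sum_k (B - 1%:M) i k * Q i k - \sum_i (B *m m) i ord0 * q i.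
  transitivity (smean n (fun j => \sum_i \sum_k (B - 1%:M) i k * (dg i (x j) * x j k ord0)
     - \sum_i (B *m m) i ord0 * dg i (x j))).
    apply: eq_smean => j; rewrite -sumrB; apply: eq_bigr => i _.
    rewrite mxE [X in X + _]mxE [(- (B *m m)) _ _]mxE mulrBr mulr_sumr.
    by congr (_ - _); [apply: eq_bigr => k _; rewrite mulrCA|rewrite mulrC].
  rewrite smeanB !smean_sum; congr (_ - _); apply: eq_bigr => i _; last by rewrite smeanZ.
  by rewrite smean_sum; apply: eq_bigr => k _; rewrite smeanZ.
have rE : smean n (fun j => g (y j)) - smean n (fun j => g (x j)) =
    smean n r + (\sum_i \sum_k (B - 1%:M) i k * Q i k - \sum_i (B *m m) i ord0 * q i).
  by rewrite -lin -smeanD -smeanB; apply: eq_smean => j; rewrite /r subrK.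
pose F := B - 1%:M + 2^-1 *: (S - 1%:M).
(* The last summand corrects for centring: [S i k] is the average of the products minus
   [m i ord0 * m k ord0]. *)
pose T1 i k := (B - 1%:M) i k * (Q i k - A i k) + (A i k * F i k +
   2^-1 * A i k * (m i ord0 * m k ord0)).
pose T2 i := (B *m m) i ord0 * (q i - b i) + b i * ((B - 1%:M) *m m) i ord0.
have -> : smean n (fun j => g (y j)) - smean n (fun j => g (x j)) +
    (2^-1 * \sum_i \sum_k A i k * (smean n (fun j => x j i ord0 * x j k ord0) - (i == k)%:R) +
    \sum_i b i * m i ord0) = smean n r + \sum_i \sum_k T1 i k - \sum_i T2 i.
  have P1 : \sum_i \sum_k T1 i k = \sum_i \sum_k (B - 1%:M) i k * Q i k +
      2^-1 * \sum_i \sum_k A i k *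
        (smean n (fun j => x j i ord0 * x j k ord0) - (i == k)%:R).
    rewrite mulr_sumr -big_split; apply: eq_bigr => i _ /=.
    rewrite mulr_sumr -big_split; apply: eq_bigr => k _ /=.
    have Fik : F i k = (B - 1%:M) i k + 2^-1 * (S i k - (i == k)%:R).
      by rewrite /F mxE; congr (_ + _); rewrite !mxE.
    by rewrite /T1 Fik /S sample_covE// -/m; ring.
  have P2 : \sum_i T2 i = \sum_i (B *m m) i ord0 * q i - \sum_i b i * m i ord0.
    rewrite -sumrB; apply: eq_bigr => i _.
    have Di : ((B - 1%:M) *m m) i ord0 = (B *m m) i ord0 - m i ord0.
      by rewrite mulmxBl mul1mx mxE; congr (_ + _); rewrite mxE.
    by rewrite /T2 Di; ring.
  rewrite rE P1 P2; ring.
have b1 : `|smean n r| <= eps * (8 * K * eps * G2).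
  apply: le_trans (smean_norm _ _) _.
  have -> : eps * (8 * K * eps * G2) = 8 * K * eps ^+ 2 * G2 by ring.
  by rewrite -smeanZ; apply: smean_le => j; exact: hr.
have b2 : `|\sum_i \sum_k T1 i k| <=
    eps * \sum_i \sum_k (2 * `|Q i k - A i k| + 6 * eps * `|A i k|).
  apply: le_trans (ler_norm_sum _ _ _) _; rewrite mulr_sumr; apply: ler_sum => i _.
  apply: le_trans (ler_norm_sum _ _ _) _; rewrite mulr_sumr; apply: ler_sum => k _.
  rewrite mulrDr; apply: le_trans (ler_normD _ _) _; apply: lerD.
    rewrite normrM mulrA (mulrC eps 2) ler_wpM2r//.
    exact: opb_entry D2.
  apply: le_trans (ler_normD _ _) _.
  have h1 : `|A i k * F i k| <= 5 * eps ^+ 2 * `|A i k|.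
    rewrite normrM mulrC ler_wpM2r//; exact: opb_entry DE.
  have h2 : `|2^-1 * A i k * (m i ord0 * m k ord0)| <= 2^-1 * eps ^+ 2 * `|A i k|.
    rewrite !normrM (@ger0_norm _ 2^-1) ?invr_ge0// -!mulrA ler_wpM2l ?invr_ge0//.
    rewrite [eps * (_ * _)]mulrA [leRHS]mulrC ler_wpM2l// ler_pM//.
      by apply: le_trans (coord_le_enorm _ _) e2.
    by apply: le_trans (coord_le_enorm _ _) e2.
  apply: le_trans (lerD h1 h2) _.
  have -> : eps * (6 * eps * `|A i k|) = 6 * (eps ^+ 2 * `|A i k|) by ring.
  rewrite -!mulrA; have := mulr_ge0 (sqr_ge0 eps) (normr_ge0 (A i k)); lra.
have b3 : `|\sum_i T2 i| <=
    eps * \sum_i (2 * `|q i - b i| + 2 * eps * `|b i|).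
  apply: le_trans (ler_norm_sum _ _ _) _; rewrite mulr_sumr; apply: ler_sum => i _.
  rewrite mulrDr; apply: le_trans (ler_normD _ _) _; apply: lerD.
    rewrite normrM mulrA (mulrC eps 2) ler_wpM2r//.
    apply: le_trans (coord_le_enorm _ _) _; apply: le_trans (B2 _) _.
    by rewrite ler_wpM2l.
  rewrite normrM mulrC mulrA ler_wpM2r//.
  apply: le_trans (coord_le_enorm _ _) _; apply: le_trans (D2 _) _.
  have -> : eps * (2 * eps) = 2 * eps * eps by ring.
  by rewrite ler_wpM2l// mulr_ge0.
apply: le_trans (ler_normB _ _) _; apply: le_trans (lerD (ler_normD _ _) (lexx _)) _.
rewrite [leRHS]mulrDr [X in _ <= X + _]mulrDr; exact: lerD (lerD b1 b2) b3.
Qed.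

End residuals.

(** The same expansion, but with the first-order term merely bounded, since the difference will be
    squared. By [eps <= 1/2] the quadratic remainder is also linear in [eps]. *)
Lemma zhat_diff (R : realType) (d : nat) : exists2 C : R, 0 <= C & exists k : nat,
  forall n (x : nat -> 'cV[R]_d) t, sample_dev n x <= 2^-1 ->
  `|zhat n (scaled_residual n x) t - zhat n x t| <=
  C * growth t ^+ k * (sample_dev n x * smean n (fun j => growth (x j) ^+ 2)).
Proof.
have [_ [H [k0 [H0 hH]]]] : tame 1 (fun x t => \sum_i `|@dgfun R d i x t|).
  apply: tame_sum => i; have [mf [H [k [H0 h]]]] := @tame_dgfun R d i.
  split; first by apply: measurableT_comp => //; exact: measurable_normr.
  by exists H, k; split => // x t; rewrite normr_id.
pose K : R := 2 * (d%:R + 1) + 10; have K0 : 0 <= K by rewrite addr_ge0// mulr_ge0// addr_ge0.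
exists (4 * (H + K)); first by rewrite mulr_ge0// addr_ge0.
pose k := maxn k0 2; exists k => n x t small.
set eps := sample_dev n x in small *; have ep : 0 <= eps := sample_dev_ge0 n x.
pose delta j := (invsqrtmx (sample_cov n x) - 1%:M) *m x j -
  invsqrtmx (sample_cov n x) *m sample_mean n x.
rewrite /zhat -smeanB; apply: le_trans (smean_norm _ _) _.
rewrite mulrA -smeanZ; apply: smean_le => j.
rewrite residualE -/(delta j).
have h1 : enorm (delta j) <= 4 * eps * growth (x j) := residual_le1 small j.
have h2 : enorm (delta j) ^+ 2 <= 8 * eps ^+ 2 * growth (x j) := residual_le2 small j.
have gx := growth_ge0 (x j); have gx1 := growth_ge1 (x j).
have gk l : (l <= k)%N -> growth t ^+ l <= growth t ^+ k by exact: growth_pow_le.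
set L := \sum_i dgfun i (x j) t * delta j i ord0.
have hL : `|L| <= 4 * H * growth t ^+ k * eps * growth (x j) ^+ 2.
  apply: (@le_trans _ _ (H * (growth (x j) * growth t ^+ k) * (4 * eps * growth (x j)))).
    apply: (@le_trans _ _ (H * (growth (x j) * growth t ^+ k0) * enorm (delta j))).
      apply: (@le_trans _ _ ((\sum_i `|dgfun i (x j) t|) * enorm (delta j))).
        rewrite mulr_suml; apply: le_trans (ler_norm_sum _ _ _) _; apply: ler_sum => i _.
        by rewrite normrM ler_wpM2l// coord_le_enorm.
      rewrite ler_wpM2r ?enorm_ge0//; apply: le_trans (ler_norm _) _.
      by have := hH (x j) t; rewrite expr1.
    apply: ler_pM; [|exact: enorm_ge0| |exact: h1].
      by rewrite !mulr_ge0// growth_pow_ge0.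
    by rewrite ler_wpM2l// ler_wpM2l// gk// leq_maxl.
  by rewrite le_eqVlt; apply/orP; left; apply/eqP; ring.
have hR : `|gfun (x j + delta j) t - gfun (x j) t - L| <=
    4 * K * growth t ^+ k * eps * growth (x j) ^+ 2.
  apply: le_trans (gfun_taylor _ _ _) _; rewrite -/K.
  apply: (@le_trans _ _ (K * (growth (x j) * growth t ^+ k) * (4 * eps * growth (x j)))).
    apply: ler_pM; [|exact: sqr_ge0| |].
    - by rewrite !mulr_ge0// ?growth_pow_ge0// growth_ge0.
    - by rewrite ler_wpM2l// ler_wpM2l// gk// leq_maxr.
    - apply: le_trans h2 _; rewrite ler_wpM2r// expr2.
      by have := ler_wpM2r ep small; lra.
  by rewrite le_eqVlt; apply/orP; left; apply/eqP; ring.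
have -> : gfun (x j + delta j) t - gfun (x j) t =
    L + (gfun (x j + delta j) t - gfun (x j) t - L) by ring.
apply: le_trans (ler_normD _ _) _; apply: le_trans (lerD hL hR) _.
by rewrite le_eqVlt; apply/orP; left; apply/eqP; ring.
Qed.

(** * Stochastic expansions *)

Lemma smean_sqr (R : realType) n (f : nat -> R) : (0 < n)%N ->
  smean n f ^+ 2 <= smean n (fun j => f j ^+ 2).
Proof.
move=> n0; set c := smean n f.
have : 0 <= smean n (fun j => (f j - c) ^+ 2) by apply: smean_ge0 => j; exact: sqr_ge0.
have -> : smean n (fun j => (f j - c) ^+ 2) = smean n (fun j => f j ^+ 2) - c ^+ 2.
  transitivity (smean n (fun j => f j ^+ 2 - 2 * c * f j + c ^+ 2)).
    by apply: eq_smean => j; ring.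
  by rewrite smeanD smeanB smeanZ smean_cst// -/c; ring.
by rewrite subr_ge0.
Qed.

Lemma OP_norm dT (T : measurableType dT) (R : realType) (P : probability T R)
    (Q : nat -> T -> R) : OP P Q -> OP P (fun n w => `|Q n w|).
Proof.
move=> h e e0; have [K hK] := h e e0; exists K; apply: filterS hK => n [N [mN PN hN]].
by exists N; split => // w Nw; rewrite normr_id; exact: hN.
Qed.

Lemma oP_norm dT (T : measurableType dT) (R : realType) (P : probability T R)
    (Q : nat -> T -> R) : oP P Q -> oP P (fun n w => `|Q n w|).
Proof.
move=> h e e0; apply: often_impl (h e e0); near=> n => w; by rewrite normr_id.
Unshelve. all: by end_near. Qed.

Section asymptotics.
Context (R : realType) (d : nat) dT (T : measurableType dT) (P : probability T R).
Variable X : nat -> {RV P >-> 'cV[R]_d}.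
Hypothesis X_iid : iid X.
Let mu : probability _ R := distribution P (X 0%N).
Hypothesis i4 : intg mu (fun x => growth x ^+ 2).
Hypothesis mean0 : forall i : 'I_d, \int[mu]_x x i ord0 = 0.
Hypothesis cov1 : forall i k : 'I_d, \int[mu]_x (x i ord0 * x k ord0) = (i == k)%:R.
Variable a : R.
Hypothesis a0 : 0 < a.
Let leb := @lebesgue_cV R d.
Let sample w j : 'cV[R]_d := X j w.

Lemma intgX (u : 'cV[R]_d -> R) : intg mu u -> intg P (fun w => u (X 0%N w)).
Proof. by move=> iu; apply/(intg_distr (X 0%N) (intg_measurable iu)). Qed.

Lemma RintX (u : 'cV[R]_d -> R) : intg mu u ->
  \int[P]_w u (X 0%N w) = \int[mu]_x u x.
Proof. by move=> iu; apply/esym/Rint_distr; [exact: intg_measurable iu|exact: intgX]. Qed.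

Lemma oP_smean (u : 'cV[R]_d -> R) : intg mu u ->
  oP P (fun n w => smean n (fun j => u (X j w)) - \int[mu]_x u x).
Proof. by move=> iu; rewrite -(RintX iu); apply: wlln (intgX iu) => //; exact: intg_measurable iu. Qed.

Lemma OP_smean (u : 'cV[R]_d -> R) : intg mu u ->
  OP P (fun n w => smean n (fun j => u (X j w))).
Proof.
move=> iu; apply: eq_OP (OPD (oP_OP (oP_smean iu)) (OP_cst P (\int[mu]_x u x))) => n w.
by rewrite subrK.
Qed.

Lemma OP_sqrt_smean (u : 'cV[R]_d -> R) (C : R) : measurable_fun setT u ->
  (forall x, `|u x| <= C * growth x) -> \int[mu]_x u x = 0 ->
  OP P (fun n w => Num.sqrt n%:R * smean n (fun j => u (X j w))).
Proof.
move=> mu' uC u0.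
have iu2 : intg mu (fun x => u x ^+ 2).
  apply: (intg_growth2 i4 (C := C ^+ 2)) => [|x]; first exact: measurable_funX.
  rewrite normrX -exprMn lerXn2r ?nnegrE//.
  exact: le_trans (uC x).
have iu : intg mu u.
  apply: (intg_growth2 i4 (C := `|C|)) => // x; apply: le_trans (uC x) _.
  apply: ler_pM; [|exact: growth_ge0|exact: ler_norm|exact: growth_sqr_ge].
  by have := le_trans (normr_ge0 _) (uC x); rewrite pmulr_lge0// (lt_le_trans _ (growth_ge1 x)).
by apply: (OP_avg X_iid mu' (intgX iu2)); rewrite RintX.
Qed.

Let coordm (i : 'I_d) : measurable_fun setT (fun x : 'cV[R]_d => x i ord0).
Proof. exact: measurable_coord. Qed.

Let dev n w := sample_dev n (sample w).

(** Each entry of S - 1 is an average of centred variables with finite second moment minus a product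
    of two sample means; the latter is of smaller order. *)
Lemma OP_dev : OP P (fun n w => Num.sqrt n%:R * dev n w).
Proof.
pose m i n w := smean n (fun j => X j w i ord0).
have mO i : OP P (fun n w => Num.sqrt n%:R * m i n w).
  apply: (OP_sqrt_smean (u := fun x : 'cV[R]_d => x i ord0) (C := 1)) => // x.
  by rewrite mul1r coord_le_growth.
pose c i k n w := smean n (fun j => X j w i ord0 * X j w k ord0 - (i == k)%:R).
have cO i k : OP P (fun n w => Num.sqrt n%:R * c i k n w).
  apply: (OP_sqrt_smean (u := fun x : 'cV[R]_d => x i ord0 * x k ord0 - (i == k)%:R) (C := 2)).
  - by apply: measurable_funB => //; exact: measurable_funM.
  - move=> x; apply: le_trans (ler_normB _ _) _; rewrite mulr2n mulrDl mul1r lerD ?coord2_le_growth//.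
    by case: (i == k); rewrite ?normr1 ?normr0 ?growth_ge1 ?growth_ge0.
  - rewrite RintB; last exact: intg_cst.
      by rewrite cov1 Rint_cst subrr.
    apply: (intg_growth2 i4 (C := 1)) => [|x]; first exact: measurable_funM.
    by rewrite mul1r (le_trans (coord2_le_growth _ _ _))// growth_sqr_ge.
pose W n w := \sum_i \sum_k (`|Num.sqrt n%:R * c i k n w| +
  `|Num.sqrt n%:R * (m i n w * m k n w)|) + \sum_i `|Num.sqrt n%:R * m i n w|.
apply: (@OP_le _ _ _ _ _ W).
  apply: often_always; near=> n => w.
  have n0 : (0 < n)%N by near: n; exact: nbhs_infty_gt.
  have s0 : 0 <= Num.sqrt n%:R :> R := sqrtr_ge0 _.
  rewrite normrM !ger0_norm// ?sample_dev_ge0// /dev /sample_dev mulrDr.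
  apply: lerD; last first.
    apply: le_trans (ler_wpM2l s0 (enorm_le_sum _)) _; rewrite mulr_sumr.
    by apply: ler_sum => i _; rewrite normrM ger0_norm// sample_meanE.
  rewrite /mx_l1 mulr_sumr; apply: ler_sum => i _; rewrite mulr_sumr; apply: ler_sum => k _.
  rewrite -[X in X * _]ger0_norm// -normrM.
  have -> : (sample_cov n (sample w) - 1%:M) i k = c i k n w - m i n w * m k n w.
    have N1 : (- 1%:M : 'M[R]_d) i k = - (i == k)%:R by rewrite !mxE.
    rewrite mxE sample_covE// N1 !sample_meanE /c smeanB smean_cst// /m /sample.
    by rewrite addrAC.
  by rewrite mulrBr ler_normB.
apply: OPD; last by apply: OP_sum => i; exact: OP_norm.
apply: OP_sum => i; apply: OP_sum => k; apply: OPD; apply: OP_norm => //.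
by apply: oP_OP; exact: oP_sqrtM.
Unshelve. all: by end_near. Qed.

Lemma oP_dev : oP P dev.
Proof.
apply: oP_near (oP_invsqrt OP_dev); near=> n => w.
have n0 : (0 < n)%N by near: n; exact: nbhs_infty_gt.
by rewrite mulKf// sqrtr_eq0 -ltNge ltr0n.
Unshelve. all: by end_near. Qed.

Lemma often_small : often P (fun n w => (0 < n)%N /\ dev n w <= 2^-1).
Proof.
have h20 : 0 < 2^-1 :> R by rewrite invr_gt0.
apply: often_impl (oP_dev h20); near=> n => w h; split.
  by near: n; exact: nbhs_infty_gt.
exact: le_trans (ler_norm _) h.
Unshelve. all: by end_near. Qed.

Let g := gamma (X 0%N) a.
Let dg := dgamma (X 0%N) a.
Let resid n w := scaled_residual n (sample w).

Lemma eta_smean n w : (0 < n)%N ->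
  smean n (fun j => eta (X 0%N) a (X j w)) =
  smean n (fun j => g (X j w)) - \int[mu]_x g x -
  (2^-1 * \sum_i \sum_k (\int[mu]_x (dg i x * x k ord0)) *
     (smean n (fun j => X j w i ord0 * X j w k ord0) - (i == k)%:R) +
   \sum_i (\int[mu]_x dg i x) * sample_mean n (sample w) i ord0).
Proof.
move=> n0; under [X in smean n X]eq_fun do rewrite (etaE i4 a0).
rewrite !smeanB smean_cst// smeanZ !smean_sum opprD addrA; congr (_ - _ * _ - _).
  apply: eq_bigr => i _; rewrite smean_sum; apply: eq_bigr => k _.
  by rewrite smeanZ smeanB smean_cst.
by apply: eq_bigr => i _; rewrite smeanZ sample_meanE.
Qed.

Let intg_dg i : intg mu (dg i).
Proof.
have [K K0 h] := dgamma_bound i4 a0 i.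
apply: (intg_growth2 i4 (C := K)) => [|x]; first exact: measurable_dgamma.
by apply: le_trans (h x) _; rewrite ler_wpM2l// growth_sqr_ge.
Qed.

Let intg_dgx i k : intg mu (fun x => dg i x * x k ord0).
Proof.
have [K K0 h] := dgamma_bound i4 a0 i.
apply: (intg_growth2 i4 (C := K)) => [|x].
  by apply: measurable_funM => //; exact: measurable_dgamma.
rewrite normrM expr2 mulrA; apply: ler_pM => //; exact: coord_le_growth.
Qed.

(** The deterministic bound is [dev] times a bracket [W]. Root n times [dev] is bounded in
    probability, and [W] tends to 0 by the law of large numbers once [A] and [b] are the means. *)
Lemma oP_linear : oP P (fun n w => Num.sqrt n%:R *
  (smean n (fun j => g (resid n w j)) - \int[mu]_x g x -
   smean n (fun j => eta (X 0%N) a (X j w)))).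
Proof.
have [K K0 hg] := gamma_taylor i4 a0.
pose A i k := \int[mu]_x (dg i x * x k ord0); pose b i := \int[mu]_x dg i x.
pose W n w := 8 * K * dev n w * smean n (fun j => growth (X j w) ^+ 2) +
    \sum_i \sum_k (2 * `|smean n (fun j => dg i (X j w) * X j w k ord0) - A i k| +
      6 * dev n w * `|A i k|) +
    \sum_i (2 * `|smean n (fun j => dg i (X j w)) - b i| + 2 * dev n w * `|b i|).
apply: (@oP_le _ _ _ _ _ (fun n w => W n w * (Num.sqrt n%:R * dev n w))); last first.
  apply: oPMO OP_dev; rewrite /W; apply: oPD; first apply: oPD.
  - apply: oPMO; first by apply: oPZ; exact: oP_dev.
    exact: (OP_smean i4).
  - apply: oP_sum => i; apply: oP_sum => k; apply: oPD.
      by apply: oPZ; apply: oP_norm; exact: (oP_smean (intg_dgx i k)).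
    by apply: oPMO (OP_cst _ _); apply: oPZ; exact: oP_dev.
  - apply: oP_sum => i; apply: oPD.
      by apply: oPZ; apply: oP_norm; exact: (oP_smean (intg_dg i)).
    by apply: oPMO (OP_cst _ _); apply: oPZ; exact: oP_dev.
apply: often_impl often_small; near=> n => w [n0 small].
rewrite normrM (ger0_norm (sqrtr_ge0 _)) mulrCA ler_wpM2l ?sqrtr_ge0// mulrC.
have := residual_linearization n0 small A b K0 hg.
rewrite (eta_smean w n0) -/(dev n w) -/(W n w); congr (`|_| <= _).
have aux (p q s c : R) : p - q + s = p - c - (q - c - s) by ring.
exact: aux.
Unshelve. all: by end_near. Qed.

Let z := zfun P (X 0%N).

Let measurable_z : measurable_fun setT z.
Proof. exact: (measurableT_comp (tame_zfun i4 a0 0).1 (measurable_pair1 (0 : 'cV[R]_d))). Qed.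

Lemma measurable_zhat2 n (Y : nat -> T -> 'cV[R]_d) : (forall j, measurable_fun setT (Y j)) ->
  measurable_fun setT (fun p : T * 'cV[R]_d => zhat n (fun j => Y j p.1) p.2).
Proof.
move=> mY; apply: measurable_funM => //; apply: measurable_bigsum => j.
have mp : measurable_fun setT (fun p : T * 'cV[R]_d => (Y j p.1, p.2)).
  by apply: measurable_fun_pair => //; exact: measurableT_comp.
exact: (measurableT_comp (tame_gfun R d).1 mp).
Qed.

(** For the observations themselves the integrand is a squared average of centred i.i.d. variables,
    of mean at most c growth(t)^(2k) / n; by Fubini the integral has mean O(1/n), small even after
    multiplication by root n. *)
Lemma oP_zhat_iid : oP P (fun n w => Num.sqrt n%:R *
  \int[leb]_t ((zhat n (sample w) t - z t) ^+ 2 * weight a t)).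
Proof.
pose h x t := gfun x t - z t.
have th : tame 1 h by apply: tameB; [exact: tame_gfun|exact: (tame_zfun i4 a0 1)].
have [mh [H [k [H0 hH]]]] := th.
have iw := intg_growth_weight d (k + k) a0; set I := \int[leb]_t (growth t ^+ (k + k) * weight a t).
have E n w t : (0 < n)%N -> zhat n (sample w) t - z t = smean n (fun j => h (X j w) t).
  by move=> n0; rewrite /h smeanB smean_cst.
have hint t : intg mu (fun x => h x t) by apply: (tame_intg_x i4); exact: tame_weaken th.
have h0 t : \int[mu]_x h x t = 0.
  have ig : intg mu (fun x => gfun x t).
    by apply: (tame_intg_x i4); exact: tame_weaken (tame_gfun R d).
  by rewrite RintB//; [rewrite -(zfunE i4) Rint_cst subrr|exact: intg_cst].
have hint2 t : intg mu (fun x => h x t ^+ 2).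
  by apply: eq_intg (tame_intg_x i4 t (tameM th th)) => x; rewrite expr2.
pose c := H ^+ 2 * \int[mu]_x growth x ^+ 2.
have h2 t : \int[mu]_x (h x t ^+ 2) <= c * growth t ^+ (k + k).
  rewrite /c mulrAC -RintZ//; apply: Rint_le => //; first exact: intgZ.
  move=> x; have := hH x t; rewrite expr1 => hx.
  have -> : H ^+ 2 * growth t ^+ (k + k) * growth x ^+ 2 =
      (H * (growth x * growth t ^+ k)) ^+ 2 by rewrite exprD; ring.
  rewrite -(real_normK (num_real (h x t))) lerXn2r ?nnegrE//.
  by rewrite !mulr_ge0 ?growth_pow_ge0// growth_ge0.
pose V n w := \int[leb]_t ((zhat n (sample w) t - z t) ^+ 2 * weight a t).
have V0 n w : 0 <= V n w.
  by apply: Rint_ge0 => t; rewrite mulr_ge0 ?sqr_ge0 ?expR_ge0.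
have key n : (0 < n)%N -> intg P (V n) /\ \int[P]_w V n w <= n%:R^-1 * (c * I).
  move=> n0.
  pose kk (p : T * 'cV[R]_d) := (zhat n (fun j => X j p.1) p.2 - z p.2) ^+ 2 * weight a p.2.
  have mk : measurable_fun setT kk.
    apply: measurable_funM; last first.
      by apply: measurableT_comp => //; exact: measurable_weight.
    apply: measurable_funX; apply: measurable_funB.
      have mX j : measurable_fun setT (X j : T -> 'cV[R]_d) by [].
      exact: (measurable_zhat2 n mX).
    exact: measurableT_comp.
  have iG : intg P (fun w => H ^+ 2 * smean n (fun j => growth (X j w) ^+ 2)).
    apply: intgZ; apply: intgZ; apply: intg_sum => j.
    exact: (iid_intg X_iid j (intg_measurable i4) (intgX i4)).
  have dom w t : `|kk (w, t)| <= H ^+ 2 * smean n (fun j => growth (X j w) ^+ 2) *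
      (growth t ^+ (k + k) * weight a t).
    rewrite /kk /=; apply: weight_dom; last exact: expR_ge0.
    rewrite ger0_norm ?sqr_ge0// E//; apply: le_trans (smean_sqr _ n0) _.
    rewrite mulrA -mulrAC -smeanZ; apply: smean_le => j.
    have := hH (X j w) t; rewrite expr1 => hx.
    have -> : H ^+ 2 * growth t ^+ (k + k) * growth (X j w) ^+ 2 =
      (H * (growth (X j w) * growth t ^+ k)) ^+ 2 by rewrite exprD; ring.
    rewrite -(real_normK (num_real (h _ t))) lerXn2r ?nnegrE//.
    by rewrite !mulr_ge0 ?growth_pow_ge0// growth_ge0.
  split; first exact: (dom_intgF (m1 := P) (m2 := leb) mk dom iG iw).
  have -> : \int[P]_w V n w = \int[leb]_t \int[P]_w kk (w, t).
    exact: (dom_fubini (m1 := P) (m2 := leb) mk dom iG iw).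
  have e t : \int[P]_w kk (w, t) = n%:R^-1 * (\int[mu]_x (h x t ^+ 2)) * weight a t.
    have mht : measurable_fun setT (fun x => h x t) := intg_measurable (hint t).
    have [ia ea] := avg_sqr X_iid n0 mht (intgX (hint2 t)) (etrans (RintX (hint t)) (h0 t)).
    rewrite -(RintX (hint2 t)) -ea -RintZr//; apply: eq_Rint => w.
    by rewrite /kk/= E.
  rewrite /I mulrA -RintZ//; apply: Rint_le.
  - exact: (dom_intgG (m1 := P) (m2 := leb) mk dom iG iw).
  - exact: intgZ.
  - move=> t; rewrite e.
    have -> : n%:R^-1 * c * (growth t ^+ (k + k) * weight a t) =
      n%:R^-1 * (c * growth t ^+ (k + k)) * weight a t.
      by move: (weight a t) => W; ring.
    by rewrite ler_wpM2r ?expR_ge0// ler_wpM2l ?invr_ge0.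
apply: (@oP_mean _ _ _ _ _ (fun n => (c * I) * (Num.sqrt n%:R)^-1)).
- near=> n; have n0 : (0 < n)%N by near: n; exact: nbhs_infty_gt.
  by apply: intg_norm; apply: intgZ; exact: (key n n0).1.
- near=> n; have n0 : (0 < n)%N by near: n; exact: nbhs_infty_gt.
  have [iV bV] := key n n0.
  have -> : \int[P]_w `|Num.sqrt n%:R * V n w| = Num.sqrt n%:R * \int[P]_w V n w.
    by rewrite -RintZ//; apply: eq_Rint => w; rewrite ger0_norm// mulr_ge0// sqrtr_ge0.
  apply: le_trans (ler_wpM2l (sqrtr_ge0 _) bV) _.
  have s0 : Num.sqrt n%:R != 0 :> R by rewrite sqrtr_eq0 -ltNge ltr0n.
  have -> : n%:R^-1 = (Num.sqrt n%:R)^-1 * (Num.sqrt n%:R)^-1 :> R.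
    by rewrite -invfM -expr2 sqr_sqrtr.
  by rewrite -(mulrA _^-1) mulVKf// mulrC.
- by rewrite -[X in _ --> X](mulr0 (c * I)); apply: cvgMr; exact: cvg_invsqrt.
Unshelve. all: by end_near. Qed.

End asymptotics.

(** * The limit theorem *)

Section limit_theorem.
Context (R : realType) (d : nat) dT (T : measurableType dT) (P : probability T R).
Variable X : nat -> {RV P >-> 'cV[R]_d}.
Hypothesis X_iid : iid X.
Let mu : probability _ R := distribution P (X 0%N).
Hypothesis i4 : intg mu (fun x => growth x ^+ 2).
Hypothesis mean0 : forall i : 'I_d, \int[mu]_x x i ord0 = 0.
Hypothesis cov1 : forall i k : 'I_d, \int[mu]_x (x i ord0 * x k ord0) = (i == k)%:R.
Variable a : R.
Hypothesis a0 : 0 < a.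
Let leb := @lebesgue_cV R d.
Let sample w j : 'cV[R]_d := X j w.
Let dev n w := sample_dev n (sample w).
Let resid n w := scaled_residual n (sample w).
Let g := gamma (X 0%N) a.
Let z := zfun P (X 0%N).

(** By (p + q)^2 <= 2 p^2 + 2 q^2 the residuals are exchanged for the observations, at a cost
    quadratic in [dev] and hence of order 1/n. *)
Lemma oP_quadratic : oP P (fun n w => Num.sqrt n%:R *
  \int[leb]_t ((zhat n (resid n w) t - z t) ^+ 2 * weight a t)).
Proof.
have [C C0 [k hC]] := zhat_diff R d.
pose I := \int[leb]_t (growth t ^+ (k + k) * weight a t).
pose G2 n w := smean n (fun j => growth (X j w) ^+ 2).
pose V n w := \int[leb]_t ((zhat n (sample w) t - z t) ^+ 2 * weight a t).
apply: (@oP_le _ _ _ _ _ (fun n w => 2 * C ^+ 2 * I *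
    (Num.sqrt n%:R * (dev n w * (dev n w * G2 n w ^+ 2))) + 2 * (Num.sqrt n%:R * V n w))).
  apply: often_impl (often_small X_iid i4 mean0 cov1); near=> n => w [n0 small].
  have tz : tame 0 (fun _ t => z t) := tame_zfun i4 a0 0.
  have t0 := tameB (tame_zhat n (resid n w) 0) tz.
  have t1 := tameB (tame_zhat n (resid n w) 0) (tame_zhat n (sample w) 0).
  have t2 := tameB (tame_zhat n (sample w) 0) tz.
  have j0 := tame_intg_t a0 (tameM t0 t0).
  have j1 := tame_intg_t a0 (tameM t1 t1).
  have j2 := tame_intg_t a0 (tameM t2 t2).
  have s0 : 0 <= Num.sqrt n%:R :> R := sqrtr_ge0 _.
  set L := \int[leb]_t _.
  have L0 : 0 <= L by apply: Rint_ge0 => t; rewrite mulr_ge0 ?sqr_ge0 ?expR_ge0.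
  rewrite ger0_norm ?mulr_ge0//.
  have -> : 2 * C ^+ 2 * I * (Num.sqrt n%:R * (dev n w * (dev n w * G2 n w ^+ 2))) +
      2 * (Num.sqrt n%:R * V n w) =
    Num.sqrt n%:R * (2 * ((C * (dev n w * G2 n w)) ^+ 2 * I) + 2 * V n w) by ring.
  rewrite ler_wpM2l//.
  apply: (@le_trans _ _ (\int[leb]_t (2 * ((zhat n (resid n w) t - zhat n (sample w) t) ^+ 2 * weight a t)
      + 2 * ((zhat n (sample w) t - z t) ^+ 2 * weight a t)))).
    apply: Rint_le => [||t].
    - by apply: eq_intg j0 => t; rewrite expr2.
    - by apply: intgD; apply: intgZ; [apply: eq_intg j1 => t|apply: eq_intg j2 => t]; rewrite expr2.
    - have := expR_ge0 (- a * enorm t ^+ 2); rewrite -/(weight a t).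
      set u := zhat _ _ _; set v := zhat _ _ _; move: (weight a t) => W W0.
      rewrite !mulrA -mulrDl ler_wpM2r//.
      have -> : u - z t = (u - v) + (v - z t) by ring.
      by have := sqr_ge0 ((u - v) - (v - z t)); nra.
  have k1 : intg leb (fun t => (zhat n (resid n w) t - zhat n (sample w) t) ^+ 2 * weight a t).
    by apply: eq_intg j1 => t; rewrite expr2.
  have k2 : intg leb (fun t => (zhat n (sample w) t - z t) ^+ 2 * weight a t).
    by apply: eq_intg j2 => t; rewrite expr2.
  rewrite RintD; [|exact: intgZ..]; rewrite (RintZ _ k1) (RintZ _ k2) lerD2r ler_wpM2l//.
  have iw := intg_growth_weight d (k + k) a0.
  rewrite /I -RintZ//; apply: Rint_le => [//||t]; first exact: intgZ.
  rewrite [leRHS]mulrA ler_wpM2r ?expR_ge0//.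
  have -> : (C * (dev n w * G2 n w)) ^+ 2 * growth t ^+ (k + k) =
      (C * growth t ^+ k * (dev n w * G2 n w)) ^+ 2 by rewrite exprD; ring.
  rewrite -[leLHS]real_normK ?num_real// lerXn2r ?nnegrE//; last exact: (hC n (sample w) t small).
  apply: mulr_ge0; first by rewrite mulr_ge0// growth_pow_ge0.
  by apply: mulr_ge0; [exact: sample_dev_ge0|apply: smean_ge0 => j; exact: growth_pow_ge0].
have dO := OP_dev X_iid i4 mean0 cov1.
have GO : OP P G2 := OP_smean X_iid i4.
apply: oPD; apply: oPZ; last exact: oP_zhat_iid.
apply: oP_sqrtM => //.
by apply: eq_OP (OPM dO (OPM GO GO)) => n w; rewrite expr2 -[LHS]mulrA.
Unshelve. all: by end_near. Qed.

Lemma smean_gamma n (y : nat -> 'cV[R]_d) :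
  intg leb (fun t => zhat n y t * (z t * weight a t)) /\
  \int[leb]_t (zhat n y t * (z t * weight a t)) = smean n (fun j => g (y j)).
Proof.
have [ig _ _] := tame_fubini i4 a0 (tame_weaken (leqnSn 1) (tame_gfun R d)).
have e t : zhat n y t * (z t * weight a t) =
    n%:R^-1 * \sum_(1 <= j < n.+1) (gfun (y j) t * (z t * weight a t)).
  by rewrite /zhat /smean -mulr_suml -[LHS]mulrA.
have isum : intg leb (fun t => \sum_(1 <= j < n.+1) (gfun (y j) t * (z t * weight a t))).
  by apply: intg_sum => j; exact: ig.
split; first by apply: eq_intg (intgZ n%:R^-1 isum) => t; rewrite e.
rewrite (eq_Rint _ e) RintZ// /smean; congr (_ * _).
by rewrite Rint_sum// => j; exact: ig.
Qed.

(** The identity Z^2 - z^2 = (Z - z)^2 + 2 z (Z - z), integrated against the weight. *)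
Lemma test_stat_decomposition n w : (0 < n)%N ->
  test_stat n (sample w) a / n%:R - Gamma_lim P (X 0%N) a =
  \int[leb]_t ((zhat n (resid n w) t - z t) ^+ 2 * weight a t) +
  2 * (smean n (fun j => g (resid n w j)) - \int[mu]_x g x).
Proof.
move=> n0; have [i1 e1] := smean_gamma n (resid n w).
have tz : tame 0 (fun _ t => z t) := tame_zfun i4 a0 0.
have th := tame_zhat n (resid n w) 0.
have i2 : intg leb (fun t => z t ^+ 2 * weight a t).
  by apply: eq_intg (tame_intg_t a0 (tameM tz tz)) => t; rewrite expr2.
have i3 : intg leb (fun t => zhat n (resid n w) t ^+ 2 * weight a t).
  by apply: eq_intg (tame_intg_t a0 (tameM th th)) => t; rewrite expr2.
have nz : n%:R != 0 :> R by rewrite pnatr_eq0 -lt0n.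
rewrite test_statE// mulrC mulKf// -/(resid n w) -(Gamma_limE i4 a0) -e1.
have -> : \int[leb]_t ((zhat n (resid n w) t - z t) ^+ 2 * weight a t) =
    \int[leb]_t (zhat n (resid n w) t ^+ 2 * weight a t) -
    2 * \int[leb]_t (zhat n (resid n w) t * (z t * weight a t)) + Gamma_lim P (X 0%N) a.
  rewrite -RintZ// -RintB//; last exact: intgZ.
  rewrite /Gamma_lim -RintD//; last by apply: intgB => //; exact: intgZ.
  by apply: eq_Rint => t; move: (weight a t) => W; rewrite /z; ring.
move: (\int[leb]_t _) (\int[leb]_t _) (Gamma_lim _ _ _) => p q r; ring.
Qed.

(** In [etaE] the part with [gamma] is centred by construction, and the corrections are centred
    because X has mean 0 and identity covariance. *)
Lemma eta_mean0 : \int[mu]_x eta (X 0%N) a x = 0.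
Proof.
have i1 (i : 'I_d) : intg mu (fun x : 'cV[R]_d => x i ord0).
  exact: (tame_intg_x i4 0 (tame_weaken (leqnSn 1) (@tame_xcoord R d i))).
have i2 (i k : 'I_d) : intg mu (fun x : 'cV[R]_d => x i ord0 * x k ord0).
  exact: (tame_intg_x i4 0 (tame_weaken (leqnSn 1) (@tame_xcoord2 R d i k))).
have ig : intg mu g.
  have [K K0 h] := gamma_bound i4 a0.
  apply: (intg_growth2 i4 (C := K)) => [|x]; first exact: measurable_gamma.
  by apply: le_trans (h x) _; rewrite ler_wpM2l// growth_sqr_ge.
pose A i k := \int[mu]_y (dgamma (X 0%N) a i y * y k ord0).
pose b i := \int[mu]_y dgamma (X 0%N) a i y.
have c0 (i k : 'I_d) : intg mu (fun x : 'cV[R]_d => A i k * (x i ord0 * x k ord0 - (i == k)%:R)) /\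
   \int[mu]_x (A i k * (x i ord0 * x k ord0 - (i == k)%:R)) = 0.
  have ic : intg mu (fun x : 'cV[R]_d => x i ord0 * x k ord0 - (i == k)%:R).
    by apply: intgB => //; exact: intg_cst.
  split; first exact: intgZ.
  by rewrite RintZ// RintB//; [rewrite cov1 Rint_cst subrr mulr0|exact: intg_cst].
have ic k : intg mu (fun x : 'cV[R]_d => \sum_i A k i * (x k ord0 * x i ord0 - (k == i)%:R)).
  by apply: intg_sum => i; exact: (c0 k i).1.
have icc : intg mu (fun x : 'cV[R]_d => \sum_k \sum_i A k i * (x k ord0 * x i ord0 - (k == i)%:R)).
  exact: intg_sum.
have ib : intg mu (fun x : 'cV[R]_d => \sum_i b i * x i ord0).
  by apply: intg_sum => i; exact: intgZ.
rewrite (eq_Rint _ (etaE i4 a0)).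
rewrite RintB//; last by apply: intgB; [apply: intgB => //; exact: intg_cst|exact: intgZ].
rewrite RintB//; [|by apply: intgB => //; exact: intg_cst|exact: intgZ].
rewrite RintB//; last exact: intg_cst.
rewrite Rint_cst subrr RintZ// Rint_sum// big1 => [|k _]; last first.
  rewrite Rint_sum => [|i]; last exact: (c0 k i).1.
  by rewrite big1// => i _; exact: (c0 k i).2.
rewrite mulr0 subrr Rint_sum => [|i]; last exact: intgZ.
by rewrite big1 ?subr0// => i _; rewrite RintZ// mean0 mulr0.
Qed.

Lemma measurable_resid n j : measurable_fun setT (fun w => resid n w j).
Proof.
have mX k : mmx (fun w => X k w : 'cV[R]_d).
  by move=> i l; apply: (measurableT_comp (measurable_coord i l)).
have mm : mmx (fun w => sample_mean n (sample w)).
  by apply: mmxZ => //; exact: mmx_sum.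
have mS : mmx (fun w => sample_cov n (sample w)).
  apply: mmxZ => //; apply: mmx_sum => k.
  have mXk := mmxB (mX k) mm.
  exact: (mmx_mul mXk (mmx_tr mXk)).
apply: measurable_fun_mx.
exact: (mmx_mul (mmx_invsqrt mS (fun w => sample_cov_psd n (sample w))) (mmxB (mX j) mm)).
Qed.

Lemma measurable_test_stat n : measurable_fun setT (fun w => test_stat n (sample w) a).
Proof.
under eq_fun do rewrite test_statE//.
apply: measurable_funM => //.
pose kk (p : T * 'cV[R]_d) := zhat n (fun j => resid n p.1 j) p.2 ^+ 2 * weight a p.2.
apply: (@measurable_Rint2 _ _ _ _ _ leb kk) => [|p].
  apply: measurable_funM; last by apply: measurableT_comp => //; exact: measurable_weight.
  apply: measurable_funX.
  exact: (measurable_zhat2 n (Y := fun j w => resid n w j) (measurable_resid n)).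
by rewrite mulr_ge0 ?sqr_ge0// expR_ge0.
Qed.

(** The central limit theorem is applied to [u], twice [eta]: the quadratic part is o_P(1), the
    linear part is [oP_linear] doubled, and [sigma2E] recognises the variance. *)
Lemma test_stat_clt : cvg_in_distribution P
    (fun n w => Num.sqrt n%:R *
       (test_stat n (fun j => X j w) a / n%:R - Gamma_lim P (X 0%N) a))
    (normal_law (sigma2 P (X 0%N) a)).
Proof.
pose u x := 2 * eta (X 0%N) a x.
have mu' : measurable_fun setT u by apply: measurable_funM => //; exact: measurable_eta.
have iu2 : intg mu (fun x => u x ^+ 2).
  have [K K0 h] := eta_bound i4 a0.
  apply: (intg_growth2 i4 (C := (2 * K) ^+ 2)) => [|x]; first exact: measurable_funX.
  rewrite normrX -exprMn lerXn2r ?nnegrE// ?mulr_ge0 ?growth_ge0//.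
  by rewrite normrM ger0_norm// -mulrA ler_wpM2l.
have ieta : intg mu (eta (X 0%N) a).
  have [K K0 h] := eta_bound i4 a0.
  apply: (intg_growth2 i4 (C := K)) => [|x]; first exact: measurable_eta.
  by apply: le_trans (h x) _; rewrite ler_wpM2l// growth_sqr_ge.
have iu : intg mu u by exact: intgZ.
rewrite (sigma2E i4 a0) -(RintX iu2).
apply: (cvg_in_law_clt X_iid mu' (intgX iu2)).
- by rewrite (RintX iu) RintZ// eta_mean0 mulr0.
- near=> n; apply: measurable_funM => //; apply: measurable_funB => //.
  by apply: measurable_funM => //; exact: measurable_test_stat.
apply: (oP_near _ (oPD oP_quadratic (oPZ 2 (oP_linear X_iid i4 mean0 cov1 a0)))).
near=> n => w; have n0 : (0 < n)%N by near: n; exact: nbhs_infty_gt.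
rewrite (test_stat_decomposition w n0).
have s0 : Num.sqrt n%:R != 0 :> R by rewrite sqrtr_eq0 -ltNge ltr0n.
have -> : (Num.sqrt n%:R)^-1 * \sum_(1 <= j < n.+1) u (X j w) =
    Num.sqrt n%:R * (2 * smean n (fun j => eta (X 0%N) a (X j w))).
  rewrite -smeanZ /smean mulrA; congr (_ * _).
  by rewrite -[X in _ = _ / X](@sqr_sqrtr _ n%:R)// expr2 invfM mulVKf.
have aux (s V p c e : R) : s * V + 2 * (s * (p - c - e)) = s * (V + 2 * (p - c)) - s * (2 * e).
  by ring.
exact: aux.
Unshelve. all: by end_near. Qed.

End limit_theorem.

Lemma intg_growth_sqr (R : realType) (d : nat) dT (T : measurableType dT)
    (P : probability T R) (Y : {RV P >-> 'cV[R]_d}) :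
  ('E_P[fun w => (enorm (Y w) ^+ 4)%R] < +oo)%E ->
  intg (distribution P Y) (fun x => growth x ^+ 2).
Proof.
rewrite unlock => mom.
have m4 : measurable_fun setT (fun x : 'cV[R]_d => enorm x ^+ 4).
  by apply: measurable_funX; exact: measurable_enorm.
have i4 : intg P (fun w => enorm (Y w) ^+ 4).
  apply: intg_ge0 => // [|w]; first exact: (measurableT_comp m4).
  by rewrite exprn_ge0 ?enorm_ge0.
have mg : measurable_fun setT (fun x : 'cV[R]_d => growth x ^+ 2).
  by apply: measurable_funX; exact: measurable_growth.
apply/(intg_distr Y mg).
apply: intg_dom (intgD (intg_cst P 2) (intgZ 2 i4)) _ => [|w].
  exact: (measurableT_comp mg).
rewrite ger0_norm ?sqr_ge0// /growth.
have -> : enorm (Y w) ^+ 4 = (enorm (Y w) ^+ 2) ^+ 2 by rewrite -exprM.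
by have := sqr_ge0 (1 - enorm (Y w) ^+ 2); nra.
Qed.

(* [X 0] is the generic vector X, and X 1, X 2, ... is the sample. *)
Theorem theorem4p4 (R : realType) (d : nat) (hd : (0 < d)%N)
    (dT : measure_display) (T : measurableType dT) (P : probability T R)
    (a : R) (ha : 0 < a) (X : nat -> {RV P >-> 'cV[R]_d})
    (X_iid : iid X)
    (X_ac : distribution P (X 0%N) `<< lebesgue_cV d)
    (X_mom4 : ('E_P[fun w => (enorm (X 0%N w) ^+ 4)%R] < +oo)%E)
    (X_mean : mx_expect P (X 0%N) = 0)
    (X_cov : mx_expect P (fun w => X 0%N w *m (X 0%N w)^T) = 1%:M) :
  cvg_in_distribution P
    (fun n w => Num.sqrt n%:R *
       (test_stat n (fun j => X j w) a / n%:R - Gamma_lim P (X 0%N) a))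
    (normal_law (sigma2 P (X 0%N) a)).
Proof.
have i4 := intg_growth_sqr X_mom4.
have i1 (i : 'I_d) : intg (distribution P (X 0%N)) (fun x : 'cV[R]_d => x i ord0).
  exact: (tame_intg_x i4 0 (tame_weaken (leqnSn 1) (@tame_xcoord R d i))).
have i2 (i k : 'I_d) :
    intg (distribution P (X 0%N)) (fun x : 'cV[R]_d => x i ord0 * x k ord0).
  exact: (tame_intg_x i4 0 (tame_weaken (leqnSn 1) (@tame_xcoord2 R d i k))).
apply: test_stat_clt => // [i|i k].
- rewrite -(expectE (intg_measurable (i1 i)) (i1 i)).
  by have := congr1 (fun M : 'cV[R]_d => M i ord0) X_mean; rewrite !mxE.
- rewrite -(expectE (intg_measurable (i2 i k)) (i2 i k)).
  have := congr1 (fun M : 'M[R]_d => M i k) X_cov; rewrite !mxE => <-.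
  by congr expect; apply/funext => w; rewrite mxE big_ord1 mxE.
Qed.
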